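(* Let $X$ be a Hilbert space and $U$ a Banach space. Let $A=A^*$ be a self-adjoint operator on $X$ generating an exponentially stable semigroup $T=(T(t))_{t\ge0}$, and let $B\in L(U,X_{-1+q})$ be such that $(-A)^qB$ is $C$-admissible, with $q\in[0,\frac12]$. Then the function $$W_q(x)=\int_0^\infty\big\|(-A)^qT(t)x\big\|^2\,dt=\tfrac12\langle x,(-A)^{2q-1}x\rangle=\tfrac12\big\|(-A)^{q-\frac12}x\big\|^2,\qquad x\in X,$$ is a quadratic non-coercive $L^2$-ISS Lyapunov function for $\Sigma(A,B)$. It is even coercive if $q=\frac12$, in which case $W_{\frac12}(x)=\frac12\|x\|^2$. In particular, if $\dim U<\infty$, the assumption that $(-A)^qB$ is $C$-admissible is automatically satisfied.
   Context: ''Non-coercive'' means ''not necessarily coercive''. $L(X,Y)$ denotes the bounded linear operators from $X$ to $Y$, $L(X)=L(X,X)$. $\mathcal K_\infty$ is the set of continuous, strictly increasing $\theta:[0,\infty)\to[0,\infty)$ with $\theta(0)=0$, $\lim_{r\to\infty}\theta(r)=\infty$. $X_{-1}$ is the completion of $X$ with respect to $\|x\|_{X_{-1}}=\|(aI-A)^{-1}x\|_X$ for some $a$ in the resolvent set of $A$; $T$ extends uniquely to a strongly continuous semigroup $T_{-1}$ on $X_{-1}$, with generator $A_{-1}$ extending $A$, $D(A_{-1})=X$. Fractional powers $(-A)^{\pm\alpha}$ are those of the sectorial (here positive self-adjoint, boundedly invertible) operator $-A$; $(-A)^0=I$. $X_0=X$, and for $\alpha\in(0,1)$, $X_{-\alpha}=D((-A_{-1})^{1-\alpha})\subset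 X_{-1}$ with its graph norm (up to equivalence of norms the completion of $X$ with respect to $\|(-A)^{-\alpha}x\|_X$). The subscript $-1$ is dropped for extensions; in particular $(-A)^qB$ denotes the composition of $B$ with the extension $(-A_{-1})^q:X_{-1+q}\to X_{-1}$, so $(-A)^qB\in L(U,X_{-1})$. For $B\in L(U,X_{-1})$, $\Sigma(A,B)$ denotes the system $\dot x(t)=Ax(t)+Bu(t)$, $x(0)=x_0$, with mild solution $\phi(t,x_0,u)=T(t)x_0+\int_0^tT_{-1}(t-s)Bu(s)\,ds$ (integral in $X_{-1}$). An operator $B\in L(U,X_{-1})$ is $C$-admissible (for $T$) if $\int_0^tT_{-1}(t-s)Bu(s)\,ds\in X$ for all $t\ge0$ and all $u\in C([0,t],U)$. Quadratic $L^2$-ISS Lyapunov function for $\Sigma(A,B)$ (where $B$ is $C$-admissible): a continuous $V:X\to[0,\infty)$ of the form $V(x)=\|Fx\|^2$ with an injective $F\in L(X)$, such that there is $\alpha_2\in\mathcal K_\infty$ with $0<V(x)\le\alpha_2(\|x\|)$ for $x\ne0$, and there are $a_3,a_4>0$ with $\dot V_u(x):=\limsup_{h\to0^+}\frac1h\big(V(\phi(h,x,u))-V(x)\big)\le-a_3\|x\|^2+a_4\|u(0)\|_U^2$ for all $x\in X$ and all $u\in C([0,\infty),U)$. It is coercive if there are $a_1,a_2>0$ with $a_1\|x\|^2\le V(x)\le a_2\|x\|^2$ for all $x\in X$. *)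

(* Defs.v *)
From Stdlib Require Export Reals.
From Coquelicot Require Export Coquelicot.
Open Scope R_scope.

Inductive RorC := RealScalars | ComplexScalars.

Definition scalars (k : RorC) : AbsRing :=
  match k with RealScalars => R_AbsRing | ComplexScalars => C_AbsRing end.

Definition inj (k : RorC) : R -> scalars k :=
  match k return R -> scalars k with
  | RealScalars => fun r => r
  | ComplexScalars => RtoC
  end.

Definition conj (k : RorC) : scalars k -> scalars k :=
  match k return scalars k -> scalars k with
  | RealScalars => fun r => r
  | ComplexScalars => Cconj
  end.

Lemma inj_plus k a b : inj k (a + b) = plus (inj k a) (inj k b).
Proof. destruct k; [reflexivity | exact (RtoC_plus a b)]. Qed.

Lemma inj_mult k a b : inj k (a * b) = mult (inj k a) (inj k b).
Proof. destruct k; [reflexivity | exact (RtoC_mult a b)]. Qed.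

Lemma inj_one k : inj k 1 = one.
Proof. destruct k; reflexivity. Qed.

Lemma abs_inj k r : abs (inj k r) = Rabs r.
Proof. destruct k; [reflexivity | exact (Cmod_R r)]. Qed.

(** A normed space over [scalars k], seen as a real one (same carrier, topology
    and norm): Coquelicot's Riemann integral is only available over R. *)
Section RestrictScalars.

Variables (k : RorC) (E : NormedModule (scalars k)).

Definition restrict_scal (r : R) (x : E) : E := scal (inj k r) x.

Lemma restrict_scal_assoc (a b : R) (x : E) :
  restrict_scal a (restrict_scal b x) = restrict_scal (mult a b) x.
Proof.
unfold restrict_scal; rewrite scal_assoc.
change (mult a b) with (a * b); now rewrite inj_mult.
Qed.

Lemma restrict_scal_one (x : E) : restrict_scal one x = x.
Proof.
unfold restrict_scal; change (@one R_Ring) with 1; rewrite inj_one.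
exact (scal_one x).
Qed.

Lemma restrict_scal_distr_l (a : R) (x y : E) :
  restrict_scal a (plus x y) = plus (restrict_scal a x) (restrict_scal a y).
Proof. exact (scal_distr_l (inj k a) x y). Qed.

Lemma restrict_scal_distr_r (a b : R) (x : E) :
  restrict_scal (plus a b) x = plus (restrict_scal a x) (restrict_scal b x).
Proof.
unfold restrict_scal; change (plus a b) with (a + b); rewrite inj_plus.
exact (scal_distr_r (inj k a) (inj k b) x).
Qed.

Lemma restrict_norm_scal (a : R) (x : E) :
  norm (restrict_scal a x) <= Rabs a * norm x.
Proof. rewrite <- (abs_inj k); exact (norm_scal (inj k a) x). Qed.

Definition restrict_ModuleSpace_mixin :=
  ModuleSpace.Mixin R_Ring E restrict_scal restrict_scal_assoc
    restrict_scal_one restrict_scal_distr_l restrict_scal_distr_r.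

Definition restrict_NormedModuleAux : NormedModuleAux R_AbsRing :=
  NormedModuleAux.Pack R_AbsRing E
    (NormedModuleAux.Class R_AbsRing E
       (ModuleSpace.Class R_Ring E (AbelianGroup.class E)
          restrict_ModuleSpace_mixin)
       (UniformSpace.class E))
    E.

Definition restrict_NormedModule_mixin :=
  NormedModule.Mixin R_AbsRing restrict_NormedModuleAux
    (@norm (scalars k) E) (@norm_factor (scalars k) E)
    norm_triangle restrict_norm_scal norm_compat1 norm_compat2
    norm_eq_zero.

Definition restrict_scalars : NormedModule R_AbsRing :=
  NormedModule.Pack R_AbsRing E
    (NormedModule.Class R_AbsRing E
       (NormedModuleAux.class R_AbsRing restrict_NormedModuleAux)
       restrict_NormedModule_mixin)
    E.

End RestrictScalars.

Arguments restrict_scalars {k} E.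

Definition is_RInt_over {k : RorC} {E : NormedModule (scalars k)}
    (f : R -> E) (a b : R) (I : E) : Prop :=
  @is_RInt (restrict_scalars E) f a b I.

Definition is_RInt_0_infty {k : RorC} {E : NormedModule (scalars k)}
    (f : R -> E) (I : E) : Prop :=
  @is_RInt_gen (restrict_scalars E) f (at_right 0) (Rbar_locally p_infty) I.

Record HilbertSpace (k : RorC) := {
  hilbert_carrier :> CompleteNormedModule (scalars k);
  inner : hilbert_carrier -> hilbert_carrier -> scalars k;
  inner_plus_l : forall x y z,
    inner (plus x y) z = plus (inner x z) (inner y z);
  inner_scal_l : forall a x y, inner (scal a x) y = mult a (inner x y);
  inner_conj_sym : forall x y, inner y x = conj k (inner x y);
  inner_norm : forall x, inner x x = inj k (norm x ^ 2)
}.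

Arguments inner {k h} _ _.

Definition dense {k : RorC} {E : NormedModule (scalars k)} (D : E -> Prop) :=
  forall (z : E) (eps : R), 0 < eps -> exists x, D x /\ norm (minus z x) < eps.

Definition finite_dim {k : RorC} (E : NormedModule (scalars k)) : Prop :=
  exists (n : nat) (e : nat -> E), forall x : E,
    exists c : nat -> scalars k, x = sum_n (fun i => scal (c i) (e i)) n.

(** An unbounded operator [A] is given by its graph: [A x y] means that
    [x] is in the domain of [A] and [A x = y].  A semigroup is a function on
    [R], of which only the values at [t >= 0] are constrained. *)

Definition self_adjoint {k : RorC} {X : HilbertSpace k}
    (A : X -> X -> Prop) : Prop :=
  dense (fun x => exists y, A x y) /\
  forall y z, A y z <-> (forall x x', A x x' -> inner x' y = inner x z).

Record C0_semigroup {k : RorC} {E : NormedModule (scalars k)}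
    (T : R -> E -> E) : Prop := {
  sg_linear : forall t, 0 <= t -> is_linear (T t);
  sg_zero : forall x, T 0 x = x;
  sg_plus : forall s t x, 0 <= s -> 0 <= t -> T (s + t) x = T s (T t x);
  sg_cont : forall x, filterlim (fun t => T t x) (at_right 0) (locally x)
}.

Definition exponentially_stable {k : RorC} {E : NormedModule (scalars k)}
    (T : R -> E -> E) : Prop :=
  exists M w, 0 < w /\
    forall t x, 0 <= t -> norm (T t x) <= M * exp (- w * t) * norm x.

Definition generates {k : RorC} {E : NormedModule (scalars k)}
    (A : E -> E -> Prop) (T : R -> E -> E) : Prop :=
  forall x y, A x y <->
    filterlim (fun h => scal (inj k (/ h)) (minus (T h x) x))
      (at_right 0) (locally y).

(** [Ra] is the bounded everywhere defined inverse of [a - A]. *)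
Definition is_resolvent {k : RorC} {E : NormedModule (scalars k)}
    (A : E -> E -> Prop) (a : scalars k) (Ra : E -> E) : Prop :=
  is_linear Ra /\
  forall x y, y = Ra x <-> A y (minus (scal a y) x).

(** For the generator [A] of an exponentially stable semigroup [T] and
    [alpha > 0],
      [(-A)^(-alpha) x = 1 / Gamma alpha * int_0^oo t^(alpha - 1) T t x dt],
    [(-A)^alpha] is the inverse of the injective operator [(-A)^(-alpha)], and
    [(-A)^0 = I].  [A] enters only through [T], which it determines. *)

Definition Gamma (alpha : R) : R :=
  RInt_gen (fun t => Rpower t (alpha - 1) * exp (- t))
    (at_right 0) (Rbar_locally p_infty).

Definition neg_frac_pow {k : RorC} {E : NormedModule (scalars k)}
    (T : R -> E -> E) (alpha : R) (x y : E) : Prop :=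
  exists I : E,
    is_RInt_0_infty (fun t => scal (inj k (Rpower t (alpha - 1))) (T t x)) I /\
    y = scal (inj k (/ Gamma alpha)) I.

(** [frac_pow T s x y]: [x] is in the domain of [(-A)^s] and [(-A)^s x = y],
    where [A] is the generator of [T]. *)
Definition frac_pow {k : RorC} {E : NormedModule (scalars k)}
    (T : R -> E -> E) (s : R) (x y : E) : Prop :=
  (s < 0 /\ neg_frac_pow T (- s) x y) \/
  (s = 0 /\ x = y) \/
  (0 < s /\ neg_frac_pow T s y x).

(** [Xm1] with the embedding [i] is a completion of [X] for the norm
    [x |-> norm ((a - A)^(-1) x)], for some [a] in the resolvent set of [A]. *)
Definition is_extrapolation_space {k : RorC} {X : NormedModule (scalars k)}
    (A : X -> X -> Prop) (Xm1 : CompleteNormedModule (scalars k))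
    (i : X -> Xm1) : Prop :=
  is_linear i /\
  dense (fun z => exists x, z = i x) /\
  exists a Ra, is_resolvent A a Ra /\ forall x, norm (i x) = norm (Ra x).

Definition is_extrapolated_semigroup {k : RorC}
    {X Xm1 : NormedModule (scalars k)} (i : X -> Xm1)
    (T : R -> X -> X) (Tm1 : R -> Xm1 -> Xm1) : Prop :=
  C0_semigroup Tm1 /\ forall t x, 0 <= t -> Tm1 t (i x) = i (T t x).

(** [B] is a bounded operator from [U] to [X_(-1+q)], i.e. to the domain of
    [(-A_{-1})^q] in [Xm1] with its graph norm. *)
Definition bounded_into_frac_dom {k : RorC} {U Xm1 : NormedModule (scalars k)}
    (Tm1 : R -> Xm1 -> Xm1) (q : R) (B : U -> Xm1) : Prop :=
  is_linear B /\
  (forall u, exists y, frac_pow Tm1 q (B u) y) /\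
  exists M, forall u y, frac_pow Tm1 q (B u) y ->
    norm (B u) + norm y <= M * norm u.

Definition is_input_integral {k : RorC} {U Xm1 : NormedModule (scalars k)}
    (Tm1 : R -> Xm1 -> Xm1) (B : U -> Xm1) (u : R -> U) (t : R) (z : Xm1) :=
  is_RInt_over (fun s => Tm1 (t - s) (B (u s))) 0 t z.

(** The integrand is continuous, so the integral always exists in [Xm1]; what is
    asked is that it lies in [X]. *)
Definition C_admissible {k : RorC} {U X Xm1 : NormedModule (scalars k)}
    (i : X -> Xm1) (Tm1 : R -> Xm1 -> Xm1) (B : U -> Xm1) : Prop :=
  is_linear B /\
  forall (t : R) (u : R -> U), 0 <= t ->
    continuous_on (fun s => 0 <= s <= t) u ->
    exists x : X, is_input_integral Tm1 B u t (i x).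

Definition is_mild_solution {k : RorC} {U X Xm1 : NormedModule (scalars k)}
    (i : X -> Xm1) (T : R -> X -> X) (Tm1 : R -> Xm1 -> Xm1) (B : U -> Xm1)
    (x0 : X) (u : R -> U) (phi : R -> X) : Prop :=
  forall t, 0 <= t -> exists z,
    is_input_integral Tm1 B u t z /\ i (phi t) = plus (i (T t x0)) z.

Record K_infty (theta : R -> R) : Prop := {
  K_nonneg : forall r, 0 <= r -> 0 <= theta r;
  K_cont : continuous_on (fun r => 0 <= r) theta;
  K_incr : forall r s, 0 <= r -> r < s -> theta r < theta s;
  K_zero : theta 0 = 0;
  K_lim : is_lim theta p_infty p_infty
}.

Definition limsup_0_right (g : R -> R) : Rbar :=
  Rbar_glb (fun s => exists d, 0 < d /\
    s = Lub_Rbar (fun v => exists h, 0 < h < d /\ v = g h)).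

Record quadratic_L2_ISS_Lyapunov {k : RorC} {U X Xm1 : NormedModule (scalars k)}
    (i : X -> Xm1) (T : R -> X -> X) (Tm1 : R -> Xm1 -> Xm1) (B : U -> Xm1)
    (V : X -> R) : Prop := {
  lyap_admissible : C_admissible i Tm1 B;
  lyap_continuous : forall x, continuous V x;
  lyap_quadratic : exists F : X -> X,
    is_linear F /\ (forall x y, F x = F y -> x = y) /\
    forall x, V x = norm (F x) ^ 2;
  lyap_bounds : exists alpha2, K_infty alpha2 /\
    forall x, x <> zero -> 0 < V x <= alpha2 (norm x);
  lyap_decay : exists a3 a4, 0 < a3 /\ 0 < a4 /\
    forall (x : X) (u : R -> U) (phi : R -> X),
      continuous_on (fun s => 0 <= s) u ->
      is_mild_solution i T Tm1 B x u phi ->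
      Rbar_le (limsup_0_right (fun h => 1 / h * (V (phi h) - V x)))
        (- a3 * norm x ^ 2 + a4 * norm (u 0) ^ 2)
}.

Definition coercive {k : RorC} {X : NormedModule (scalars k)} (V : X -> R) :=
  exists a1 a2, 0 < a1 /\ 0 < a2 /\
    forall x, a1 * norm x ^ 2 <= V x <= a2 * norm x ^ 2.

(** [w] is the integral over [(0,oo)] of [norm ((-A)^q (T t x)) ^ 2]; in
    particular [T t x] is in the domain of [(-A)^q] for all [t > 0]. *)
Definition is_energy_integral {k : RorC} {X : NormedModule (scalars k)}
    (T : R -> X -> X) (q : R) (x : X) (w : R) : Prop :=
  exists g : R -> X,
    (forall t, 0 < t -> frac_pow T q (T t x) (g t)) /\
    is_RInt_gen (fun t => norm (g t) ^ 2) (at_right 0) (Rbar_locally p_infty) w.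

(* Main.v *)
(** Since [T] is symmetric, [f t = <T t x, x> = |T (t/2) x|^2] is nonnegative and
    nonincreasing. Hence [|T t x| <= |(-A)^(-1) x| / t], so that [T t] factors
    through [(-A)^(-1)], and Tonelli's theorem for [f] gives the semigroup law
    of the powers [(-A)^(-a)].

    With [g t = (-A)^q (T t x)], the derivative of [W_q (T t x)] is [- |g t|^2],
    and [|g|] is nonincreasing. A mild solution is [T h x + (-A)^(-q) z], where
    [z] is the response of [(-A)^q B], and
      [W_q (T h x + (-A)^(-q) z) - W_q x
         <= - h |g h|^2 + <g h, (-A)^(-1) z> + 1/2 <z, (-A)^(-1) z>].
    Here [(-A)^(-1) z] is the integral of a bounded integrand, hence of order
    [h |u|], and [|z| <= K |u|] by admissibility and uniform boundedness.

    If [U] has finite dimension, Gram-Schmidt reduces admissibility to scalar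
    inputs [c] multiplied by a fixed vector [b]. As
    [<A (T s b), A (T r b)> >= 0], the response to [c] is bounded by the response
    to the constant [sup |c|], and smooth inputs are treated by parts. *)

(* The powers are accessible only as vector-valued Riemann integrals over the reals. Scalars are
   therefore restricted to the reals and the inner product to its real part; identities for [inner]
   are recovered by testing against all scalar multiples of a vector. Only the bounded powers
   [(-A)^(-a)], [a] in [[0,1]], occur as operators: a positive power is a preimage under an
   injective bounded one, and [- A (T t)] is the extension of [T t] along the range of [(-A)^(-1)].

   The extrapolation space is identified with [X] by [(-A_{-1})^(-1)], under which the embedding of
   [X] becomes [(-A)^(-1)]. Lying in [X] then means lying in the range of [(-A)^(-1)], and responses
   are computed in [X].

   Admissibility is purely qualitative: it gives a vector for each input and no estimate. A bound on
   [z] uniform in the length of the interval is what keeps the quadratic term of the energy balance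
   of order [h]. It is obtained at time 1, from the bounded operators [- A (T (1 / (n + 1)))], and
   transferred to short intervals afterwards. *)
Require Import Defs.
From Stdlib Require Import ssreflect Lra Psatz List Classical ClassicalEpsilon.

(** * Normed modules over the reals *)

Section VectorTactic.

Variable V : ModuleSpace R_Ring.

Inductive vexpr :=
  | VAtom (n : nat) | VZero | VPlus (a b : vexpr) | VOpp (a : vexpr)
  | VScal (r : R) (a : vexpr).

Fixpoint vden (env : list V) (e : vexpr) : V :=
  match e with
  | VAtom n => nth n env zero
  | VZero => zero
  | VPlus a b => plus (vden env a) (vden env b)
  | VOpp a => opp (vden env a)
  | VScal r a => scal r (vden env a)
  end.

Fixpoint vcoef (e : vexpr) (n : nat) : R :=
  match e with
  | VAtom m => if Nat.eqb m n then 1 else 0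
  | VZero => 0
  | VPlus a b => vcoef a n + vcoef b n
  | VOpp a => - vcoef a n
  | VScal r a => r * vcoef a n
  end.

Fixpoint vsum (env : list V) (c : nat -> R) : V :=
  match env with
  | nil => zero
  | x :: l => plus (scal (c 0%nat) x) (vsum l (fun n => c (S n)))
  end.

Lemma vsum_ext env c d : (forall n, c n = d n) -> vsum env c = vsum env d.
Proof. elim: env c d => [|x l IH] c d H //=; rewrite H; f_equal; by apply: IH. Qed.

Lemma vsum_0 env : vsum env (fun _ => 0) = zero.
Proof.
elim: env => [|x l IH] //=; rewrite IH plus_zero_r; exact: (scal_zero_l x).
Qed.

Lemma vsum_plus env c d :
  vsum env (fun n => c n + d n) = plus (vsum env c) (vsum env d).
Proof.
elim: env c d => [|x l IH] c d /=; first by rewrite plus_zero_r.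
rewrite (IH (fun n => c (S n))).
rewrite (scal_distr_r (c 0%nat : R_Ring) (d 0%nat : R_Ring)).
rewrite -!plus_assoc; f_equal; rewrite !plus_assoc; f_equal; exact: plus_comm.
Qed.

Lemma vsum_scal env r c : vsum env (fun n => r * c n) = scal r (vsum env c).
Proof.
elim: env c => [|x l IH] c /=; first by rewrite (scal_zero_r (r : R_Ring)).
rewrite (IH (fun n => c (S n))) scal_distr_l; f_equal.
symmetry; exact: scal_assoc.
Qed.

Lemma vden_vsum env e : vden env e = vsum env (vcoef e).
Proof.
elim: e => [n||a IHa b IHb|a IH|r a IH] /=.
- elim: env n => [|x l IH] [|n] //=.
  + by rewrite (vsum_0 l) plus_zero_r (scal_one x).
  + by rewrite (scal_zero_l x) plus_zero_l -IH.
- by rewrite vsum_0.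
- by rewrite IHa IHb vsum_plus.
- rewrite IH -(scal_opp_one (K := R_Ring)) -vsum_scal.
  apply: vsum_ext => n; change (opp (@one R_Ring)) with (- 1); ring.
- by rewrite IH vsum_scal.
Qed.

Lemma vden_eq env a b :
  vsum env (vcoef a) = vsum env (vcoef b) -> vden env a = vden env b.
Proof. by rewrite !vden_vsum. Qed.

End VectorTactic.

Ltac vec_pos x env :=
  match env with
  | cons x _ => constr:(0%nat)
  | cons _ ?l => let n := vec_pos x l in constr:(S n)
  end.
Ltac vec_add x env :=
  match env with
  | _ => let n := vec_pos x env in env
  | _ => constr:(cons x env)
  end.
Ltac vec_atoms e env :=
  match e with
  | @plus _ ?a ?b => let env := vec_atoms a env in vec_atoms b env
  | @minus _ ?a ?b => let env := vec_atoms a env in vec_atoms b env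
  | @opp _ ?a => vec_atoms a env
  | @scal _ _ _ ?a => vec_atoms a env
  | @zero _ => env
  | _ => vec_add e env
  end.
Ltac vec_reify e env :=
  match e with
  | @plus _ ?a ?b =>
      let a := vec_reify a env in let b := vec_reify b env in
      constr:(VPlus a b)
  | @minus _ ?a ?b =>
      let a := vec_reify a env in let b := vec_reify b env in
      constr:(VPlus a (VOpp b))
  | @opp _ ?a => let a := vec_reify a env in constr:(VOpp a)
  | @scal _ _ ?r ?a => let a := vec_reify a env in constr:(VScal r a)
  | @zero _ => constr:(VZero)
  | _ => let n := vec_pos e env in constr:(VAtom n)
  end.

(** Decides linear identities in a real vector space, up to [field] on the
    coefficients. *)
Ltac vec :=
  match goal with
  | |- @eq ?T ?x ?y =>
      let T := eval cbn in T in
      let V := open_constr:(_) in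
      unify T (ModuleSpace.sort R_Ring V);
      let env := vec_atoms x (@nil T) in
      let env := vec_atoms y env in
      let a := vec_reify x env in
      let b := vec_reify y env in
      change (vden V env a = vden V env b); apply vden_eq;
      cbn [vsum vcoef Nat.eqb];
      repeat (apply (f_equal2 plus);
              [apply (f_equal2 scal);
               [match goal with |- @eq _ ?a ?b => change (@eq R a b) end;
                try change (@one R_Ring) with 1; try ring; try (field; lra) | reflexivity]|]);
      try reflexivity
  end.


(** Coquelicot reaches the algebraic structures of a normed module along
    several convertible paths, which [lra] takes for distinct. *)
Ltac norm_monoid M :=
  lazymatch M with
  | NormedModule.AbelianMonoid _ _ => fail
  | _ =>
    let T := eval cbn in (AbelianMonoid.sort M) in
    let V := open_constr:(_) in
    unify T (NormedModule.sort R_AbsRing V);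
    change M with (NormedModule.AbelianMonoid R_AbsRing V) in *
  end.
Ltac norm_group M :=
  lazymatch M with
  | NormedModule.AbelianGroup _ _ => fail
  | _ =>
    let T := eval cbn in (AbelianGroup.sort M) in
    let V := open_constr:(_) in
    unify T (NormedModule.sort R_AbsRing V);
    change M with (NormedModule.AbelianGroup R_AbsRing V) in *
  end.
Ltac norm_module M :=
  lazymatch M with
  | NormedModule.ModuleSpace _ _ => fail
  | _ =>
    let T := eval cbn in (ModuleSpace.sort R_Ring M) in
    let V := open_constr:(_) in
    unify T (NormedModule.sort R_AbsRing V);
    change M with (NormedModule.ModuleSpace R_AbsRing V) in *
  end.
Ltac one_path :=
  repeat match goal with
  | H : context [@plus ?M _ _] |- _ => norm_monoid M
  | |- context [@plus ?M _ _] => norm_monoid M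
  | H : context [@zero ?M] |- _ => norm_monoid M
  | |- context [@zero ?M] => norm_monoid M
  | H : context [@minus ?M _ _] |- _ => norm_group M
  | |- context [@minus ?M _ _] => norm_group M
  | H : context [@opp ?M _] |- _ => norm_group M
  | |- context [@opp ?M _] => norm_group M
  | H : context [@scal _ ?M _ _] |- _ => norm_module M
  | |- context [@scal _ ?M _ _] => norm_module M
  end.
Ltac nlra := one_path; lra.
Ltac nnra := one_path; nra.

Lemma inv_INR_small e : 0 < e ->
  exists N, forall n, (N <= n)%nat -> / (INR n + 1) < e.
Proof.
move=> he; have [N [hN hN0]] := archimed_cor1 e he; exists N => n hn'.
have h1 := le_INR _ _ hn'; have h0 := lt_0_INR _ hN0.
apply: Rle_lt_trans hN; apply: Rinv_le_contravar; lra.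
Qed.

Section NormedModules.

Variables V W : NormedModule R_AbsRing.

(** The axioms give only one inequality; applied to the inverse scalar, it gives the other. *)
Lemma norm_scal_eq (r : R) (x : V) : norm (scal r x) = Rabs r * norm x.
Proof.
apply: Rle_antisym; first exact: norm_scal.
case: (Req_dec r 0) => [->|hr].
  rewrite Rabs_R0 Rmult_0_l; exact: norm_ge_0.
have -> : norm x = norm (scal (/ r) (scal r x)) by f_equal; vec.
have h := norm_scal (/ r) (scal r x).
have h2 : abs (/ r) = / Rabs r by rewrite -Rabs_inv.
rewrite h2 in h.
have hp : 0 < Rabs r by apply: Rabs_pos_lt.
apply: Rle_trans (Rmult_le_compat_l _ _ _ (Rlt_le _ _ hp) h) _.
by rewrite -Rmult_assoc Rinv_r; [lra|apply: Rabs_no_R0].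
Qed.

Lemma norm_minus_sym (x y : V) : norm (minus x y) = norm (minus y x).
Proof. rewrite -norm_opp; f_equal; vec. Qed.

Lemma norm_minus_le (x y : V) : norm (minus x y) <= norm x + norm y.
Proof. rewrite -(norm_opp y); exact: norm_triangle. Qed.

Lemma norm_triangle_mid (x y z : V) :
  norm (minus x z) <= norm (minus x y) + norm (minus y z).
Proof.
have -> : minus x z = plus (minus x y) (minus y z) by vec.
exact: norm_triangle.
Qed.

Lemma norm_le_minus (x y : V) : norm x <= norm (minus x y) + norm y.
Proof.
have {1}-> : x = plus (minus x y) y by vec.
exact: norm_triangle.
Qed.

Lemma norm_small_eq (x y : V) :
  (forall e, 0 < e -> norm (minus x y) <= e) -> x = y.
Proof.
move=> h; have h0 : norm (minus x y) = 0.
  apply: Rle_antisym; last exact: norm_ge_0.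
  by apply: Rle_plus_epsilon => e he; rewrite Rplus_0_l; apply: h.
have -> : x = plus (minus x y) y by vec.
by rewrite (norm_eq_zero _ h0) plus_zero_l.
Qed.

Lemma filterlim_normP {T : Type} (F : (T -> Prop) -> Prop) {hF : Filter F}
    (f : T -> V) (l : V) :
  filterlim f F (locally l) <->
  forall e, 0 < e -> F (fun t => norm (minus (f t) l) < e).
Proof.
split.
- move=> h e he; have := proj1 (filterlim_locally_ball_norm f l) h (mkposreal e he).
  exact.
- move=> h; apply/filterlim_locally_ball_norm => e; exact: (h e (cond_pos e)).
Qed.

Lemma continuous_normP (f : R -> V) (t : R) :
  continuous f t <->
  forall e, 0 < e -> exists d, 0 < d /\
    forall s, Rabs (s - t) < d -> norm (minus (f s) (f t)) < e.
Proof.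
split.
- move=> h e he.
  have [d hd] := proj1 (filterlim_normP _ _ _) h e he.
  by exists d; split; [exact: cond_pos|move=> s hs; apply: hd].
- move=> h; apply/filterlim_normP => e he.
  have [d [hd hs]] := h e he.
  by exists (mkposreal d hd) => s; apply: hs.
Qed.

Lemma is_linear_intro (L : V -> W) (M : R) :
  (forall x y, L (plus x y) = plus (L x) (L y)) ->
  (forall (r : R) x, L (scal r x) = scal r (L x)) ->
  (forall x, norm (L x) <= M * norm x) -> is_linear L.
Proof.
move=> h1 h2 h3; split=> //; exists (Rabs M + 1); split.
  have := Rabs_pos M; lra.
move=> x; have := h3 x; have := norm_ge_0 x; have := Rle_abs M; nra.
Qed.

Lemma Riemann_sum_linear (L : V -> W) (hL : is_linear L) (f : R -> V) ptd :
  Riemann_sum (fun t => L (f t)) ptd = L (Riemann_sum f ptd).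
Proof.
move: ptd; apply: SF_cons_ind => [x0|h s IH].
  by rewrite /Riemann_sum /= (linear_zero L).
by rewrite !Riemann_sum_cons IH linear_plus // linear_scal.
Qed.

Lemma is_RInt_linear (L : V -> W) (hL : is_linear L) (f : R -> V) (a b : R)
    (I : V) : is_RInt f a b I -> is_RInt (fun t => L (f t)) a b (L I).
Proof.
move=> hf; rewrite /is_RInt.
apply: (filterlim_ext (fun ptd => L (scal (sign (b - a)) (Riemann_sum f ptd)))).
  by move=> ptd; rewrite Riemann_sum_linear // linear_scal.
apply: filterlim_comp; [exact: hf|exact: linear_cont].
Qed.

Lemma is_RInt_gen_linear (L : V -> W) (hL : is_linear L) (f : R -> V) Fa Fb
    (I : V) :
  is_RInt_gen f Fa Fb I -> is_RInt_gen (fun t => L (f t)) Fa Fb (L I).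
Proof.
move=> hf P hP.
have hQ : locally I (fun y => P (L y)) by apply: (linear_cont L I hL).
case: (hf _ hQ) => Q R hQa hRb h.
exists Q R => // a b ha hb.
have [y [hy1 hy2]] := h a b ha hb.
by exists (L y); split=> //; apply: is_RInt_linear.
Qed.

Lemma is_RInt_eq (f : R -> V) (a b : R) (I J : V) :
  is_RInt f a b I -> is_RInt f a b J -> I = J.
Proof. move=> hI hJ; exact: (filterlim_locally_unique _ I J hI hJ). Qed.

End NormedModules.

(** The value at [y] is the limit of [P x] as [i x] tends to [y]. *)
Lemma dense_extension (X Y : NormedModule R_AbsRing)
    (Z : CompleteNormedModule R_AbsRing) (i : X -> Y) (P : X -> Z) (C : R) :
  (forall x y, i (plus x y) = plus (i x) (i y)) ->
  (forall (r : R) x, i (scal r x) = scal r (i x)) ->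
  (forall x y, P (plus x y) = plus (P x) (P y)) ->
  (forall (r : R) x, P (scal r x) = scal r (P x)) ->
  (forall x, norm (P x) <= C * norm (i x)) ->
  (forall y e, 0 < e -> exists x, norm (minus y (i x)) < e) ->
  exists J : Y -> Z, is_linear J /\ forall x, J (i x) = P x.
Proof.
move=> i_plus i_scal P_plus P_scal hC0 hd.
(* [C] may be zero or negative; [D] is a positive bound by which one can divide. *)
pose D := Rabs C + 1.
have hD : 0 < D by rewrite /D; have := Rabs_pos C; nlra.
have hC x : norm (P x) <= D * norm (i x).
  rewrite /D; have := hC0 x; have := norm_ge_0 (i x); have := Rle_abs C; nnra.
have i_minus x y : i (minus x y) = minus (i x) (i y).
  rewrite /minus i_plus -(scal_opp_one y) i_scal; f_equal; exact: scal_opp_one.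
have P_minus x y : P (minus x y) = minus (P x) (P y).
  rewrite /minus P_plus -(scal_opp_one y) P_scal; f_equal; exact: scal_opp_one.
have lip x y : norm (minus (P x) (P y)) <= D * norm (minus (i x) (i y)).
  by rewrite -P_minus -i_minus.
(* The value at [y] is characterised by an estimate against every [P x]. This estimate is all that
   the proof of linearity uses, so the approximating sequence can be forgotten. *)
have ex y : exists z, forall x, norm (minus z (P x)) <= D * norm (minus y (i x)).
  have hn (n : nat) : exists x, norm (minus y (i x)) < / (INR n + 1).
    by apply: hd; apply: Rinv_0_lt_compat; have := pos_INR n; nlra.
  pose u n := proj1_sig (constructive_indefinite_description _ (hn n)).
  have hu n : norm (minus y (i (u n))) < / (INR n + 1).
    exact: (proj2_sig (constructive_indefinite_description _ (hn n))).
  have tri n x : norm (minus (P (u n)) (P x)) <=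
      D * (/ (INR n + 1) + norm (minus y (i x))).
    apply: Rle_trans (lip _ _) _; apply: Rmult_le_compat_l; first nlra.
    apply: Rle_trans (norm_triangle_mid _ _ y _) _.
    rewrite norm_minus_sym; have := hu n; nlra.
  have cau : exists z, filterlim (fun n => P (u n)) eventually (locally z).
    apply/filterlim_locally_cauchy => e.
    have he : 0 < e / (2 * D).
      by apply: Rdiv_lt_0_compat; [exact: cond_pos|lra].
    have [N hN] := inv_INR_small _ he.
    exists (fun n => (N <= n)%nat); split; first by exists N.
    move=> n m h1 h2; apply: norm_compat1; rewrite norm_minus_sym.
    apply: Rle_lt_trans (tri _ _) _.
    have := hN n h1; have := hN m h2; have := hu m.
    set a := norm _; set b := / (INR n + 1); set c := / (INR m + 1) => h3 h4 h5.
    have -> : (e : R) = D * (e / (2 * D) + e / (2 * D)) by field; nlra.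
    apply: Rmult_lt_compat_l => //; nlra.
  have [z hz] := cau; exists z => x; apply: Rle_plus_epsilon => e he.
  have he' : 0 < e / (2 * D) by apply: Rdiv_lt_0_compat; nlra.
  have [N hN] := inv_INR_small _ he'.
  have [N' hN'] := proj1 (filterlim_normP _ _ _ _) hz (e / 2) ltac:(lra).
  pose n := Nat.max N N'.
  have h1 := hN n (Nat.le_max_l _ _).
  have h2 := hN' n (Nat.le_max_r _ _).
  have h3 := tri n x.
  have h4 := norm_triangle_mid _ z (P (u n)) (P x).
  rewrite norm_minus_sym in h2.
  have h5 : D * / (INR n + 1) <= e / 2.
    have -> : e / 2 = D * (e / (2 * D)) by field; nlra.
    by apply: Rmult_le_compat_l; nlra.
  nlra.
pose J y := proj1_sig (constructive_indefinite_description _ (ex y)).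
have hJ y x : norm (minus (J y) (P x)) <= D * norm (minus y (i x)).
  exact: (proj2_sig (constructive_indefinite_description _ (ex y))).
have Ji x : J (i x) = P x.
  apply: norm_small_eq => e he; apply: Rle_trans (hJ _ _) _.
  have -> : minus (i x) (i x) = zero by vec.
  rewrite norm_zero; nlra.
exists J; split=> //.
apply: (is_linear_intro _ _ _ D).
- move=> y y'; apply: norm_small_eq => e he.
  have he' : 0 < e / (4 * D) by apply: Rdiv_lt_0_compat; nlra.
  have [x hx] := hd y _ he'; have [x' hx'] := hd y' _ he'.
  have h1 := hJ (plus y y') (plus x x').
  have -> : minus (J (plus y y')) (plus (J y) (J y')) =
    minus (minus (J (plus y y')) (P (plus x x')))
      (plus (minus (J y) (P x)) (minus (J y') (P x'))) by rewrite P_plus; vec.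
  have h2 := norm_minus_le _ (minus (J (plus y y')) (P (plus x x')))
      (plus (minus (J y) (P x)) (minus (J y') (P x'))).
  have h3 := norm_triangle (minus (J y) (P x)) (minus (J y') (P x')).
  have h4 := hJ y x; have h5 := hJ y' x'.
  have h6 : norm (minus (plus y y') (i (plus x x'))) <=
      norm (minus y (i x)) + norm (minus y' (i x')).
    have -> : minus (plus y y') (i (plus x x')) =
       plus (minus y (i x)) (minus y' (i x')) by rewrite i_plus; vec.
    exact: norm_triangle.
  have h7 : D * (e / (4 * D)) = e / 4 by field; lra.
  have h8 := Rmult_le_compat_l D _ _ (Rlt_le _ _ hD) (Rlt_le _ _ hx).
  have h9 := Rmult_le_compat_l D _ _ (Rlt_le _ _ hD) (Rlt_le _ _ hx').
  have h10 := Rmult_le_compat_l D _ _ (Rlt_le _ _ hD) h6.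
  nlra.
- move=> r y; apply: norm_small_eq => e he.
  pose c := 2 * (Rabs r + 1) * D.
  have hr := Rabs_pos r.
  have hc : 0 < c by rewrite /c; nnra.
  have he' : 0 < e / c by apply: Rdiv_lt_0_compat; nlra.
  have [x hx] := hd y _ he'.
  have h1 := hJ (scal r y) (scal r x); have h2 := hJ y x.
  rewrite P_scal i_scal in h1.
  have e1 : minus (scal r y) (scal r (i x)) = scal r (minus y (i x)) by vec.
  rewrite e1 norm_scal_eq in h1.
  have -> : minus (J (scal r y)) (scal r (J y)) =
    minus (minus (J (scal r y)) (scal r (P x))) (scal r (minus (J y) (P x))) by vec.
  apply: Rle_trans (norm_minus_le _ _ _) _; rewrite norm_scal_eq.
  have h3 : 2 * ((Rabs r + 1) * D * (e / c)) = e by rewrite /c; field; nra.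
  have hrD : 0 < (Rabs r + 1) * D by nra.
  have h5 := Rmult_le_compat_l _ _ _ (Rlt_le _ _ hrD) (Rlt_le _ _ hx).
  have h4 : Rabs r * norm (minus (J y) (P x)) <=
      Rabs r * (D * norm (minus y (i x))) by apply: Rmult_le_compat_l.
  have h6 : norm (minus (scal r y) (scal r (i x))) = Rabs r * norm (minus y (i x)).
    by rewrite e1 norm_scal_eq.
  have h7 := norm_ge_0 (minus y (i x)).
  have h8 : 0 <= D * norm (minus y (i x)) by apply: Rmult_le_pos; lra.
  nnra.
- move=> y; apply: Rle_plus_epsilon => e he.
  have he' : 0 < e / (2 * D) by apply: Rdiv_lt_0_compat; nlra.
  have [x hx] := hd y _ he'.
  have h1 := hJ y x; have h2 := hC x.
  have h3 := norm_le_minus _ (J y) (P x).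
  have h4 := norm_le_minus _ (i x) y; rewrite norm_minus_sym in h4.
  have h5 : D * (e / (2 * D)) = e / 2 by field; lra.
  have h6 := Rmult_le_compat_l D _ _ (Rlt_le _ _ hD) (Rlt_le _ _ hx).
  have h7 := Rmult_le_compat_l D _ _ (Rlt_le _ _ hD) h4.
  nlra.
Qed.

Lemma linear_dense_eq {S : Type} {V W : NormedModule R_AbsRing} (i : S -> V)
    (L1 L2 : V -> W) :
  is_linear L1 -> is_linear L2 ->
  (forall x e, 0 < e -> exists y, norm (minus x (i y)) < e) ->
  (forall y, L1 (i y) = L2 (i y)) -> forall x, L1 x = L2 x.
Proof.
move=> h1 h2 hd h x; apply: norm_small_eq => e he.
have [M1 [hM1 b1]] := linear_norm _ h1; have [M2 [hM2 b2]] := linear_norm _ h2.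
have hq : 0 < e / (M1 + M2) by apply: Rdiv_lt_0_compat; lra.
have [y hy] := hd x _ hq.
have -> : minus (L1 x) (L2 x) = minus (L1 (minus x (i y))) (L2 (minus x (i y))).
  rewrite (linear_minus L1) // (linear_minus L2) // h; vec.
apply: Rle_trans (norm_minus_le _ _ _) _.
have := b1 (minus x (i y)); have := b2 (minus x (i y)).
have hp := Rmult_le_compat_l (M1 + M2) _ _ ltac:(lra) (Rlt_le _ _ hy).
have -> : e = (M1 + M2) * (e / (M1 + M2)) by field; lra.
lra.
Qed.

(** * Improper integrals over the half-line *)

Lemma ex_RInt_pos {V : CompleteNormedModule R_AbsRing} (f : R -> V) (a b : R) :
  (forall t, 0 < t -> continuous f t) -> 0 < a -> 0 < b -> ex_RInt f a b.
Proof.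
move=> hf ha hb; apply: ex_RInt_continuous => t [h _]; apply: hf.
by apply: Rlt_le_trans h; apply: Rmin_glb_lt.
Qed.

Notation improper f l := (is_RInt_gen f (at_right 0) (Rbar_locally p_infty) l).

Lemma at_right_0P (P : R -> Prop) :
  at_right 0 P <-> exists d, 0 < d /\ forall t, 0 < t < d -> P t.
Proof.
split.
- move=> [d hd]; exists d; split; first exact: cond_pos.
  move=> t ht; apply: (hd t _ (proj1 ht)).
  rewrite /ball /= /AbsRing_ball /= /abs /= /minus /plus /opp /=.
  rewrite Ropp_0 Rplus_0_r Rabs_pos_eq; lra.
- move=> [d [hd h]]; exists (mkposreal d hd) => t ht h0; apply: h; split=> //.
  move: ht; rewrite /ball /= /AbsRing_ball /= /abs /= /minus /plus /opp /=.
  rewrite Ropp_0 Rplus_0_r Rabs_pos_eq; lra.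
Qed.

(** The clause [d <= N] can always be enforced by enlarging [N]; it guarantees [a < b] for all the
    bounds concerned. *)
Lemma improperP (V : NormedModule R_AbsRing) (f : R -> V) (l : V) :
  improper f l <->
  forall e, 0 < e -> exists d N, 0 < d /\ d <= N /\
    forall a b, 0 < a < d -> N < b ->
      exists I, is_RInt f a b I /\ norm (minus I l) < e.
Proof.
split.
- move=> h e he.
  have hl : locally l (fun y => norm (minus y l) < e).
    apply: locally_le_locally_norm; exists (mkposreal e he) => y; exact.
  case: (h _ hl) => Q S /at_right_0P [d [hd hQ]] [N hN] hQS.
  exists d, (Rmax d N); split=> //; split; first exact: Rmax_l.
  move=> a b ha hb; apply: (hQS a b); first exact: hQ.
  apply: hN; apply: Rle_lt_trans hb; exact: Rmax_r.
- move=> h P /locally_norm_le_locally [e he].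
  have [d [N [hd [_ hab]]]] := h e (cond_pos e).
  exists (fun t => 0 < t < d) (fun t => N < t).
  + by apply/at_right_0P; exists d.
  + by exists N.
  + move=> a b ha hb; have [I [hI1 hI2]] := hab a b ha hb.
    by exists I; split=> //; apply: he.
Qed.

Lemma improper_eq (V : NormedModule R_AbsRing) (f : R -> V) (l m : V) :
  improper f l -> improper f m -> l = m.
Proof.
move=> /improperP hl /improperP hm; apply: norm_small_eq => e he.
have [d [N [hd [hdN h]]]] := hl (e / 2) ltac:(lra).
have [d' [N' [hd' [hdN' h']]]] := hm (e / 2) ltac:(lra).
pose a := Rmin d d' / 2; pose b := Rmax N N' + 1.
have ha : 0 < a /\ a < d /\ a < d'.
  have := Rmin_l d d'; have := Rmin_r d d'; have := Rmin_glb_lt _ _ _ hd hd'.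
  rewrite /a; lra.
have hb : N < b /\ N' < b by have := Rmax_l N N'; have := Rmax_r N N'; rewrite /b; lra.
have [I [h1 h2]] := h a b ltac:(lra) ltac:(lra).
have [J [h3 h4]] := h' a b ltac:(lra) ltac:(lra).
rewrite (is_RInt_eq _ _ _ _ _ _ h3 h1) in h4.
have := norm_triangle_mid _ l I m; rewrite (norm_minus_sym _ l I); lra.
Qed.

Lemma improper_ext (V : NormedModule R_AbsRing) (f g : R -> V) (l : V) :
  (forall t, 0 < t -> f t = g t) -> improper f l -> improper g l.
Proof.
move=> h /improperP hf; apply/improperP => e he.
have [d [N [hd [hdN hab]]]] := hf e he; exists d, N; split=> //; split=> //.
move=> a b ha hb; have [I [h1 h2]] := hab a b ha hb; exists I; split=> //.
apply: is_RInt_ext h1 => x; rewrite Rmin_left; last lra.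
by move=> hx; apply: h; lra.
Qed.

Lemma improper_plus (V : NormedModule R_AbsRing) (f g : R -> V) (l m : V) :
  improper f l -> improper g m ->
  improper (fun t => plus (f t) (g t)) (plus l m).
Proof. move=> hf hg; exact: (is_RInt_gen_plus f g l m hf hg). Qed.

Lemma improper_scal (V : NormedModule R_AbsRing) (f : R -> V) (c : R) (l : V) :
  improper f l -> improper (fun t => scal c (f t)) (scal c l).
Proof. move=> h; exact: (is_RInt_gen_scal f c l h). Qed.

Lemma improper_linear (V W : NormedModule R_AbsRing) (L : V -> W) (f : R -> V)
    (l : V) : is_linear L -> improper f l -> improper (fun t => L (f t)) (L l).
Proof. by move=> hL; apply: is_RInt_gen_linear. Qed.

Lemma RInt_mono_bounds (f : R -> R) (a0 a b b0 : R) :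
  (forall t, 0 < t -> continuous f t) -> (forall t, 0 < t -> 0 <= f t) ->
  0 < a0 -> a0 <= a -> a <= b -> b <= b0 ->
  RInt f a b <= RInt f a0 b0.
Proof.
move=> hf h0 ha0 ha hab hb.
have ex u v : 0 < u -> 0 < v -> ex_RInt f u v by exact: ex_RInt_pos.
have c1 := RInt_Chasles f a b b0 ltac:(apply: ex; lra) ltac:(apply: ex; lra).
have c2 := RInt_Chasles f a0 a b0 ltac:(apply: ex; lra) ltac:(apply: ex; lra).
have h1 : 0 <= RInt f a0 a.
  by apply: RInt_ge_0; [lra|apply: ex; lra|move=> x hx; apply: h0; lra].
have h2 : 0 <= RInt f b b0.
  by apply: RInt_ge_0; [lra|apply: ex; lra|move=> x hx; apply: h0; lra].
move: c1 c2; rewrite /plus /=; lra.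
Qed.

(** Integrals of a nonnegative function grow with the interval, so the improper integral is the
    supremum of the proper ones. Comparisons and the exchange of integrals are carried out in this
    form. *)
Lemma improper_nonnegP (f : R -> R) (l : R) :
  (forall t, 0 < t -> continuous f t) -> (forall t, 0 < t -> 0 <= f t) ->
  improper f l <->
  (forall a b, 0 < a < b -> RInt f a b <= l) /\
  (forall e, 0 < e -> exists a b, 0 < a < b /\ l - e < RInt f a b).
Proof.
move=> hf h0; split.
- move=> /improperP h; split.
  + move=> a b hab; apply: Rle_plus_epsilon => e he.
    have [d [N [hd [hdN hI]]]] := h e he.
    pose a' := Rmin a (d / 2); pose b' := Rmax b (N + 1).
    have ha' : 0 < a' by apply: Rmin_glb_lt; lra.
    have ha2 : a' < d by have := Rmin_r a (d / 2); rewrite -/a'; lra.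
    have hb2 : N < b' by have := Rmax_r b (N + 1); rewrite -/b'; lra.
    have [I [h1 h2]] := hI a' b' ltac:(lra) hb2.
    have h3 := RInt_mono_bounds f a' a b b' hf h0 ha' (Rmin_l _ _) ltac:(lra)
      (Rmax_l _ _).
    rewrite (is_RInt_unique _ _ _ _ h1) in h3.
    have := Rle_abs (I - l); move: h2.
    rewrite /norm /= /abs /= /minus /plus /opp /=; rewrite /Rminus; lra.
  + move=> e he; have [d [N [hd [hdN hI]]]] := h e he.
    have [I [h1 h2]] := hI (d / 2) (N + 1) ltac:(lra) ltac:(lra).
    exists (d / 2), (N + 1); split; first lra.
    rewrite (is_RInt_unique _ _ _ _ h1).
    have := Rle_abs (- (I - l)); rewrite Rabs_Ropp; move: h2.
    rewrite /norm /= /abs /= /minus /plus /opp /=; rewrite /Rminus; lra.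
- move=> [h1 h2]; apply/improperP => e he.
  have [a0 [b0 [hab h]]] := h2 e he.
  exists a0, b0; split; first lra; split; first lra.
  move=> a b ha hb; exists (RInt f a b); split.
    by apply: RInt_correct; apply: ex_RInt_pos => //; lra.
  have h3 := h1 a b ltac:(lra).
  have h4 := RInt_mono_bounds f a a0 b0 b hf h0 ltac:(lra) ltac:(lra) ltac:(lra)
    ltac:(lra).
  rewrite /norm /= /abs /= /minus /plus /opp /=; apply: Rabs_def1; lra.
Qed.

Lemma improper_nonneg_ex (f : R -> R) (L : R) :
  (forall t, 0 < t -> continuous f t) -> (forall t, 0 < t -> 0 <= f t) ->
  (forall a b, 0 < a < b -> RInt f a b <= L) ->
  exists l, improper f l.
Proof.
move=> hf h0 hL.
pose E x := exists a b, 0 < a < b /\ x = RInt f a b.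
have [l [hl1 hl2]] : {l | is_lub E l}.
  apply: completeness.
  - by exists L => x [a [b [hab ->]]]; apply: hL.
  - by exists (RInt f 1 2), 1, 2; split; first lra.
exists l; apply/improper_nonnegP => //; split.
  by move=> a b hab; apply: hl1; exists a, b.
move=> e he; apply: NNPP => hn.
have : l <= l - e; last lra.
apply: hl2 => x [a [b [hab ->]]]; apply: Rnot_lt_le => hlt.
by apply: hn; exists a, b.
Qed.

(** Both differences are sums of integrals over the two outer pieces, where [g] dominates [f]. The
    Cauchy property of the integrals of [g] thereby passes to those of [f]. *)
Lemma norm_RInt_extend {V : CompleteNormedModule R_AbsRing} (f : R -> V)
    (g : R -> R) (a0 a b b0 : R) :
  (forall t, 0 < t -> continuous f t) -> (forall t, 0 < t -> continuous g t) ->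
  (forall t, 0 < t -> norm (f t) <= g t) ->
  0 < a0 -> a0 <= a -> a <= b -> b <= b0 ->
  norm (minus (RInt f a0 b0) (RInt f a b)) <= RInt g a0 b0 - RInt g a b.
Proof.
move=> hf hg hfg ha0 ha hab hb.
have exf u v : 0 < u -> 0 < v -> ex_RInt f u v by exact: ex_RInt_pos.
have exg u v : 0 < u -> 0 < v -> ex_RInt g u v by exact: ex_RInt_pos.
have split_f : RInt f a0 b0 =
    plus (RInt f a0 a) (plus (RInt f a b) (RInt f b b0)).
  rewrite (RInt_Chasles f a b b0) ?RInt_Chasles //; apply: exf; lra.
have split_g : RInt g a0 b0 = RInt g a0 a + (RInt g a b + RInt g b b0).
  have h1 := RInt_Chasles g a b b0 ltac:(apply: exg; lra) ltac:(apply: exg; lra).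
  have h2 := RInt_Chasles g a0 a b0 ltac:(apply: exg; lra) ltac:(apply: exg; lra).
  move: h1 h2; rewrite /plus /=; lra.
have -> : minus (RInt f a0 b0) (RInt f a b) =
    plus (RInt f a0 a) (RInt f b b0) by rewrite split_f; vec.
have hn u v : a0 <= u -> u <= v -> norm (RInt f u v) <= RInt g u v.
  move=> hu huv; apply: (norm_RInt_le f g u v).
  - exact: huv.
  - by move=> x hx; apply: hfg; lra.
  - by apply: RInt_correct; apply: exf; lra.
  - by apply: RInt_correct; apply: exg; lra.
have := norm_triangle (RInt f a0 a) (RInt f b b0).
have := hn a0 a ltac:(lra) ltac:(lra); have := hn b b0 ltac:(lra) ltac:(lra).
rewrite split_g; nlra.
Qed.

Lemma improper_dominated {V : CompleteNormedModule R_AbsRing} (f : R -> V)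
    (g : R -> R) (lg : R) :
  (forall t, 0 < t -> continuous f t) -> (forall t, 0 < t -> continuous g t) ->
  (forall t, 0 < t -> norm (f t) <= g t) -> improper g lg ->
  exists l, improper f l /\ norm l <= lg.
Proof.
move=> hf hg hfg hlg.
have g0 t : 0 < t -> 0 <= g t.
  by move=> ht; apply: Rle_trans (hfg t ht); apply: norm_ge_0.
have [hg1 hg2] := proj1 (improper_nonnegP g lg hg g0) hlg.
have PF : ProperFilter (filter_prod (at_right 0) (Rbar_locally p_infty)).
  exact: filter_prod_proper.
have [l hl] : exists l, filterlim (fun ab => RInt f (fst ab) (snd ab))
    (filter_prod (at_right 0) (Rbar_locally p_infty)) (locally l).
  apply/filterlim_locally_cauchy => e.
  have [a [b [hab h]]] := hg2 (e / 2) ltac:(have := cond_pos e; lra).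
  exists (fun ab => 0 < fst ab < a /\ b < snd ab); split.
    exists (fun t => 0 < t < a) (fun t => b < t) => //.
    - by apply/at_right_0P; exists a; split; first lra.
    - by exists b.
  move=> [a1 b1] [a2 b2] /= h1 h2; apply: norm_compat1.
  have n1 := norm_RInt_extend f g a1 a b b1 hf hg hfg ltac:(lra) ltac:(lra)
    ltac:(lra) ltac:(lra).
  have n2 := norm_RInt_extend f g a2 a b b2 hf hg hfg ltac:(lra) ltac:(lra)
    ltac:(lra) ltac:(lra).
  have := norm_triangle_mid _ (RInt f a2 b2) (RInt f a b) (RInt f a1 b1).
  rewrite (norm_minus_sym _ (RInt f a b)).
  have := hg1 a1 b1 ltac:(lra); have := hg1 a2 b2 ltac:(lra); nlra.
have hfl : improper f l.
  apply/improperP => e he.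
  have [Q S /at_right_0P [d [hd hQ]] [N hN] hQS] :=
    proj1 (filterlim_normP _ _ _ _) hl e he.
  exists d, (Rmax d N); split=> //; split; first exact: Rmax_l.
  move=> a b ha hb; exists (RInt f a b).
  have hdb := Rle_lt_trans _ _ _ (Rmax_l d N) hb.
  have hNb := Rle_lt_trans _ _ _ (Rmax_r d N) hb.
  split; first by apply: RInt_correct; apply: ex_RInt_pos => //; lra.
  by apply: (hQS a b); [apply: hQ|apply: hN].
exists l; split=> //; apply: Rle_plus_epsilon => e he.
have [d [N [hd [hdN h]]]] := proj1 (improperP _ _ _) hfl e he.
have [I [h1 h2]] := h (d / 2) (N + 1) ltac:(lra) ltac:(lra).
have h3 : norm I <= RInt g (d / 2) (N + 1).
  apply: (norm_RInt_le f g (d / 2) (N + 1)) => //; first lra.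
  - by move=> x hx; apply: hfg; lra.
  - by apply: RInt_correct; apply: ex_RInt_pos => //; lra.
have := hg1 (d / 2) (N + 1) ltac:(lra).
have := norm_le_minus _ l I; rewrite norm_minus_sym; lra.
Qed.

(** Domination controls what remains outside [[a, b]]; this makes truncation errors uniform when [f]
    depends on a parameter and [g] does not. *)
Lemma improper_tail_le (f g : R -> R) (lf lg a b : R) :
  (forall t, 0 < t -> continuous f t) -> (forall t, 0 < t -> continuous g t) ->
  (forall t, 0 < t -> 0 <= f t <= g t) -> improper f lf -> improper g lg ->
  0 < a < b -> lf - RInt f a b <= lg - RInt g a b.
Proof.
move=> hf hg hfg hlf hlg hab.
have f0 t : 0 < t -> 0 <= f t by move=> ht; have := hfg t ht; lra.
have g0 t : 0 < t -> 0 <= g t by move=> ht; have := hfg t ht; lra.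
have [hg1 _] := proj1 (improper_nonnegP g lg hg g0) hlg.
have [hf1 hf2] := proj1 (improper_nonnegP f lf hf f0) hlf.
apply: Rle_plus_epsilon => e he; have [a' [b' [hab' h]]] := hf2 e he.
pose a0 := Rmin a a'; pose b0 := Rmax b b'.
have h1 : 0 < a0 by apply: Rmin_glb_lt; lra.
have h2 := Rmin_l a a'; have h3 := Rmin_r a a'; rewrite -/a0 in h2 h3.
have h4 := Rmax_l b b'; have h5 := Rmax_r b b'; rewrite -/b0 in h4 h5.
have hfg' t : 0 < t -> norm (f t) <= g t.
  move=> ht; rewrite /norm /= /abs /= Rabs_pos_eq; have := hfg t ht; lra.
have h6 := norm_RInt_extend (V := R_CompleteNormedModule) f g a0 a b b0 hf hg
  hfg' h1 h2 ltac:(lra) h4.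
have h7 := RInt_mono_bounds f a0 a' b' b0 hf f0 h1 h3 ltac:(lra) h5.
have := hg1 a0 b0 ltac:(lra).
have := Rle_abs (RInt f a0 b0 - RInt f a b).
move: h6; rewrite /norm /= /abs /= /minus /plus /opp /=; rewrite /Rminus; lra.
Qed.

(** * Exchange of improper integrals *)

Lemma continuous_RInt_param (h : R -> R -> R) (c d x : R) :
  c <= d -> (forall r, c <= r <= d -> continuity_2d_pt h x r) ->
  locally x (fun y => ex_RInt (h y) c d) ->
  continuous (fun y => RInt (h y) c d) x.
Proof.
move=> hcd hc [d1 hex]; apply/continuous_normP => e he.
(* The added 1 covers [c = d] and makes the final inequality strict. *)
have he' : 0 < e / (d - c + 1) by apply: Rdiv_lt_0_compat; lra.
have [d2 hd] := uniform_continuity_2d_1d' h c d x hc (mkposreal _ he').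
exists (Rmin d1 d2); split; first by apply: Rmin_glb_lt; exact: cond_pos.
move=> y hy.
have hy1 := Rlt_le_trans _ _ _ hy (Rmin_l _ _).
have hy2 := Rlt_le_trans _ _ _ hy (Rmin_r _ _).
have ey : ex_RInt (h y) c d by apply: hex.
have ex : ex_RInt (h x) c d by apply: hex; exact: ball_center.
have -> : minus (RInt (h y) c d) (RInt (h x) c d) =
    RInt (fun r => minus (h y r) (h x r)) c d by rewrite RInt_minus.
have h1 : norm (RInt (fun r => minus (h y r) (h x r)) c d) <=
    (d - c) * (e / (d - c + 1)).
  apply: (norm_RInt_le_const (fun r => minus (h y r) (h x r)) c d) => //.
  - move=> r hr; apply: Rlt_le; apply: (hd r x r y) => //.
    + have := cond_pos d2; lra.
    + by move/Rabs_def2: hy2 => ?; lra.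
    + rewrite Rminus_diag Rabs_R0; exact: cond_pos.
  - by apply: RInt_correct; apply: ex_RInt_minus.
apply: Rle_lt_trans h1 _.
have -> : (d - c) * (e / (d - c + 1)) = e - e / (d - c + 1) by field; lra.
lra.
Qed.

(** * Continuous functions on the open quadrant *)

Section Quadrant.

Variable h : R -> R -> R.
Hypothesis h_cont : forall s r, 0 < s -> 0 < r -> continuity_2d_pt h s r.

Lemma quadrant_cont_l s r : 0 < s -> 0 < r -> continuous (fun s => h s r) s.
Proof.
move=> hs hr; apply/continuous_normP => e he.
have [d hd] := h_cont s r hs hr (mkposreal e he).
exists d; split; first exact: cond_pos.
move=> y hy; apply: hd => //; rewrite Rminus_diag Rabs_R0; exact: cond_pos.
Qed.

Lemma quadrant_cont_r s r : 0 < s -> 0 < r -> continuous (h s) r.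
Proof.
move=> hs hr; apply/continuous_normP => e he.
have [d hd] := h_cont s r hs hr (mkposreal e he).
exists d; split; first exact: cond_pos.
move=> y hy; apply: hd => //; rewrite Rminus_diag Rabs_R0; exact: cond_pos.
Qed.

Lemma locally_pos (x : R) (P : R -> Prop) :
  0 < x -> (forall y, 0 < y -> P y) -> locally x P.
Proof.
move=> hx hP; exists (mkposreal x hx) => y hy; apply: hP.
move: hy; rewrite /ball /= /AbsRing_ball /= /abs /minus /plus /opp /= => hy.
move/Rabs_def2: hy; lra.
Qed.

Lemma quadrant_RInt_cont c d x : 0 < c -> c <= d -> 0 < x ->
  continuous (fun y => RInt (h y) c d) x.
Proof.
move=> hc hcd hx; apply: continuous_RInt_param => //.
  by move=> r hr; apply: h_cont; lra.
apply: locally_pos => // y hy; apply: ex_RInt_pos; try lra.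
by move=> t ht; apply: quadrant_cont_r.
Qed.

End Quadrant.

Lemma quadrant_swap_cont h :
  (forall s r, 0 < s -> 0 < r -> continuity_2d_pt h s r) ->
  forall s r, 0 < s -> 0 < r -> continuity_2d_pt (fun r s => h s r) s r.
Proof.
move=> hc s r hs hr e; have [d hd] := hc r s hr hs e.
by exists d => u v hu hv; apply: hd.
Qed.

(** Differentiation in the upper bound: [F t] is a primitive of [h] in its first variable, and the
    integral of [F t x] over [t] in [[c, d]] vanishes at [x = a] and has the inner integral
    [RInt (h x) c d] as derivative. *)
Lemma RInt_swap (h : R -> R -> R) (a b c d : R) :
  (forall s r, 0 < s -> 0 < r -> continuity_2d_pt h s r) ->
  0 < a <= b -> 0 < c <= d ->
  RInt (fun s => RInt (h s) c d) a b =
  RInt (fun r => RInt (fun s => h s r) a b) c d.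
Proof.
move=> hc hab hcd.
have hc' := quadrant_swap_cont h hc.
pose F t u := RInt (fun s => h s t) a u.
have dF t u : 0 < u -> 0 < t -> is_derive (F t) u (h u t).
  move=> hu ht; apply: (is_derive_RInt (fun s => h s t) (F t) a u).
  - apply: locally_pos => // y hy; apply: RInt_correct; apply: ex_RInt_pos; try lra.
    by move=> s hs; apply: quadrant_cont_l.
  - exact: quadrant_cont_l.
have dPhi x : 0 < x ->
    is_derive (fun x => RInt (fun t => F t x) c d) x (RInt (h x) c d).
  move=> hx.
  have -> : RInt (h x) c d = RInt (fun t => Derive (fun u => F t u) x) c d.
    apply: RInt_ext => t; rewrite Rmin_left; last lra.
    move=> ht; symmetry; apply: is_derive_unique; apply: dF; lra.
  apply: (is_derive_RInt_param (fun x t => F t x)).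
  - apply: locally_pos => // y hy t; rewrite Rmin_left; last lra.
    by move=> ht; exists (h y t); apply: dF; lra.
  - move=> t; rewrite Rmin_left; last lra.
    rewrite Rmax_right; last lra.
    move=> ht; apply: (continuity_2d_pt_ext_loc h); last by apply: hc; lra.
    have hm : 0 < Rmin x t by apply: Rmin_glb_lt; lra.
    exists (mkposreal _ hm) => u v /= hu hv.
    have := Rmin_l x t; have := Rmin_r x t.
    move/Rabs_def2: hu; move/Rabs_def2: hv => hv hu h1 h2.
    symmetry; apply: is_derive_unique; apply: dF; lra.
  - apply: locally_pos => // y hy; rewrite /F.
    (* Here [y] is any positive number near [x], so it may lie to the left of [a]. *)
    case: (Rle_dec a y) => hay.
      apply: ex_RInt_pos; try lra; move=> t ht.
      by apply: (quadrant_RInt_cont (fun r s => h s r)) => //; lra.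
    apply: (ex_RInt_ext (fun t => opp (RInt (fun s => h s t) y a))).
      move=> t; rewrite Rmin_left; last lra.
      move=> ht; apply: opp_RInt_swap; apply: ex_RInt_pos; try lra.
      by move=> s hs; apply: quadrant_cont_l => //; lra.
    apply: ex_RInt_pos; try lra; move=> t ht; apply: continuous_opp.
    by apply: (quadrant_RInt_cont (fun r s => h s r)) => //; lra.
have hI : is_RInt (fun x => RInt (h x) c d) a b
    (minus (RInt (fun t => F t b) c d) (RInt (fun t => F t a) c d)).
  apply: (is_RInt_derive (fun x => RInt (fun t => F t x) c d)) => x;
    (rewrite Rmin_left; last lra); move=> hx; first by apply: dPhi; lra.
  by apply: quadrant_RInt_cont => //; lra.
rewrite (is_RInt_unique _ _ _ _ hI).
have -> : RInt (fun t => F t a) c d = 0.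
  rewrite (RInt_ext _ (fun _ => 0)); last by move=> t _; exact: RInt_point.
  rewrite RInt_const; exact: Rmult_0_r.
exact: Rminus_0_r.
Qed.

Lemma RInt_le_pos (f g : R -> R) (a b : R) :
  (forall t, 0 < t -> continuous f t) -> (forall t, 0 < t -> continuous g t) ->
  0 < a <= b -> (forall t, a < t < b -> f t <= g t) ->
  RInt f a b <= RInt g a b.
Proof. by move=> hf hg hab; apply: RInt_le; try apply: ex_RInt_pos; lra || assumption. Qed.

Lemma RInt_plus_const (f : R -> R) (a b e : R) :
  (forall t, 0 < t -> continuous f t) -> 0 < a <= b ->
  RInt (fun t => f t + e) a b = RInt f a b + e * (b - a).
Proof.
move=> hf hab.
have h := RInt_plus f (fun _ => e) a b.
move: h; rewrite /plus /= => ->.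
- by rewrite RInt_const /scal /= /mult /= Rmult_comm.
- by apply: ex_RInt_pos => //; lra.
- exact: ex_RInt_const.
Qed.

(** Tonelli's theorem in terms of suprema. [K] and [M] are the two marginals of [h]; the last two
    approximation hypotheses replace each of them, uniformly on a compact interval, by a proper
    integral, so that the exchange takes place on rectangles. *)
Lemma improper_swap (h : R -> R -> R) (K M : R -> R) (L : R) :
  (forall s r, 0 < s -> 0 < r -> continuity_2d_pt h s r) ->
  (forall s r, 0 < s -> 0 < r -> 0 <= h s r) ->
  (forall t, 0 < t -> continuous K t) -> (forall t, 0 < t -> continuous M t) ->
  (forall s c d, 0 < s -> 0 < c < d -> RInt (h s) c d <= K s) ->
  (forall r a b, 0 < r -> 0 < a < b -> RInt (fun s => h s r) a b <= M r) ->
  (forall a b e, 0 < a < b -> 0 < e -> exists c d, 0 < c < d /\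
     forall s, a <= s <= b -> K s <= RInt (h s) c d + e) ->
  (forall c d e, 0 < c < d -> 0 < e -> exists a b, 0 < a < b /\
     forall r, c <= r <= d -> M r <= RInt (fun s => h s r) a b + e) ->
  improper K L -> improper M L.
Proof.
move=> hc h0 cK cM hK hM uK uM hL.
have hc' := quadrant_swap_cont h hc.
have K0 s : 0 < s -> 0 <= K s.
  move=> hs; apply: Rle_trans (hK s 1 2 hs _); last lra.
  apply: RInt_ge_0; first lra.
    by apply: ex_RInt_pos; try lra; move=> t ht; apply: quadrant_cont_r.
  by move=> x hx; apply: h0; lra.
have M0 s : 0 < s -> 0 <= M s.
  move=> hs; apply: Rle_trans (hM s 1 2 hs _); last lra.
  apply: RInt_ge_0; first lra.
    by apply: ex_RInt_pos; try lra; move=> t ht; apply: quadrant_cont_l.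
  by move=> x hx; apply: h0; lra.
have [L1 L2] := proj1 (improper_nonnegP K L cK K0) hL.
have cIr a b t : 0 < a < b -> 0 < t -> continuous (fun r => RInt (fun s => h s r) a b) t.
  by move=> hab ht; apply: (quadrant_RInt_cont (fun r s => h s r)) => //; lra.
have cIl c d t : 0 < c < d -> 0 < t -> continuous (fun s => RInt (h s) c d) t.
  by move=> hab ht; apply: quadrant_RInt_cont => //; lra.
have cst f e t : continuous f t -> continuous (fun t : R => f t + e) t.
  by move=> hf; apply: continuous_plus => //; exact: continuous_const.
apply/improper_nonnegP => //; split.
- move=> c d hcd; apply: Rle_plus_epsilon => e he.
  have he' : 0 < e / (d - c) by apply: Rdiv_lt_0_compat; lra.
  have [a [b [hab u]]] := uM c d _ hcd he'.
  have h1 : RInt M c d <=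
      RInt (fun r => RInt (fun s => h s r) a b + e / (d - c)) c d.
    apply: RInt_le_pos => //; try lra.
    - by move=> t ht; apply: cst; apply: cIr.
    - by move=> t ht; apply: u; lra.
  rewrite RInt_plus_const in h1; [|by move=> t ht; apply: cIr|lra].
  rewrite -RInt_swap in h1 => //; try lra.
  have h2 : RInt (fun s => RInt (h s) c d) a b <= RInt K a b.
    apply: RInt_le_pos => //; try lra.
    - by move=> t ht; apply: cIl.
    - by move=> t ht; apply: hK; lra.
  have h3 := L1 a b hab.
  have h4 : e / (d - c) * (d - c) = e by field; lra.
  lra.
- move=> e he; have [a [b [hab h1]]] := L2 (e / 2) ltac:(lra).
  have he' : 0 < e / 2 / (b - a) by apply: Rdiv_lt_0_compat; lra.
  have [c [d [hcd u]]] := uK a b _ hab he'.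
  exists c, d; split=> //.
  have h2 : RInt K a b <= RInt (fun s => RInt (h s) c d + e / 2 / (b - a)) a b.
    apply: RInt_le_pos => //; try lra.
    - by move=> t ht; apply: cst; apply: cIl.
    - by move=> t ht; apply: u; lra.
  rewrite RInt_plus_const in h2; [|by move=> t ht; apply: cIl|lra].
  rewrite RInt_swap in h2 => //; try lra.
  have h3 : RInt (fun r => RInt (fun s => h s r) a b) c d <= RInt M c d.
    apply: RInt_le_pos => //; try lra.
    - by move=> t ht; apply: cIr.
    - by move=> t ht; apply: hM; lra.
  have h4 : e / 2 / (b - a) * (b - a) = e / 2 by field; lra.
  lra.
Qed.

(** * The Gamma function and convolution of power kernels *)

Lemma is_derive_eq {V : NormedModule R_AbsRing} (f : R -> V) (x : R) (d d' : V) :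
  is_derive f x d -> d = d' -> is_derive f x d'.
Proof. by move=> h <-. Qed.

Lemma is_derive_eq_R (f : R -> R) (x d d' : R) :
  is_derive f x d -> d = d' -> is_derive f x d'.
Proof. by move=> h <-. Qed.

Lemma exp_mono (x y : R) : x <= y -> exp x <= exp y.
Proof. by case=> [h|->]; [apply: Rlt_le; exact: exp_increasing|lra]. Qed.

Lemma improper_Rmult (f : R -> R) (c l : R) :
  improper f l -> improper (fun t => c * f t) (c * l).
Proof. move=> h; exact: (is_RInt_gen_scal (V := R_NormedModule) f c l h). Qed.

Lemma improper_ext_R (f g : R -> R) (l : R) :
  (forall t, 0 < t -> f t = g t) -> improper f l -> improper g l.
Proof. exact: improper_ext. Qed.

Lemma Rpower_pos t b : 0 < Rpower t b.
Proof. exact: exp_pos. Qed.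

Lemma continuous_Rpower b t : 0 < t -> continuous (fun t => Rpower t b) t.
Proof.
move=> ht; apply: ex_derive_continuous; exists (b * Rpower t (b - 1)).
apply/is_derive_Reals; exact: derivable_pt_lim_power.
Qed.

Lemma continuous_Rmult (f g : R -> R) t :
  continuous f t -> continuous g t -> continuous (fun t => f t * g t) t.
Proof. exact: (continuous_mult (K := R_AbsRing)). Qed.

Lemma continuous_expN w t : continuous (fun t => exp (- w * t)) t.
Proof. by apply: ex_derive_continuous; auto_derive. Qed.

Lemma Rpower_le_1 t a : 0 < t -> 0 <= a <= 1 -> Rpower t a <= 1 + t.
Proof.
move=> ht ha; apply: Rle_trans (Rle_Rpower_l t (1 + t) a (proj1 ha) _) _; first lra.
rewrite -{2}(Rpower_1 (1 + t)); last lra.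
apply: Rle_Rpower; lra.
Qed.

(** [H] below is negative, bounded below, and its derivative exceeds the
    integrand since [t^a <= 1 + t]. *)
Lemma improper_power_exp a w : 0 < a <= 1 -> 0 < w ->
  exists l, improper (fun t => Rpower t (a - 1) * exp (- w * t)) l.
Proof.
move=> ha hw.
(* The term [- / w] compensates the derivative of [- (1 + t)]: up to the factor [exp (- w * t) / a],
   the derivative of [H] is [a * t^(a-1) + w * (1 + t - t^a)]. *)
pose H t := (Rpower t a - (1 + t) - / w) * exp (- w * t) / a.
pose dH t := (a * Rpower t (a - 1) - 1 - w * (Rpower t a - (1 + t) - / w))
  * exp (- w * t) / a.
have hH t : 0 < t -> is_derive H t (dH t).
  move=> ht.
  have h1 : is_derive (fun t => Rpower t a) t (a * Rpower t (a - 1)).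
    apply/is_derive_Reals; exact: derivable_pt_lim_power.
  have h2 : is_derive (fun t => - (1 + t) - / w) t (- 1).
    by auto_derive; [|ring].
  have h3 : is_derive (fun t => exp (- w * t)) t (- w * exp (- w * t)).
    by auto_derive; [|ring].
  have h4 := is_derive_plus _ _ t _ _ h1 h2.
  have h5 := is_derive_mult _ _ t _ _ h4 h3 Rmult_comm.
  have h6 := is_derive_scal _ t (/ a) _ h5.
  apply: (is_derive_eq _ _ _ _ (is_derive_ext _ _ _ _ _ h6)).
    by move=> s; rewrite /H /plus /mult /=; field; lra.
  rewrite /dH /plus /mult /=; field; lra.
have cdH t : 0 < t -> continuous dH t.
  move=> ht; apply: continuous_Rmult; last exact: continuous_const.
  apply: continuous_Rmult; last exact: continuous_expN.
  have c b := continuous_Rpower b t ht.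
  have cc (r : R) : continuous (fun _ : R => r) t by exact: continuous_const.
  apply: (continuous_minus (V := R_NormedModule)).
    apply: (continuous_minus (V := R_NormedModule)) => //; exact: continuous_Rmult.
  apply: continuous_Rmult => //; do 2 apply: (continuous_minus (V := R_NormedModule)) => //.
  by apply: (continuous_plus (V := R_NormedModule)) => //; exact: continuous_id.
have cf t : 0 < t -> continuous (fun t => Rpower t (a - 1) * exp (- w * t)) t.
  move=> ht; apply: continuous_Rmult; [exact: continuous_Rpower|exact: continuous_expN].
have hiw : 0 < / w by exact: Rinv_0_lt_compat.
have hia : 0 < / a by apply: Rinv_0_lt_compat; lra.
apply: (improper_nonneg_ex _ ((1 + 2 * / w) / a)) => //.
  by move=> t ht; apply: Rmult_le_pos; apply: Rlt_le; exact: exp_pos.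
move=> x y hxy.
have h1 : is_RInt dH x y (minus (H y) (H x)).
  apply: is_RInt_derive => t; (rewrite Rmin_left; last lra); move=> ht.
    by apply: hH; lra.
  by apply: cdH; lra.
apply: Rle_trans (RInt_le_pos _ dH _ _ cf cdH _ _) _; first lra.
  move=> t ht; rewrite /dH /Rdiv.
  have -> : Rpower t (a - 1) * exp (- w * t) =
      a * Rpower t (a - 1) * exp (- w * t) * / a by field; lra.
  apply: Rmult_le_compat_r; first lra.
  apply: Rmult_le_compat_r; first by apply: Rlt_le; exact: exp_pos.
  have h2 := Rpower_le_1 t a ltac:(lra) ltac:(lra).
  have h3 : w * / w = 1 by field; lra.
  nra.
rewrite (is_RInt_unique _ _ _ _ h1) /minus /plus /opp /=.
have hneg t : 0 < t -> H t <= 0.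
  move=> ht; have h2 := Rpower_le_1 t a ht ltac:(lra).
  have h3 := exp_pos (- w * t).
  rewrite /H /Rdiv -[X in _ <= X](Rmult_0_l (/ a)).
  apply: Rmult_le_compat_r; first lra.
  have : 0 <= (1 + t + / w - Rpower t a) * exp (- w * t).
    apply: Rmult_le_pos; lra.
  lra.
have hlow t : 0 < t -> - ((1 + 2 * / w) / a) <= H t.
  move=> ht; rewrite /H /Rdiv -Ropp_mult_distr_l_reverse.
  apply: Rmult_le_compat_r; first lra.
  have h3 := exp_pos (- w * t).
  have h4 : exp (- w * t) <= 1.
    rewrite -exp_0; apply: exp_mono; nra.
  have h5 : t * exp (- w * t) <= / w.
    have h6 := exp_ineq1_le (w * t).
    have h7 : exp (- w * t) * exp (w * t) = 1.
      by rewrite -exp_plus -exp_0; f_equal; ring.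
    have h8 : w * (t * exp (- w * t)) <= 1 by nra.
    apply: (Rmult_le_reg_l w) => //; rewrite Rinv_r; lra.
  have h6 := Rpower_pos t a.
  nra.
have := hneg y ltac:(lra); have := hlow x ltac:(lra); lra.
Qed.

Lemma Gamma_improper a : 0 < a <= 1 ->
  improper (fun t => Rpower t (a - 1) * exp (- t)) (Gamma a).
Proof.
move=> ha; have [l hl] := improper_power_exp a 1 ha Rlt_0_1.
have hex : improper (fun t => Rpower t (a - 1) * exp (- t)) l.
  apply: improper_ext hl => t _; do 2 f_equal; ring.
exact: (RInt_gen_correct (V := R_CompleteNormedModule) _ (ex_intro _ l hex)).
Qed.

Lemma continuous_gamma_kernel a t : 0 < t ->
  continuous (fun t => Rpower t (a - 1) * exp (- t)) t.
Proof.
move=> ht; apply: continuous_Rmult; first exact: continuous_Rpower.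
by apply: ex_derive_continuous; auto_derive.
Qed.

Lemma Gamma_pos a : 0 < a <= 1 -> 0 < Gamma a.
Proof.
move=> ha.
have h0 t : 0 < t -> 0 < Rpower t (a - 1) * exp (- t).
  by move=> ht; apply: Rmult_lt_0_compat; exact: exp_pos.
have c := continuous_gamma_kernel a.
have [h1 _] := proj1 (improper_nonnegP _ _ c (fun t ht => Rlt_le _ _ (h0 t ht)))
  (Gamma_improper a ha).
apply: Rlt_le_trans (h1 1 2 ltac:(lra)).
apply: RInt_gt_0; first lra; move=> x hx; [apply: h0|apply: c]; lra.
Qed.

Lemma Gamma_1 : Gamma 1 = 1.
Proof.
apply: (improper_eq _ _ _ _ (Gamma_improper 1 ltac:(lra))).
have e : forall t, 0 < t -> exp (- t) = Rpower t (1 - 1) * exp (- t).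
  by move=> t ht; rewrite Rminus_diag Rpower_O // Rmult_1_l.
apply: improper_ext e _.
have hI a b : RInt (fun t => exp (- t)) a b = exp (- a) - exp (- b).
  have h : is_RInt (fun t => exp (- t)) a b (minus (- exp (- b)) (- exp (- a))).
    apply: (is_RInt_derive (fun t => - exp (- t))) => t _.
      by auto_derive; [|ring].
    by apply: ex_derive_continuous; auto_derive.
  rewrite (is_RInt_unique _ _ _ _ h) /minus /plus /opp /=; ring.
apply/improper_nonnegP.
- by move=> t _; apply: ex_derive_continuous; auto_derive.
- by move=> t _; apply: Rlt_le; exact: exp_pos.
split.
- move=> a b hab; rewrite hI; have := exp_pos (- b).
  have : exp (- a) <= exp 0 by apply: exp_mono; lra.
  rewrite exp_0; lra.
- move=> e he.
  (* Each end costs at most [e / 2], since [1 - exp (- a) <= a] and [exp (- b) < / b]; the minimum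
     with 1 ensures [a < b]. *)
  pose a := Rmin (e / 2) 1; pose b := 2 / e + 1.
  have ha : 0 < a by apply: Rmin_glb_lt; lra.
  have ha1 := Rmin_l (e / 2) 1; have ha2 := Rmin_r (e / 2) 1.
  rewrite -/a in ha1 ha2.
  have h2e : 0 < 2 / e by apply: Rdiv_lt_0_compat; lra.
  have hb : 1 < b by rewrite /b; lra.
  exists a, b; split; first lra.
  rewrite hI.
  have h1 := exp_ineq1_le (- a).
  have h2 : exp (- b) < e / 2.
    have h3 := exp_ineq1_le b; have h4 := exp_pos (- b).
    have h5 : exp (- b) * exp b = 1 by rewrite -exp_plus -exp_0; f_equal; ring.
    have h6 : e / 2 * (2 / e) = 1 by field; lra.
    have h7 : e / 2 * b = 1 + e / 2 by rewrite /b; lra.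
    apply: Rnot_le_lt => h8.
    have : e / 2 * b <= exp (- b) * exp b by apply: Rmult_le_compat; lra.
    lra.
  lra.
Qed.

(** Substituting [r = s * rho] turns the left-hand side into an integral over
    [rho], whose kernel does not depend on [f]. *)
Lemma power_convolution (f k : R -> R) (a b Ib I L : R) :
  0 < a -> 0 < b -> a + b <= 1 ->
  (forall t, 0 < t -> continuous f t) -> (forall t, 0 < t -> 0 <= f t) ->
  (forall s t, 0 < s <= t -> f t <= f s) ->
  improper (fun t => Rpower t (b - 1) * f t) Ib ->
  improper (fun t => Rpower t (a + b - 1) * f t) I ->
  (forall s, 0 < s -> continuous k s) ->
  (forall s, 0 < s -> improper (fun r => Rpower r (b - 1) * f (s + r)) (k s)) ->
  improper (fun s => Rpower s (a - 1) * k s) L ->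
  improper (fun r => Rpower r (b - 1) * Rpower (1 + r) (- (a + b)) * I) L.
Proof.
move=> ha hb hab cf f0 fd hIb hI ck hk hL.
have cp c t : 0 < t -> continuous (fun t : R => Rpower t c) t by exact: continuous_Rpower.
have p0 t c : 0 < Rpower t c by exact: Rpower_pos.
have pf0 c t : 0 < t -> 0 <= Rpower t c * f t.
  by move=> ht; apply: Rmult_le_pos; [apply: Rlt_le|apply: f0].
have cpf c t : 0 < t -> continuous (fun t : R => Rpower t c * f t) t.
  by move=> ht; apply: continuous_Rmult; [apply: cp|apply: cf].
have cfs s t : 0 < s -> 0 < t -> continuous (fun t : R => f (s + t)) t.
  move=> hs ht; apply: (continuous_comp (fun t => s + t) f).
    by apply: ex_derive_continuous; auto_derive.
  by apply: cf; lra.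
have cpfs s c t : 0 < s -> 0 < t -> continuous (fun t : R => Rpower t c * f (s + t)) t.
  by move=> hs ht; apply: continuous_Rmult; [apply: cp|apply: cfs].
have pfs0 s c t : 0 < s -> 0 < t -> 0 <= Rpower t c * f (s + t).
  by move=> hs ht; apply: Rmult_le_pos; [apply: Rlt_le|apply: f0; lra].
(* The integrand after the substitution: the exponent of [s] is [(a - 1) + (b - 1) + 1], from the
   two kernels and the Jacobian. *)
pose h s r := Rpower s (a + b - 1) * Rpower r (b - 1) * f (s * (1 + r)).
have [_ Ib2] := proj1 (improper_nonnegP _ Ib (cpf _) (pf0 _)) hIb.
have [I1 I2] := proj1 (improper_nonnegP _ I (cpf _) (pf0 _)) hI.
have hKint s c d : 0 < s -> 0 < c < d -> RInt (h s) c d =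
    Rpower s (a - 1) * RInt (fun r => Rpower r (b - 1) * f (s + r)) (s * c) (s * d).
  move=> hs hcd.
  have e : ex_RInt (fun r => Rpower r (b - 1) * f (s + r)) (s * c) (s * d).
    by apply: ex_RInt_pos; try nra; move=> t ht; apply: cpfs.
  have e2 := RInt_correct _ _ _ e.
  have e3 : s * c = s * c + 0 by ring.
  have e4 : s * d = s * d + 0 by ring.
  rewrite {1}e3 {1}e4 in e2.
  have e5 := is_RInt_scal _ _ _ (Rpower s (a - 1)) _ (is_RInt_comp_lin _ _ _ _ _ _ e2).
  apply: is_RInt_unique; apply: is_RInt_ext e5 => x.
  rewrite Rmin_left; last lra; move=> hx.
  rewrite /scal /= /mult /= /h Rplus_0_r -Rpower_mult_distr; try lra.
  have -> : a + b - 1 = (a - 1) + (b - 1) + 1 by ring.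
  rewrite !Rpower_plus Rpower_1 //.
  have -> : s * (1 + x) = s + s * x by ring.
  ring.
have hMint r c d : 0 < r -> 0 < c < d -> RInt (fun s => h s r) c d =
    Rpower r (b - 1) * Rpower (1 + r) (- (a + b)) *
    RInt (fun t => Rpower t (a + b - 1) * f t) ((1 + r) * c) ((1 + r) * d).
  move=> hr hcd.
  have e : ex_RInt (fun t => Rpower t (a + b - 1) * f t) ((1 + r) * c) ((1 + r) * d).
    by apply: ex_RInt_pos; try nra; move=> t ht; apply: cpf.
  have e2 := RInt_correct _ _ _ e.
  have e3 : (1 + r) * c = (1 + r) * c + 0 by ring.
  have e4 : (1 + r) * d = (1 + r) * d + 0 by ring.
  rewrite {1}e3 {1}e4 in e2.
  have e5 := is_RInt_scal _ _ _ (Rpower r (b - 1) * Rpower (1 + r) (- (a + b))) _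
    (is_RInt_comp_lin _ _ _ _ _ _ e2).
  apply: is_RInt_unique; apply: is_RInt_ext e5 => x.
  rewrite Rmin_left; last lra; move=> hx.
  rewrite /scal /= /mult /= /h Rplus_0_r -Rpower_mult_distr; try lra.
  have -> : Rpower (1 + r) (a + b - 1) = / (1 + r) * Rpower (1 + r) (a + b).
    have e1 : a + b = (a + b - 1) + 1 by ring.
    rewrite {2}e1 Rpower_plus Rpower_1; last lra.
    by field; lra.
  rewrite Rpower_Ropp [x * (1 + r)]Rmult_comm.
  have := p0 (1 + r) (a + b); set z := Rpower (1 + r) (a + b) => hz.
  field; split; lra.
apply: (improper_swap h (fun s => Rpower s (a - 1) * k s) _ L) => //.
- move=> s r hs hr.
  have id1 := continuity_2d_pt_id1 s r; have id2 := continuity_2d_pt_id2 s r.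
  apply: continuity_2d_pt_mult.
    apply: continuity_2d_pt_mult.
      apply: (continuity_1d_2d_pt_comp (fun s => Rpower s (a + b - 1))) => //.
      by apply/continuity_pt_filterlim; apply: cp.
    apply: (continuity_1d_2d_pt_comp (fun s => Rpower s (b - 1))) => //.
    by apply/continuity_pt_filterlim; apply: cp.
  apply: (continuity_1d_2d_pt_comp f (fun s r => s * (1 + r))).
    by apply/continuity_pt_filterlim; apply: cf; nra.
  apply: continuity_2d_pt_mult => //; apply: continuity_2d_pt_plus => //.
  exact: continuity_2d_pt_const.
- move=> s r hs hr; apply: Rmult_le_pos; last by apply: f0; nra.
  by apply: Rlt_le; apply: Rmult_lt_0_compat.
- by move=> t ht; apply: continuous_Rmult; [apply: cp|apply: ck].
- move=> t ht; apply: continuous_Rmult; last exact: continuous_const.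
  apply: continuous_Rmult; first exact: cp.
  apply: (continuous_comp (fun t => 1 + t) (fun t => Rpower t (- (a + b)))).
    by apply: ex_derive_continuous; auto_derive.
  by apply: cp; lra.
- move=> s c d hs hcd; rewrite hKint //; apply: Rmult_le_compat_l.
    exact: Rlt_le.
  have [k1 _] := proj1 (improper_nonnegP _ (k s) (fun t => cpfs s _ t hs)
    (fun t => pfs0 s _ t hs)) (hk s hs).
  apply: k1; nra.
- move=> r c d hr hcd; rewrite hMint //; apply: Rmult_le_compat_l.
    by apply: Rlt_le; apply: Rmult_lt_0_compat.
  apply: I1; nra.
- move=> s1 s2 e hs12 he.
  have hs1 : 0 < Rpower s1 (a - 1) by exact: p0.
  have he' : 0 < e / Rpower s1 (a - 1) by apply: Rdiv_lt_0_compat.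
  have [p [q [hpq h1]]] := Ib2 _ he'.
  have hc : 0 < p / s2 by apply: Rdiv_lt_0_compat; lra.
  have e1 : s2 * (p / s2) = p by field; lra.
  have e2 : s1 * (q / s1) = q by field; lra.
  have hd : p / s2 < q / s1.
    apply: (Rmult_lt_reg_l s1); first lra.
    rewrite e2; apply: Rle_lt_trans (proj2 hpq).
    rewrite -{2}e1; apply: Rmult_le_compat_r; lra.
  (* For every [s] in [[s1, s2]] the bounds scaled by [s] enclose [[p, q]]. As [f (s + r) <= f r],
     the remainder outside [[p, q]] is at most that of [Ib], uniformly in [s]; the prefactor
     [s^(a-1)] is largest at [s1], which explains the tolerance. *)
  exists (p / s2), (q / s1); split=> // s hs.
  rewrite hKint //; last lra.
  have h2 := improper_tail_le (fun r => Rpower r (b - 1) * f (s + r))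
    (fun r => Rpower r (b - 1) * f r) (k s) Ib p q
    (fun t => cpfs s _ t ltac:(lra)) (fun t => cpf _ t).
  have h3 := h2 _ (hk s ltac:(lra)) hIb hpq.
  have h4 : k s - RInt (fun r => Rpower r (b - 1) * f (s + r)) p q <=
      e / Rpower s1 (a - 1).
    have h4 : forall t, 0 < t -> 0 <= Rpower t (b - 1) * f (s + t) <= Rpower t (b - 1) * f t.
      move=> t ht; split; first by apply: pfs0; lra.
      by apply: Rmult_le_compat_l; [apply: Rlt_le|apply: fd; lra].
    have := h3 h4; lra.
  have h5 := RInt_mono_bounds (fun r => Rpower r (b - 1) * f (s + r))
    (s * (p / s2)) p q (s * (q / s1)) (fun t => cpfs s _ t ltac:(lra))
    (fun t => pfs0 s _ t ltac:(lra)) ltac:(nra) ltac:(nra) ltac:(lra) ltac:(nra).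
  have h6 : Rpower s (a - 1) <= Rpower s1 (a - 1).
    have -> : a - 1 = - (1 - a) by ring.
    rewrite !Rpower_Ropp; apply: Rinv_le_contravar; first exact: p0.
    apply: Rle_Rpower_l; lra.
  have h7 : k s - RInt (fun r => Rpower r (b - 1) * f (s + r)) (s * (p / s2))
    (s * (q / s1)) <= e / Rpower s1 (a - 1) by lra.
  have h8 := Rmult_le_compat_l _ _ _ (Rlt_le _ _ (p0 s (a - 1))) h7.
  have h9 := Rmult_le_compat_r _ _ _ (Rlt_le _ _ he') h6.
  have h10 : Rpower s1 (a - 1) * (e / Rpower s1 (a - 1)) = e by field; lra.
  lra.
- move=> c d e hcd he.
  have hc1 : 0 < Rpower c (b - 1) by exact: p0.
  have he' : 0 < e / Rpower c (b - 1) by apply: Rdiv_lt_0_compat.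
  have [p [q [hpq h1]]] := I2 _ he'.
  have e1 : (1 + d) * (p / (1 + d)) = p by field; lra.
  have hp : 0 < p / (1 + d) by apply: Rdiv_lt_0_compat; lra.
  (* For every [r] in [[c, d]] the bounds scaled by [1 + r] enclose [[p, q]], and the kernel is at
     most [c^(b-1)]. *)
  exists (p / (1 + d)), q; split; first by split=> //; nra.
  move=> r hr; rewrite hMint; [|lra|split=> //; nra].
  have h5 := RInt_mono_bounds (fun t => Rpower t (a + b - 1) * f t)
    ((1 + r) * (p / (1 + d))) p q ((1 + r) * q) (cpf _)
    (pf0 _) ltac:(nra) ltac:(nra) ltac:(lra) ltac:(nra).
  have h6 : Rpower r (b - 1) * Rpower (1 + r) (- (a + b)) <= Rpower c (b - 1).
    rewrite -[X in _ <= X]Rmult_1_r; apply: Rmult_le_compat.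
    + exact: Rlt_le.
    + exact: Rlt_le.
    + have -> : b - 1 = - (1 - b) by ring.
      rewrite !Rpower_Ropp; apply: Rinv_le_contravar; first exact: p0.
      apply: Rle_Rpower_l; lra.
    + have := Rle_Rpower (1 + r) (- (a + b)) 0 ltac:(lra) ltac:(lra).
      rewrite Rpower_O; lra.
  have hm : 0 < Rpower r (b - 1) * Rpower (1 + r) (- (a + b)).
    by apply: Rmult_lt_0_compat.
  have h7 : I - RInt (fun t => Rpower t (a + b - 1) * f t)
    ((1 + r) * (p / (1 + d))) ((1 + r) * q) <= e / Rpower c (b - 1) by lra.
  have h8 := Rmult_le_compat_l _ _ _ (Rlt_le _ _ hm) h7.
  have h9 := Rmult_le_compat_r _ _ _ (Rlt_le _ _ he') h6.
  have h10 : Rpower c (b - 1) * (e / Rpower c (b - 1)) = e by field; lra.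
  lra.
Qed.

(** The kernel in the convolution formula is the same for all [f], and the choice [f t = exp (- t)]
    evaluates its integral through [Gamma]. The two formulas are multiplied crosswise, so that the
    case [I = 0] is included. *)
Lemma power_convolution_Gamma (f k : R -> R) (a b Ib I L : R) :
  0 < a -> 0 < b -> a + b <= 1 ->
  (forall t, 0 < t -> continuous f t) -> (forall t, 0 < t -> 0 <= f t) ->
  (forall s t, 0 < s <= t -> f t <= f s) ->
  improper (fun t => Rpower t (b - 1) * f t) Ib ->
  improper (fun t => Rpower t (a + b - 1) * f t) I ->
  (forall s, 0 < s -> continuous k s) ->
  (forall s, 0 < s -> improper (fun r => Rpower r (b - 1) * f (s + r)) (k s)) ->
  improper (fun s => Rpower s (a - 1) * k s) L ->
  L * Gamma (a + b) = Gamma a * Gamma b * I.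
Proof.
move=> ha hb hab cf f0 fd hIb hI ck hk hL.
have h1 := power_convolution f k a b Ib I L ha hb hab cf f0 fd hIb hI ck hk hL.
have ga : improper (fun t => Rpower t (a - 1) * exp (- t)) (Gamma a).
  by apply: Gamma_improper; lra.
have gb : improper (fun t => Rpower t (b - 1) * exp (- t)) (Gamma b).
  by apply: Gamma_improper; lra.
have ce t : continuous (fun t : R => exp (- t)) t.
  by apply: ex_derive_continuous; auto_derive.
have h2 : improper (fun r => Rpower r (b - 1) * Rpower (1 + r) (- (a + b))
    * Gamma (a + b)) (Gamma a * Gamma b).
  apply: (power_convolution (fun t => exp (- t)) (fun s => exp (- s) * Gamma b)
    a b (Gamma b)) => //.
  - by move=> t _; apply: Rlt_le; exact: exp_pos.
  - by move=> s t hst; apply: exp_mono; lra.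
  - have : 0 < a + b <= 1 by lra.
    exact: Gamma_improper.
  - by move=> s _; apply: continuous_Rmult => //; exact: continuous_const.
  - move=> s hs.
    have h := improper_Rmult _ (exp (- s)) _ gb.
    apply: (improper_ext_R _ _ _ _ h) => t ht.
    have -> : - (s + t) = - s + - t by ring.
    rewrite exp_plus; ring.
  - rewrite Rmult_comm.
    have h := improper_Rmult _ (Gamma b) _ ga.
    apply: (improper_ext_R _ _ _ _ h) => t ht; ring.
have h3 := improper_Rmult _ (Gamma (a + b)) _ h1.
have h4 := improper_Rmult _ I _ h2.
rewrite [L * _]Rmult_comm [_ * I]Rmult_comm.
apply: (improper_eq _ _ _ _ h3).
apply: (improper_ext_R _ _ _ _ h4) => t ht; ring.
Qed.

(** * Negative powers of the generator of a stable semigroup *)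

(** Orbits are frozen at negative times, which makes them continuous on the whole line; the
    semigroup law remains restricted to nonnegative times. *)
Record stable_semigroup (X : CompleteNormedModule R_AbsRing) (T : R -> X -> X) :
    Prop := {
  ss_lin : forall t, is_linear (T t);
  ss_neg : forall t x, t <= 0 -> T t x = x;
  ss_add : forall s t x, 0 <= s -> 0 <= t -> T (s + t) x = T s (T t x);
  ss_cont : forall x t, continuous (fun t => T t x) t;
  ss_bound : exists M w, 0 < w /\
    forall t x, 0 <= t -> norm (T t x) <= M * exp (- w * t) * norm x
}.

Definition power_integral {X : CompleteNormedModule R_AbsRing}
    (T : R -> X -> X) (a : R) (x : X) : X :=
  RInt_gen (fun t => scal (Rpower t (a - 1)) (T t x))
    (at_right 0) (Rbar_locally p_infty).

(** [(-A)^(-a)]. *)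
Definition npow {X : CompleteNormedModule R_AbsRing}
    (T : R -> X -> X) (a : R) (x : X) : X :=
  match Req_dec_T a 0 with
  | left _ => x
  | right _ => scal (/ Gamma a) (power_integral T a x)
  end.

Lemma RInt_average {X : CompleteNormedModule R_AbsRing} (f : R -> X) :
  (forall t, continuous f t) ->
  filterlim (fun h => scal (/ h) (RInt f 0 h)) (at_right 0) (locally (f 0)).
Proof.
move=> hf; apply/filterlim_normP => e he.
have [d [hd h]] := proj1 (continuous_normP _ f 0) (hf 0) (e / 2) ltac:(lra).
apply/at_right_0P; exists d; split=> // s hs.
have ex : ex_RInt f 0 s by apply: ex_RInt_continuous.
have exm : ex_RInt (fun t => minus (f t) (f 0)) 0 s.
  by apply: ex_RInt_minus => //; exact: ex_RInt_const.
have e1 : RInt (fun t => minus (f t) (f 0)) 0 s =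
    minus (RInt f 0 s) (scal s (f 0)).
  rewrite RInt_minus //; last exact: ex_RInt_const.
  by rewrite RInt_const Rminus_0_r.
have h1 : norm (RInt (fun t => minus (f t) (f 0)) 0 s) <= (s - 0) * (e / 2).
  apply: (norm_RInt_le_const (fun t => minus (f t) (f 0)) 0 s); first lra.
  - move=> t ht; apply: Rlt_le; apply: h; rewrite Rminus_0_r Rabs_pos_eq; lra.
  - exact: RInt_correct.
have -> : minus (scal (/ s) (RInt f 0 s)) (f 0) =
    scal (/ s) (minus (RInt f 0 s) (scal s (f 0))) by vec.
rewrite -e1 norm_scal_eq Rabs_pos_eq; last first.
  by apply: Rlt_le; apply: Rinv_0_lt_compat; lra.
have his : 0 < / s by apply: Rinv_0_lt_compat; lra.
apply: Rle_lt_trans (Rmult_le_compat_l _ _ _ (Rlt_le _ _ his) h1) _.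
have -> : / s * ((s - 0) * (e / 2)) = e / 2 by field; lra.
lra.
Qed.

Lemma improper_from_0 {X : CompleteNormedModule R_AbsRing} (f : R -> X) (l : X) :
  (forall t, continuous f t) -> improper f l ->
  filterlim (fun b => RInt f 0 b) (Rbar_locally p_infty) (locally l).
Proof.
move=> hf hl; apply/filterlim_normP => e he.
have [d [N [hd [hdN h]]]] := proj1 (improperP _ f l) hl (e / 2) ltac:(lra).
have [d' [hd' h']] := proj1 (continuous_normP _ f 0) (hf 0) 1 ltac:(lra).
pose M := norm (f 0) + 1.
have hM : 0 < M by rewrite /M; have := norm_ge_0 (f 0); lra.
pose a := Rmin (Rmin (d / 2) (d' / 2)) (e / 4 / M).
have ha : 0 < a.
  apply: Rmin_glb_lt; first by apply: Rmin_glb_lt; lra.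
  by apply: Rdiv_lt_0_compat; lra.
have ha1 : a <= d / 2 by apply: Rle_trans (Rmin_l _ _) _; exact: Rmin_l.
have ha2 : a <= d' / 2 by apply: Rle_trans (Rmin_l _ _) _; exact: Rmin_r.
have ha3 : a * M <= e / 4.
  have h1 : a <= e / 4 / M by exact: Rmin_r.
  have h2 := Rmult_le_compat_r M _ _ (Rlt_le _ _ hM) h1.
  have h3 : e / 4 / M * M = e / 4 by field; lra.
  lra.
exists N => b hb.
have [I [hI1 hI2]] := h a b ltac:(lra) hb.
have ex u v : ex_RInt f u v by apply: ex_RInt_continuous.
rewrite -(RInt_Chasles f 0 a b) //.
rewrite (is_RInt_unique _ _ _ _ hI1).
have h1 : norm (RInt f 0 a) <= (a - 0) * M.
  apply: (norm_RInt_le_const f 0 a); first lra; last exact: RInt_correct.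
  move=> t ht; have := h' t; rewrite Rminus_0_r Rabs_pos_eq; last lra.
  move=> h2; have := h2 ltac:(lra).
  have := norm_le_minus _ (f t) (f 0); rewrite /M; nlra.
have -> : minus (plus (RInt f 0 a) I) l = plus (RInt f 0 a) (minus I l) by vec.
apply: Rle_lt_trans (norm_triangle _ _) _; lra.
Qed.

(** * Negative powers as bounded operators, and the generator as the inverse of [- (-A)^(-1)] *)

Section Semigroup.

Variables (X : CompleteNormedModule R_AbsRing) (T : R -> X -> X).
Hypothesis hT : stable_semigroup X T.

Let lin := ss_lin X T hT.
Let cont := ss_cont X T hT.
Local Notation P := (npow T).

Lemma sg_comm s t x : T s (T t x) = T t (T s x).
Proof.
case: (Rle_dec s 0) => hs; first by rewrite !(ss_neg _ _ hT s).
case: (Rle_dec t 0) => ht; first by rewrite !(ss_neg _ _ hT t).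
rewrite -!(ss_add _ _ hT); try lra; by rewrite Rplus_comm.
Qed.

Lemma continuous_power_integrand a x t : 0 < t ->
  continuous (fun t => scal (Rpower t (a - 1)) (T t x)) t.
Proof.
by move=> ht; apply: continuous_scal; [exact: continuous_Rpower|exact: cont].
Qed.

Lemma power_integral_bound a : 0 < a <= 1 -> exists C, 0 <= C /\ forall x,
  improper (fun t => scal (Rpower t (a - 1)) (T t x)) (power_integral T a x) /\
  norm (power_integral T a x) <= C * norm x.
Proof.
move=> ha; have [M [w [hw hM]]] := ss_bound _ _ hT.
have [l hl] := improper_power_exp a w ha hw.
have cg t : 0 < t -> continuous (fun t : R => Rpower t (a - 1) * exp (- w * t)) t.
  move=> ht; apply: continuous_Rmult; [exact: continuous_Rpower|exact: continuous_expN].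
have l0 : 0 <= l.
  have [h1 _] := proj1 (improper_nonnegP _ l cg
    (fun t _ => Rmult_le_pos _ _ (Rlt_le _ _ (Rpower_pos _ _))
       (Rlt_le _ _ (exp_pos _)))) hl.
  apply: Rle_trans (h1 1 2 ltac:(lra)).
  apply: RInt_ge_0; first lra; first by apply: ex_RInt_pos => //; lra.
  by move=> t ht; apply: Rmult_le_pos; apply: Rlt_le; exact: exp_pos.
exists (Rabs M * l); split; first by apply: Rmult_le_pos => //; exact: Rabs_pos.
move=> x.
have [I [h1 h2]] : exists I,
    improper (fun t => scal (Rpower t (a - 1)) (T t x)) I /\
    norm I <= Rabs M * norm x * l.
  apply: (improper_dominated _
    (fun t => Rabs M * norm x * (Rpower t (a - 1) * exp (- w * t)))).
  - exact: continuous_power_integrand.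
  - by move=> t ht; apply: continuous_Rmult; [exact: continuous_const|apply: cg].
  - move=> t ht; rewrite norm_scal_eq.
    have hp := Rpower_pos t (a - 1); rewrite Rabs_pos_eq; last lra.
    have := hM t x ltac:(lra) => h1.
    have -> : Rabs M * norm x * (Rpower t (a - 1) * exp (- w * t)) =
      Rpower t (a - 1) * (Rabs M * exp (- w * t) * norm x) by ring.
    apply: Rmult_le_compat_l; first lra.
    apply: Rle_trans h1 _; apply: Rmult_le_compat_r; first exact: norm_ge_0.
    apply: Rmult_le_compat_r; [apply: Rlt_le; exact: exp_pos|exact: Rle_abs].
  - exact: improper_Rmult.
have h3 : improper (fun t => scal (Rpower t (a - 1)) (T t x)) (power_integral T a x).
  exact: (RInt_gen_correct _ (ex_intro _ I h1)).
split=> //; rewrite -(improper_eq _ _ _ _ h1 h3); lra.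
Qed.

Lemma power_integralP a x : 0 < a <= 1 ->
  improper (fun t => scal (Rpower t (a - 1)) (T t x)) (power_integral T a x).
Proof. by move=> /power_integral_bound [C [_ h]]; exact: (proj1 (h x)). Qed.

Lemma power_integral_eq a x I : 0 < a <= 1 ->
  improper (fun t => scal (Rpower t (a - 1)) (T t x)) I -> power_integral T a x = I.
Proof. by move=> ha; apply: improper_eq; apply: power_integralP. Qed.

Lemma npow_0 x : P 0 x = x.
Proof. by rewrite /npow; case: Req_dec_T. Qed.

Lemma npow_pos a x : 0 < a -> P a x = scal (/ Gamma a) (power_integral T a x).
Proof. by rewrite /npow => ha; case: Req_dec_T => // h; lra. Qed.

Lemma npow_linear a : 0 <= a <= 1 -> is_linear (P a).
Proof.
move=> ha; case: (Req_dec a 0) => [->|h0].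
  by apply: (is_linear_ext (fun x => x)); [move=> x; rewrite npow_0|exact: is_linear_id].
have ha' : 0 < a <= 1 by lra.
have [C [hC h]] := power_integral_bound a ha'.
apply: (is_linear_intro _ _ _ (Rabs (/ Gamma a) * C)).
- move=> x y; rewrite !npow_pos; try lra; rewrite -scal_distr_l; f_equal.
  apply: power_integral_eq => //.
  have := improper_plus _ _ _ _ _ (power_integralP a x ha') (power_integralP a y ha').
  apply: improper_ext => t ht; rewrite (linear_plus _ (lin t)); vec.
- move=> r x; rewrite !npow_pos; try lra.
  have -> : power_integral T a (scal r x) = scal r (power_integral T a x).
    apply: power_integral_eq => //.
    have := improper_scal _ _ r _ (power_integralP a x ha').
    apply: improper_ext => t ht; rewrite (linear_scal _ (lin t)); vec.
  vec.
- move=> x; rewrite npow_pos; last lra.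
  rewrite norm_scal_eq Rmult_assoc; apply: Rmult_le_compat_l; first exact: Rabs_pos.
  exact: (proj2 (h x)).
Qed.

Lemma npow_comm a (L : X -> X) x : 0 <= a <= 1 -> is_linear L ->
  (forall t x, L (T t x) = T t (L x)) -> P a (L x) = L (P a x).
Proof.
move=> ha hL hc; case: (Req_dec a 0) => [->|h0]; first by rewrite !npow_0.
rewrite !npow_pos; try lra; rewrite (linear_scal _ hL); f_equal.
apply: power_integral_eq; first lra.
have := improper_linear _ _ L _ _ hL (power_integralP a x ltac:(lra)).
by apply: improper_ext => t ht; rewrite (linear_scal _ hL) hc.
Qed.

Lemma npow_sg a t x : 0 <= a <= 1 -> P a (T t x) = T t (P a x).
Proof. by move=> ha; apply: npow_comm => // s y; exact: sg_comm. Qed.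

Lemma npow_npow_comm a b x : 0 <= a <= 1 -> 0 <= b <= 1 ->
  P a (P b x) = P b (P a x).
Proof.
move=> ha hb; apply: npow_comm => //; first exact: npow_linear.
by move=> t y; apply: npow_sg.
Qed.

Lemma npow_1_improper x : improper (fun t => T t x) (P 1 x).
Proof.
rewrite npow_pos; last lra.
rewrite Gamma_1 Rinv_1 (scal_one (power_integral T 1 x)).
have := power_integralP 1 x ltac:(lra).
apply: improper_ext => t ht; rewrite Rminus_diag Rpower_O //; exact: scal_one.
Qed.

Lemma ex_RInt_sg x a b : ex_RInt (fun t => T t x) a b.
Proof. by apply: ex_RInt_continuous => t _; exact: cont. Qed.

(** [T h] shifts the integral [P 1 x] over the half-line to one starting at [h]. The derivative of
    the orbit of [P 1 x], the generator, and the density of the range of [P 1] are all read off from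
    this identity. *)
Lemma sg_npow_1 h x : 0 <= h ->
  T h (P 1 x) = minus (P 1 x) (RInt (fun t => T t x) 0 h).
Proof.
move=> hh; rewrite -npow_sg; last lra.
have h1 := improper_from_0 _ _ (cont x) (npow_1_improper x).
have h2 := improper_from_0 _ _ (cont (T h x)) (npow_1_improper (T h x)).
apply: norm_small_eq => e he.
have [N hN] := proj1 (filterlim_normP _ _ _ _) h1 (e / 2) ltac:(lra).
have [N' hN'] := proj1 (filterlim_normP _ _ _ _) h2 (e / 2) ltac:(lra).
pose b := Rmax (Rmax N N') 0 + 1.
have hb1 := Rmax_l (Rmax N N') 0; have hb0 := Rmax_r (Rmax N N') 0.
have hb2 := Rmax_l N N'; have hb3 := Rmax_r N N'.
have n1 := hN (b + h) ltac:(rewrite /b; lra).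
have n2 := hN' b ltac:(rewrite /b; lra).
have e1 : RInt (fun t => T t (T h x)) 0 b = RInt (fun t => T t x) h (b + h).
  have c := RInt_correct _ _ _ (ex_RInt_sg x h (b + h)).
  have c1 : h = 1 * 0 + h by ring.
  have c2 : b + h = 1 * b + h by ring.
  rewrite {1}c1 c2 in c; rewrite c2.
  apply: is_RInt_unique; apply: is_RInt_ext (is_RInt_comp_lin _ _ _ _ _ _ c) => t.
  rewrite Rmin_left; last by rewrite /b; lra.
  move=> ht; rewrite Rmult_1_l (ss_add _ _ hT); try lra.
  exact: scal_one.
have e2 := RInt_Chasles _ _ _ _ (ex_RInt_sg x 0 h) (ex_RInt_sg x h (b + h)).
rewrite -e1 in e2; rewrite -e2 in n1.
set Y := P 1 (T h x) in n2 *; set Z := P 1 x in n1 *.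
set I1 := RInt _ 0 h in n1 *; set I2 := RInt _ 0 b in n1 n2.
have -> : minus Y (minus Z I1) = minus (minus (plus I1 I2) Z) (minus I2 Y) by vec.
apply: Rle_trans (norm_minus_le _ _ _) _; nlra.
Qed.

Lemma npow_1_sg h x : 0 <= h ->
  P 1 (minus x (T h x)) = RInt (fun t => T t x) 0 h.
Proof.
move=> hh; have h1 : is_linear (P 1) by apply: npow_linear; lra.
rewrite (linear_minus _ _ _ h1) npow_sg; last lra.
rewrite sg_npow_1 //; vec.
Qed.

Lemma is_derive_sg_npow_1 x t : 0 < t ->
  is_derive (fun t => T t (P 1 x)) t (opp (T t x)).
Proof.
move=> ht.
have h1 : is_derive (fun t => minus (P 1 x) (RInt (fun t => T t x) 0 t)) t
    (minus zero (T t x)).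
  apply: is_derive_minus; first exact: is_derive_const.
  apply: (is_derive_RInt (fun t => T t x) _ 0 t); last exact: cont.
  by apply: filter_forall => s; apply: RInt_correct; exact: ex_RInt_sg.
apply: (is_derive_eq _ _ (minus zero (T t x))); last by vec.
apply: is_derive_ext_loc h1; apply: locally_pos => // s hs.
by rewrite sg_npow_1 //; lra.
Qed.

Definition generator (y z : X) : Prop :=
  filterlim (fun h => scal (/ h) (minus (T h y) y)) (at_right 0) (locally z).

Lemma generator_npow_1 x : generator (P 1 x) (opp x).
Proof.
have h1 := RInt_average (fun t => T t x) (cont x).
rewrite (ss_neg _ _ hT) in h1; last lra.
have h2 := filterlim_comp _ _ _ _ opp _ _ _ h1 (filterlim_opp x).
apply: filterlim_ext_loc h2; apply/at_right_0P; exists 1; split; first lra.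
move=> s hs; rewrite sg_npow_1; last lra; vec.
Qed.

(** [P 1] turns the difference quotient of [y] into minus the mean of its orbit over [[0, h]], which
    tends to [- y]. *)
Lemma generator_inv y z : generator y z -> y = opp (P 1 z).
Proof.
move=> hg; have hl : is_linear (P 1) by apply: npow_linear; lra.
have h1 := filterlim_comp _ _ _ _ (P 1) _ _ _ hg (linear_cont _ z hl).
have h2 := RInt_average (fun t => T t y) (cont y).
rewrite (ss_neg _ _ hT) in h2; last lra.
have h3 := filterlim_comp _ _ _ _ opp _ _ _ h2 (filterlim_opp y).
have -> : y = opp (opp y) by vec.
f_equal; apply: (filterlim_locally_unique _ _ _ h3).
apply: filterlim_ext_loc h1; apply/at_right_0P; exists 1; split; first lra.
move=> s hs; rewrite (linear_scal _ hl) -npow_1_sg; last lra.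
rewrite !(linear_minus _ _ _ hl); vec.
Qed.

Lemma npow_1_inj x y : P 1 x = P 1 y -> x = y.
Proof.
move=> h; have h1 := generator_npow_1 x; rewrite h in h1.
have h2 := filterlim_locally_unique _ _ _ h1 (generator_npow_1 y).
have e : x = opp (opp x) by vec.
by rewrite e h2; vec.
Qed.

(** The mean of the orbit over a short interval is close to [x], and it is [P 1] of a difference
    quotient. *)
Lemma npow_1_dense x e : 0 < e -> exists y, norm (minus x (P 1 y)) < e.
Proof.
move=> he; have h1 := RInt_average (fun t => T t x) (cont x).
rewrite (ss_neg _ _ hT) in h1; last lra.
have [d [hd h]] := proj1 (at_right_0P _) (proj1 (filterlim_normP _ _ _ _) h1 e he).
exists (scal (/ (d / 2)) (minus x (T (d / 2) x))).
have hl : is_linear (P 1) by apply: npow_linear; lra.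
rewrite (linear_scal _ hl) npow_1_sg; last lra.
by rewrite norm_minus_sym; apply: h; lra.
Qed.

End Semigroup.

(** * Real inner products *)

Lemma is_derive_normP {V : NormedModule R_AbsRing} (f : R -> V) (x : R) (l : V) :
  is_derive f x l <->
  forall e, 0 < e -> exists d, 0 < d /\ forall y, Rabs (y - x) < d ->
    norm (minus (minus (f y) (f x)) (scal (y - x) l)) <= e * Rabs (y - x).
Proof.
split.
- move=> [_ h] e he.
  have [d hd] := h x (fun P hP => hP) (mkposreal e he).
  by exists d; split; [exact: cond_pos|move=> y hy; apply: (hd y hy)].
- move=> h; split; first exact: is_linear_scal_l.
  move=> x' hx' e.
  have e1 : x = x' by exact: is_filter_lim_locally_unique hx'.
  have [d [hd h']] := h e (cond_pos e).
  by exists (mkposreal d hd) => y hy; rewrite -e1; apply: h'.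
Qed.

Lemma is_derive_bilinear {U V W : NormedModule R_AbsRing} (b : U -> V -> W)
    (M : R) (f : R -> U) (g : R -> V) (x : R) (df : U) (dg : V) :
  (forall u u' v, b (plus u u') v = plus (b u v) (b u' v)) ->
  (forall u v v', b u (plus v v') = plus (b u v) (b u v')) ->
  (forall (r : R) u v, b (scal r u) v = scal r (b u v)) ->
  (forall (r : R) u v, b u (scal r v) = scal r (b u v)) ->
  0 <= M -> (forall u v, norm (b u v) <= M * norm u * norm v) ->
  is_derive f x df -> is_derive g x dg ->
  is_derive (fun t => b (f t) (g t)) x (plus (b df (g x)) (b (f x) dg)).
Proof.
move=> bl br sl sr hM hb hf hg.
have bml u u' v : b (minus u u') v = minus (b u v) (b u' v).
  have -> : minus u u' = plus u (scal (- 1) u') by vec.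
  rewrite bl sl; vec.
have bmr u v v' : b u (minus v v') = minus (b u v) (b u v').
  have -> : minus v v' = plus v (scal (- 1) v') by vec.
  rewrite br sr; vec.
have cg : continuous g x by apply: ex_derive_continuous; exists dg.
apply/is_derive_normP => e he.
(* The error splits into three bilinear terms, bounded by [q * Rabs (y - x)] times the three
   contributions to [C]; the last 1 makes [C] positive. *)
pose C := M * (norm (g x) + 1 + norm (f x) + norm df) + 1.
have n1 := norm_ge_0 (g x); have n2 := norm_ge_0 (f x); have n3 := norm_ge_0 df.
have hC : 0 < C by rewrite /C; nra.
have hd0 : 0 < e / C by apply: Rdiv_lt_0_compat.
have eC : C * (e / C) = e by field; lra.
set q := e / C in hd0 eC.
have [d1 [hd1 h1]] := proj1 (is_derive_normP _ _ _) hf q hd0.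
have [d2 [hd2 h2]] := proj1 (is_derive_normP _ _ _) hg q hd0.
have hm : 0 < Rmin 1 q by apply: Rmin_glb_lt; lra.
have [d3 [hd3 h3]] := proj1 (continuous_normP _ _ _) cg _ hm.
exists (Rmin d1 (Rmin d2 d3)); split; first by do 2 (apply: Rmin_glb_lt => //).
move=> y hy.
have hy1 := Rlt_le_trans _ _ _ hy (Rmin_l _ _).
have hy' := Rlt_le_trans _ _ _ hy (Rmin_r _ _).
have hy2 := Rlt_le_trans _ _ _ hy' (Rmin_l _ _).
have hy3 := Rlt_le_trans _ _ _ hy' (Rmin_r _ _).
have {}h1 := h1 y hy1; have {}h2 := h2 y hy2; have {}h3 := h3 y hy3.
have ha := Rabs_pos (y - x).
set A := minus (minus (f y) (f x)) (scal (y - x) df) in h1.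
set B := minus (minus (g y) (g x)) (scal (y - x) dg) in h2.
set D := minus (g y) (g x) in h3.
have -> : minus (minus (b (f y) (g y)) (b (f x) (g x)))
    (scal (y - x) (plus (b df (g x)) (b (f x) dg))) =
  plus (b A (g y)) (plus (b (f x) B) (scal (y - x) (b df D))).
  rewrite /A /B /D !bml !bmr !sl !sr; vec.
have k1 : norm (g y) <= norm (g x) + 1.
  have := norm_le_minus _ (g y) (g x); have := Rmin_l 1 q; rewrite -/D; lra.
have k2 : norm D <= q by have := Rmin_r 1 q; lra.
apply: Rle_trans (norm_triangle _ _) _.
have := norm_triangle (b (f x) B) (scal (y - x) (b df D)); rewrite norm_scal_eq.
have b1 := hb A (g y); have b2 := hb (f x) B; have b3 := hb df D.
have c1 : M * norm A * norm (g y) <= M * (q * Rabs (y - x)) * (norm (g x) + 1).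
  apply: Rmult_le_compat => //; try exact: norm_ge_0.
    by apply: Rmult_le_pos => //; exact: norm_ge_0.
  exact: Rmult_le_compat_l.
have c2 : M * norm (f x) * norm B <= M * norm (f x) * (q * Rabs (y - x)).
  by apply: Rmult_le_compat_l => //; apply: Rmult_le_pos.
have c3 : M * norm df * norm D <= M * norm df * q.
  by apply: Rmult_le_compat_l => //; apply: Rmult_le_pos.
have c4 : Rabs (y - x) * norm (b df D) <= Rabs (y - x) * (M * norm df * q).
  by apply: Rmult_le_compat_l => //; lra.
have c5 : e * Rabs (y - x) = M * (q * Rabs (y - x)) * (norm (g x) + 1) +
  (M * norm (f x) * (q * Rabs (y - x)) + Rabs (y - x) * (M * norm df * q)) +
  q * Rabs (y - x) by rewrite -eC /C; ring.
have c6 : 0 <= q * Rabs (y - x) by apply: Rmult_le_pos; lra.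
lra.
Qed.

Record real_inner (X : NormedModule R_AbsRing) (ip : X -> X -> R) : Prop := {
  ip_plus_l : forall x y z, ip (plus x y) z = ip x z + ip y z;
  ip_scal_l : forall (r : R) x y, ip (scal r x) y = r * ip x y;
  ip_sym : forall x y, ip x y = ip y x;
  ip_norm : forall x, ip x x = norm x ^ 2
}.

Section InnerProduct.

Variables (X : NormedModule R_AbsRing) (ip : X -> X -> R).
Hypothesis hip : real_inner X ip.

Lemma ip_plus_r x y z : ip x (plus y z) = ip x y + ip x z.
Proof. by rewrite !(ip_sym _ _ hip x) (ip_plus_l _ _ hip). Qed.

Lemma ip_scal_r (r : R) x y : ip x (scal r y) = r * ip x y.
Proof. by rewrite !(ip_sym _ _ hip x) (ip_scal_l _ _ hip). Qed.

Lemma ip_minus_l x y z : ip (minus x y) z = ip x z - ip y z.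
Proof.
have -> : minus x y = plus x (scal (- 1) y) by vec.
rewrite (ip_plus_l _ _ hip) (ip_scal_l _ _ hip); ring.
Qed.

Lemma ip_minus_r x y z : ip x (minus y z) = ip x y - ip x z.
Proof. by rewrite !(ip_sym _ _ hip x) ip_minus_l. Qed.

Lemma ip_opp_l x y : ip (opp x) y = - ip x y.
Proof.
have -> : opp x = scal (- 1) x by vec.
rewrite (ip_scal_l _ _ hip); ring.
Qed.

Lemma ip_opp_r x y : ip x (opp y) = - ip x y.
Proof. by rewrite !(ip_sym _ _ hip x) ip_opp_l. Qed.

(** Expand the square of the norm of [norm y * x - norm x * y]. The result carries a factor
    [norm x * norm y], so null vectors are treated apart. *)
Lemma ip_le x y : ip x y <= norm x * norm y.
Proof.
have nx := norm_ge_0 x; have ny := norm_ge_0 y.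
case: (Req_dec (norm y) 0) => h0.
  have -> : y = scal 0 y by rewrite (norm_eq_zero _ h0); vec.
  rewrite ip_scal_r; have := norm_ge_0 (scal 0 y); nra.
have h := ip_norm _ _ hip (minus (scal (norm y) x) (scal (norm x) y)).
rewrite !ip_minus_l !ip_minus_r !ip_scal_r !(ip_scal_l _ _ hip) !(ip_norm _ _ hip)
  (ip_sym _ _ hip y x) in h.
have h1 : 0 <= 2 * (norm x * norm y) * (norm x * norm y - ip x y).
  have := pow2_ge_0 (norm (minus (scal (norm y) x) (scal (norm x) y))).
  rewrite -h; lra.
case: (Req_dec (norm x) 0) => hx0.
  have -> : x = scal 0 x by rewrite (norm_eq_zero _ hx0); vec.
  rewrite (ip_scal_l _ _ hip); have := norm_ge_0 (scal 0 x); nra.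
have h2 : 0 < norm x * norm y by nra.
apply: Rnot_lt_le => hlt; nra.
Qed.

Lemma ip_abs_le x y : Rabs (ip x y) <= norm x * norm y.
Proof.
apply: Rabs_le; split; last exact: ip_le.
have := ip_le (opp x) y; rewrite ip_opp_l norm_opp; lra.
Qed.

Lemma ip_linear_l y : is_linear (V := R_NormedModule) (fun x => ip x y).
Proof.
apply: (is_linear_intro X R_NormedModule _ (norm y)).
- by move=> u v; exact: (ip_plus_l _ _ hip).
- by move=> r u; exact: (ip_scal_l _ _ hip).
- by move=> u; have := ip_abs_le u y; rewrite Rmult_comm.
Qed.

Lemma ip_linear_r x : is_linear (V := R_NormedModule) (fun y => ip x y).
Proof.
apply: (is_linear_ext (V := R_NormedModule) (fun y => ip y x)).
  by move=> y; exact: (ip_sym _ _ hip).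
exact: ip_linear_l.
Qed.

Lemma is_derive_ip (f g : R -> X) (t : R) (df dg : X) :
  is_derive f t df -> is_derive g t dg ->
  is_derive (fun t => ip (f t) (g t)) t (ip df (g t) + ip (f t) dg).
Proof.
move=> hf hg.
apply: (is_derive_bilinear (W := R_NormedModule) ip 1) => //.
- exact: (ip_plus_l _ _ hip).
- exact: ip_plus_r.
- exact: (ip_scal_l _ _ hip).
- exact: ip_scal_r.
- lra.
- by move=> u v; rewrite Rmult_1_l; exact: ip_abs_le.
Qed.

Lemma continuous_ip (f g : R -> X) (t : R) :
  continuous f t -> continuous g t -> continuous (fun t => ip (f t) (g t)) t.
Proof.
move=> hf hg; apply/continuous_normP => e he.
pose C := norm (f t) + norm (g t) + 1.
have n1 := norm_ge_0 (f t); have n2 := norm_ge_0 (g t).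
have hC : 0 < C by rewrite /C; lra.
have hq : 0 < Rmin 1 (e / (2 * C)).
  by apply: Rmin_glb_lt; [lra|apply: Rdiv_lt_0_compat; lra].
have [d1 [hd1 h1]] := proj1 (continuous_normP _ _ _) hf _ hq.
have [d2 [hd2 h2]] := proj1 (continuous_normP _ _ _) hg _ hq.
exists (Rmin d1 d2); split; first exact: Rmin_glb_lt.
move=> s hs.
have {}h1 := h1 s (Rlt_le_trans _ _ _ hs (Rmin_l _ _)).
have {}h2 := h2 s (Rlt_le_trans _ _ _ hs (Rmin_r _ _)).
have m1 := Rmin_l 1 (e / (2 * C)); have m2 := Rmin_r 1 (e / (2 * C)).
have eC : C * (e / (2 * C)) = e / 2 by field; lra.
set q := e / (2 * C) in m2 eC h1 h2 m1 hq.
have e1 : ip (f s) (g s) - ip (f t) (g t) =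
    ip (minus (f s) (f t)) (g s) + ip (f t) (minus (g s) (g t)).
  rewrite ip_minus_l ip_minus_r; ring.
have k := norm_le_minus _ (g s) (g t).
have k1 := ip_abs_le (minus (f s) (f t)) (g s).
have k2 := ip_abs_le (f t) (minus (g s) (g t)).
have k3 : norm (minus (f s) (f t)) * norm (g s) <= q * (norm (g t) + 1).
  apply: Rmult_le_compat; try exact: norm_ge_0; lra.
have k4 : norm (f t) * norm (minus (g s) (g t)) <= norm (f t) * q.
  by apply: Rmult_le_compat_l; lra.
change (Rabs (ip (f s) (g s) - ip (f t) (g t)) < e); rewrite e1.
apply: Rle_lt_trans (Rabs_triang _ _) _.
have : C * q = q * (norm (g t) + 1) + norm (f t) * q by rewrite /C; ring.
lra.
Qed.

(** At [x + D x] the quadratic form of [D] reduces to [2 * norm (D x) ^ 2]. Operator identities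
    between symmetric operators can therefore be checked on scalar functions such as
    [ip (T t x) x]. *)
Lemma symmetric_zero (D : X -> X) :
  is_linear D -> (forall x y, ip (D x) y = ip x (D y)) ->
  (forall x, ip (D x) x = 0) -> forall x, D x = zero.
Proof.
move=> hD hs h0 x; apply: norm_eq_zero.
have h := h0 (plus x (D x)).
rewrite (linear_plus _ hD) ip_plus_r !(ip_plus_l _ _ hip) !h0 (hs (D x) x)
  (ip_norm _ _ hip) in h.
nra.
Qed.

End InnerProduct.

(** * Symmetric semigroups *)

Section SymmetricSemigroup.

Variables (X : CompleteNormedModule R_AbsRing) (ip : X -> X -> R)
  (T : R -> X -> X).
Hypothesis hip : real_inner X ip.
Hypothesis hT : stable_semigroup X T.
Hypothesis npow_1_sym : forall x y, ip (npow T 1 x) y = ip x (npow T 1 y).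

Let lin := ss_lin X T hT.
Let cont := ss_cont X T hT.
Local Notation P := (npow T).

(** On the range of [P 1] orbits are differentiable, and [ip (T s _) (T (t - s) _)] has zero
    derivative in [s] by symmetry of [P 1]; comparing [s = 0] with [s = t] gives the claim there,
    and density gives the rest. *)
Lemma sg_sym t x y : ip (T t x) y = ip x (T t y).
Proof.
case: (Rle_dec t 0) => ht; first by rewrite !(ss_neg _ _ hT t).
have dense_case a b : ip (T t (P 1 a)) (P 1 b) = ip (P 1 a) (T t (P 1 b)).
  pose phi s := ip (T s (P 1 a)) (T (t - s) (P 1 b)).
  have lin_sub s : is_derive (fun s : R => t - s) s (- 1) by auto_derive; [|ring].
  have cphi s : continuous phi s.
    apply: continuous_ip => //; apply: (continuous_comp (fun s : R => t - s) (fun r => T r (P 1 b)));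
      last exact: cont.
    by apply: ex_derive_continuous; exists (- 1).
  have d s : 0 < s < t -> is_derive phi s 0.
    move=> hs.
    have d1 := is_derive_sg_npow_1 X T hT a s ltac:(lra).
    have d2 := is_derive_comp _ _ s _ _
      (is_derive_sg_npow_1 X T hT b (t - s) ltac:(lra)) (lin_sub s).
    apply: (is_derive_eq_R _ _ _ _ (is_derive_ip _ _ hip _ _ _ _ _ d1 d2)).
    rewrite (ip_opp_l _ _ hip) (ip_scal_r _ _ hip) (ip_opp_r _ _ hip).
    rewrite -(npow_sg X T hT); last lra.
    rewrite -(npow_sg X T hT); last lra.
    rewrite npow_1_sym; ring.
  have [c [hc1 hc2]] := MVT_gen phi 0 t (fun _ => 0)
    ltac:(rewrite Rmin_left ?Rmax_right; [exact: d|lra|lra])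
    ltac:(move=> s _; apply/continuity_pt_filterlim; exact: cphi).
  move: hc2; rewrite Rmult_0_l /phi Rminus_diag Rminus_0_r.
  rewrite !(ss_neg _ _ hT 0); lra.
have hd := npow_1_dense X T hT.
have l1 z := is_linear_comp _ _ (lin t) (ip_linear_l X ip hip z).
have l2 z := is_linear_comp _ _ (lin t) (ip_linear_r X ip hip z).
apply: (linear_dense_eq (P 1) (fun x => ip (T t x) y : R_NormedModule)
  (fun x => ip x (T t y)) _ _ hd) => //; first exact: ip_linear_l.
move=> a; apply: (linear_dense_eq (P 1)
  (fun y => ip (T t (P 1 a)) y : R_NormedModule) (fun y => ip (P 1 a) (T t y))) => //.
exact: ip_linear_r.
Qed.

Lemma sg_inner s t x : 0 <= s -> 0 <= t ->
  ip (T s x) (T t x) = norm (T ((s + t) / 2) x) ^ 2.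
Proof.
move=> hs ht; rewrite -(ip_norm _ _ hip) -!sg_sym -!(ss_add _ _ hT); try lra.
by have -> : (s + t) / 2 + (s + t) / 2 = t + s by field.
Qed.

(** By symmetry and Cauchy-Schwarz, [norm (T s x) ^ 2 = ip (T (2 * s) x) x] is at most
    [norm (T (2 * s) x) * norm x]. A ratio [r > 1] at time [t] would thus gain at least one more
    factor [r] with each doubling of the time, against the uniform bound on the semigroup. *)
Lemma sg_contraction t x : norm (T t x) <= norm x.
Proof.
case: (Rle_dec t 0) => ht; first by rewrite (ss_neg _ _ hT t) //; lra.
apply: Rnot_lt_le => hlt.
have hx : 0 < norm x.
  have [h|h] := norm_ge_0 x; first exact: h.
  move: hlt; rewrite (norm_eq_zero x) //; rewrite (linear_zero _ (lin t)) => ?; lra.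
pose r := norm (T t x) / norm x.
have hr : 1 < r by apply: (Rmult_lt_reg_r (norm x)) => //; rewrite /r; field_simplify; lra.
have hn n : exists s, 0 <= s /\ r ^ S n * norm x <= norm (T s x).
  elim: n => [|n [s [hs IH]]].
    exists t; split; first lra; rewrite /= Rmult_1_r /r; right; field; lra.
  exists (2 * s); split; first lra.
  have h1 := sg_inner s s x hs hs.
  have e1 : (s + s) / 2 = s by field.
  rewrite e1 -sg_sym -(ss_add _ _ hT) // in h1.
  have h2 := ip_le _ _ hip (T (s + s) x) x; rewrite h1 in h2.
  have e2 : 2 * s = s + s by ring.
  rewrite e2; apply: (Rmult_le_reg_r (norm x)) => //.
  apply: Rle_trans h2.
  have hp : 0 < r ^ S n by apply: pow_lt; lra.
  have h3 : r <= r ^ S n.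
    rewrite -{1}(pow_1 r); apply: Rle_pow; [lra|lia].
  have h4 : r ^ S n * norm x * (r ^ S n * norm x) <= norm (T s x) * norm (T s x).
    by apply: Rmult_le_compat => //; apply: Rmult_le_pos; lra.
  have h5 : r * (r ^ S n * norm x * norm x) <= r ^ S n * (r ^ S n * norm x * norm x).
    apply: Rmult_le_compat_r => //; apply: Rmult_le_pos; [apply: Rmult_le_pos|]; lra.
  change (r ^ S (S n)) with (r * r ^ S n); lra.
have [M [w [hw hM]]] := ss_bound _ _ hT.
have hr' : Rabs r > 1 by rewrite Rabs_pos_eq; lra.
have [N hN] := Pow_x_infinity r hr' (Rabs M + 1).
have {}hN := hN (S N) ltac:(lia).
rewrite Rabs_pos_eq in hN; last by apply: pow_le; lra.
have [s [hs h1]] := hn N.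
have h2 := hM s x hs.
have h3 : M * exp (- w * s) <= Rabs M * 1.
  apply: Rle_trans (Rmult_le_compat_r _ _ _ (Rlt_le _ _ (exp_pos _)) (Rle_abs M)) _.
  apply: Rmult_le_compat_l; first exact: Rabs_pos.
  rewrite -exp_0; apply: exp_mono; nra.
have h4 := Rmult_le_compat_r _ _ _ (Rlt_le _ _ hx) h3.
have h5 := Rmult_le_compat_r _ _ _ (Rlt_le _ _ hx) (Rge_le _ _ hN).
lra.
Qed.

Lemma sg_norm_decr s t x : s <= t -> norm (T t x) <= norm (T s x).
Proof.
move=> hst; case: (Rle_dec s 0) => hs.
  by rewrite (ss_neg _ _ hT s) //; exact: sg_contraction.
have -> : t = (t - s) + s by ring.
by rewrite (ss_add _ _ hT); [exact: sg_contraction|lra|lra].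
Qed.

Lemma sg_form_decr s t x : 0 <= s <= t -> ip (T t x) x <= ip (T s x) x.
Proof.
move=> hst.
have e u : ip (T u x) x = ip (T u x) (T 0 x) by rewrite (ss_neg _ _ hT 0) //; lra.
rewrite !e !sg_inner; try lra.
apply: pow_incr; split; first exact: norm_ge_0.
by apply: sg_norm_decr; lra.
Qed.

Lemma sg_form_ge_0 t x : 0 <= t -> 0 <= ip (T t x) x.
Proof.
move=> ht.
have -> : ip (T t x) x = ip (T t x) (T 0 x) by rewrite (ss_neg _ _ hT 0) //; lra.
by rewrite sg_inner; [exact: pow2_ge_0|lra|lra].
Qed.

Lemma improper_ge_const (g : R -> R) (L c t : R) :
  (forall s, 0 < s -> continuous g s) -> (forall s, 0 < s -> 0 <= g s) ->
  improper g L -> 0 < t -> (forall s, 0 < s <= t -> c <= g s) -> t * c <= L.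
Proof.
move=> cg g0 hL ht hc.
have [h1 _] := proj1 (improper_nonnegP g L cg g0) hL.
have hL0 : 0 <= L.
  apply: Rle_trans (h1 1 2 ltac:(lra)).
  apply: RInt_ge_0; first lra; first by apply: ex_RInt_pos => //; lra.
  by move=> s hs; apply: g0; lra.
case: (Rle_dec c 0) => hc0; first nra.
apply: Rle_plus_epsilon => e he.
pose a := Rmin (t / 2) (e / c).
have hec : 0 < e / c by apply: Rdiv_lt_0_compat; lra.
have ha : 0 < a by apply: Rmin_glb_lt; lra.
have ha1 : a <= t / 2 by exact: Rmin_l.
have ha2 : a <= e / c by exact: Rmin_r.
have ha3 : a * c <= e.
  have -> : e = e / c * c by field; lra.
  apply: Rmult_le_compat_r; lra.
have h2 : RInt (fun _ => c) a t <= RInt g a t.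
  apply: RInt_le_pos => //; try lra.
  - by move=> s _; exact: continuous_const.
  - by move=> s hs; apply: hc; lra.
rewrite RInt_const in h2.
have := h1 a t ltac:(lra); move: h2; rewrite /scal /= /mult /=; lra.
Qed.

(** This is the analyticity estimate [norm (A (T t x)) <= norm x / t], in the
    form [norm (T t x) <= norm ((-A)^(-1) x) / t]. *)
Lemma sg_le_npow_1 t x : 0 < t -> t * norm (T t x) <= norm (P 1 x).
Proof.
move=> ht.
have i1 y z : improper (fun s => ip (T s y) z) (ip (P 1 y) z).
  exact: (improper_linear X R_NormedModule (fun v => ip v z) _ _
    (ip_linear_l X ip hip z) (npow_1_improper X T hT y)).
have c1 y z s : continuous (fun s => ip (T s y) z) s.
  by apply: continuous_ip => //; exact: continuous_const.
have pos s r : 0 < s -> 0 < r -> 0 <= ip (T r x) (T s x).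
  by move=> hs hr; rewrite sg_inner; [exact: pow2_ge_0|lra|lra].
(* The square of [norm (P 1 x)] is the double integral of [ip (T r x) (T s x)], which is the square
   of the norm at the time [(r + s) / 2], hence at least [norm (T t x) ^ 2] on the square of side
   [t]. *)
have h1 s : 0 < s <= t -> t * norm (T t x) ^ 2 <= ip (T s x) (P 1 x).
  move=> hs; rewrite (ip_sym _ _ hip).
  apply: (improper_ge_const _ _ _ t _ _ (i1 x (T s x))) => //.
    by move=> r hr; apply: pos; lra.
  move=> r hr; rewrite sg_inner; try lra.
  apply: pow_incr; split; first exact: norm_ge_0.
  by apply: sg_norm_decr; lra.
have h2 : t * (t * norm (T t x) ^ 2) <= ip (P 1 x) (P 1 x).
  apply: (improper_ge_const _ _ _ t _ _ (i1 x (P 1 x))) => // s hs.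
  rewrite (ip_sym _ _ hip).
  have [h _] := proj1 (improper_nonnegP _ _ (fun r _ => c1 x (T s x) r)
     (fun r hr => pos s r hs hr)) (i1 x (T s x)).
  apply: Rle_trans (h 1 2 ltac:(lra)).
  apply: RInt_ge_0; first lra; first by apply: ex_RInt_pos => //; lra.
  by move=> r hr; apply: pos; lra.
rewrite (ip_norm _ _ hip) in h2.
have n1 := norm_ge_0 (T t x); have n2 := norm_ge_0 (P 1 x).
apply: Rnot_lt_le => hlt; nra.
Qed.

(** [G] is the bounded operator [- A (T t)]. Since [norm (T t x)] is bounded by a multiple of
    [norm (P 1 x)], the map sending [P 1 x] to [T t x] extends from the dense range of [P 1]. *)
Lemma sg_factor t : 0 < t ->
  exists G, is_linear G /\ forall x, P 1 (G x) = T t x.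
Proof.
move=> ht.
have l1 : is_linear (P 1) by apply: npow_linear => //; lra.
have [G [hG hGP]] := dense_extension X X X (P 1) (T t) (/ t)
  (linear_plus _ l1) (linear_scal _ l1) (linear_plus _ (lin t))
  (linear_scal _ (lin t))
  ltac:(move=> x; have := sg_le_npow_1 t x ht => h;
        apply: (Rmult_le_reg_l t) => //; rewrite -Rmult_assoc Rinv_r; lra)
  (npow_1_dense X T hT).
exists G; split=> //.
apply: (linear_dense_eq (P 1)) => //.
- exact: is_linear_comp.
- exact: npow_1_dense.
- by move=> y; rewrite hGP npow_sg //; lra.
Qed.

Lemma npow_sym a x y : 0 <= a <= 1 -> ip (P a x) y = ip x (P a y).
Proof.
move=> ha; case: (Req_dec a 0) => [->|h0]; first by rewrite !npow_0.
rewrite !npow_pos; try lra.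
rewrite (ip_scal_l _ _ hip) (ip_scal_r _ _ hip); f_equal.
have h1 := improper_linear X R_NormedModule (fun v => ip v y) _ _
  (ip_linear_l X ip hip y) (power_integralP X T hT a x ltac:(lra)).
have h2 := improper_linear X R_NormedModule (fun v => ip x v) _ _
  (ip_linear_r X ip hip x) (power_integralP X T hT a y ltac:(lra)).
apply: (improper_eq _ _ _ _ h1); apply: (improper_ext_R _ _ _ _ h2) => t ht.
by rewrite (ip_scal_l _ _ hip) (ip_scal_r _ _ hip) sg_sym.
Qed.

(** The difference of the two sides is symmetric because the powers commute, so the quadratic forms
    suffice. For these the law is the scalar convolution formula for the nonincreasing function
    [ip (T t x) x]. *)
Lemma npow_add a b x : 0 <= a -> 0 <= b -> a + b <= 1 ->
  P a (P b x) = P (a + b) x.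
Proof.
move=> ha0 hb0 hab.
case: (Req_dec a 0) => [->|ha1]; first by rewrite npow_0 Rplus_0_l.
case: (Req_dec b 0) => [->|hb1]; first by rewrite npow_0 Rplus_0_r.
have la : 0 <= a <= 1 by lra.
have lb : 0 <= b <= 1 by lra.
have lab : 0 <= a + b <= 1 by lra.
have lPa := npow_linear X T hT a la; have lPb := npow_linear X T hT b lb.
have lPab := npow_linear X T hT _ lab.
pose D x := minus (P a (P b x)) (P (a + b) x).
have Dlin : is_linear D.
  have [M3 [_ b3]] := linear_norm _ lPab.
  have l1 := is_linear_comp _ _ lPb lPa.
  have [M [hM bM]] := linear_norm _ l1.
  apply: (is_linear_intro _ _ _ (M + M3)).
  - move=> u v; rewrite /D (linear_plus _ lPab) (linear_plus _ l1); vec.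
  - move=> r u; rewrite /D (linear_scal _ lPab) (linear_scal _ l1); vec.
  - move=> u; apply: Rle_trans (norm_minus_le _ _ _) _.
    have := bM u; have := b3 u; nlra.
suff hD : D x = zero.
  have -> : P a (P b x) = plus (D x) (P (a + b) x) by rewrite /D; vec.
  by rewrite hD plus_zero_l.
apply: (symmetric_zero X ip hip D Dlin).
  move=> u v; rewrite /D (ip_minus_l _ _ hip) (ip_minus_r _ _ hip) !npow_sym //.
  by rewrite (npow_npow_comm X T hT b a).
move=> {}x; rewrite /D (ip_minus_l _ _ hip).
pose J c y := power_integral T c y.
have hJ c y z : 0 < c <= 1 -> improper (fun t => Rpower t (c - 1) * ip (T t y) z)
    (ip (J c y) z).
  move=> hc.
  have h1 := improper_linear X R_NormedModule (fun v => ip v z) _ _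
    (ip_linear_l X ip hip z) (power_integralP X T hT c y hc).
  apply: (improper_ext_R _ _ _ _ h1) => t ht.
  by rewrite (ip_scal_l _ _ hip).
have JT c s y : 0 < c <= 1 -> J c (T s y) = T s (J c y).
  move=> hc; apply: power_integral_eq => //.
  have := improper_linear _ _ _ _ _ (lin s) (power_integralP X T hT c y hc).
  apply: improper_ext => t ht.
  by rewrite (linear_scal _ (lin s)) (sg_comm X T hT).
have h := power_convolution_Gamma (fun t => ip (T t x) x)
  (fun s => ip (T s (J b x)) x) a b (ip (J b x) x) (ip (J (a + b) x) x)
  (ip (J a (J b x)) x).
have hG : ip (J a (J b x)) x * Gamma (a + b) =
    Gamma a * Gamma b * ip (J (a + b) x) x.
  apply: h; try lra.
  - by move=> t ht; apply: continuous_ip => //; exact: continuous_const.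
  - by move=> t ht; apply: sg_form_ge_0; lra.
  - by move=> s t hst; apply: sg_form_decr; lra.
  - by apply: hJ; lra.
  - by apply: hJ; lra.
  - by move=> t ht; apply: continuous_ip => //; exact: continuous_const.
  - move=> s hs; rewrite -JT; last lra.
    have h1 := hJ b (T s x) x ltac:(lra).
    apply: (improper_ext_R _ _ _ _ h1) => t ht.
    by rewrite -(ss_add _ _ hT) ?(Rplus_comm t); lra.
  - by apply: hJ; lra.
have ga := Gamma_pos a ltac:(lra); have gb := Gamma_pos b ltac:(lra).
have gab := Gamma_pos (a + b) ltac:(lra).
have e1 : P a (P b x) = scal (/ Gamma a * / Gamma b) (J a (J b x)).
  rewrite (npow_pos X T b); last lra.
  rewrite (linear_scal _ lPa) npow_pos; last lra.
  rewrite -/(J b x) -/(J a (J b x)); vec.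
rewrite e1 npow_pos; last lra.
rewrite -/(J (a + b) x) !(ip_scal_l _ _ hip).
have -> : ip (J a (J b x)) x = Gamma a * Gamma b * ip (J (a + b) x) x / Gamma (a + b).
  by rewrite -hG; field; lra.
field; lra.
Qed.

Lemma npow_inj a x y : 0 <= a <= 1 -> P a x = P a y -> x = y.
Proof.
move=> ha h; apply: (npow_1_inj X T hT).
have e z : P 1 z = P (1 - a) (P a z).
  by rewrite npow_add; try lra; f_equal; ring.
by rewrite !e h.
Qed.

End SymmetricSemigroup.

(** * The energy function *)

Section Energy.

Variables (X : CompleteNormedModule R_AbsRing) (ip : X -> X -> R)
  (T : R -> X -> X).
Hypothesis hip : real_inner X ip.
Hypothesis hT : stable_semigroup X T.
Hypothesis npow_1_sym : forall x y, ip (npow T 1 x) y = ip x (npow T 1 y).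
Variable q : R.
Hypothesis hq : 0 <= q <= 1 / 2.

Let lin := ss_lin X T hT.
Let cont := ss_cont X T hT.
Local Notation P := (npow T).

(** As [q <= 1 / 2], the power of [-A] involved has nonpositive exponent [q - 1 / 2], hence is
    bounded and defined on all of [X]. *)
Definition energy (x : X) : R := 1 / 2 * norm (P (1 / 2 - q) x) ^ 2.

(** [(-A)^q (T t x)], for [t > 0]. *)
Definition smoothed (t : R) (x : X) : X :=
  epsilon (inhabits zero) (fun g => P q g = T t x).

Lemma npow_smoothed t x : 0 < t -> P q (smoothed t x) = T t x.
Proof.
move=> ht; apply: (epsilon_spec (inhabits zero) (fun g => P q g = T t x)).
have [G [_ hG]] := sg_factor X ip T hip hT npow_1_sym t ht.
(* With [G = - A (T t)], this is [(-A)^q (T t x)] written as [-A] after [(-A)^(q-1)]. *)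
exists (G (P (1 - q) x)); apply: (npow_1_inj X T hT).
rewrite (npow_npow_comm X T hT); try lra.
rewrite hG !(npow_sg X T hT); try lra.
rewrite (npow_add X ip T hip hT npow_1_sym); try lra.
by have -> : q + (1 - q) = 1 by ring.
Qed.

Lemma smoothed_sg s t x : 0 < s -> 0 <= t ->
  smoothed (t + s) x = T t (smoothed s x).
Proof.
move=> hs ht; apply: (npow_inj X ip T hip hT npow_1_sym q); first lra.
rewrite npow_smoothed; last lra.
rewrite (npow_sg X T hT); last lra.
by rewrite npow_smoothed // (ss_add _ _ hT) //; lra.
Qed.

Lemma smoothed_decr s t x : 0 < s <= t ->
  norm (smoothed t x) <= norm (smoothed s x).
Proof.
move=> hst; have -> : t = (t - s) + s by ring.
by rewrite smoothed_sg; try lra; exact: (sg_contraction X ip T hip hT npow_1_sym).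
Qed.

Lemma locally_gt (s t : R) (Q : R -> Prop) :
  s < t -> (forall r, s < r -> Q r) -> locally t Q.
Proof.
move=> hst hQ; have hd : 0 < t - s by lra.
exists (mkposreal _ hd) => r hr; apply: hQ.
move: hr; rewrite /ball /= /AbsRing_ball /= /abs /minus /plus /opp /= => hr.
move/Rabs_def2: hr; lra.
Qed.

Lemma continuous_smoothed x t : 0 < t -> continuous (fun t => smoothed t x) t.
Proof.
move=> ht.
apply: (continuous_ext_loc _ (fun r => T (r - t / 2) (smoothed (t / 2) x))).
  apply: (locally_gt (t / 2)); first lra.
  move=> r hr; rewrite -smoothed_sg; try lra; f_equal; ring.
apply: (continuous_comp (fun r : R => r - t / 2)
  (fun s => T s (smoothed (t / 2) x))); last exact: cont.
by apply: ex_derive_continuous; auto_derive.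
Qed.

(** With [v = (-A)^(q - 1/2) x], the energy is half the square of [norm (T t v)]. From time [t / 2]
    on, this orbit lies in the range of [P 1] and is differentiable, with derivative [- c] at [t],
    where [c = - A (T t v)]. In [ip c (T t v)] a factor [P (1 / 2)] taken from the right turns [c]
    into [smoothed t x], leaving that vector on both sides. *)
Lemma is_derive_energy x t : 0 < t ->
  is_derive (fun t => energy (T t x)) t (- norm (smoothed t x) ^ 2).
Proof.
move=> ht; pose v := P (1 / 2 - q) x.
have [G [_ hG]] := sg_factor X ip T hip hT npow_1_sym (t / 2) ltac:(lra).
pose c := T (t - t / 2) (G v).
have d1 : is_derive (fun r => T r v) t (opp c).
  have d2 := is_derive_comp (fun s => T s (P 1 (G v))) (fun r : R => r - t / 2)
    t _ 1 (is_derive_sg_npow_1 X T hT (G v) (t - t / 2) ltac:(lra))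
    ltac:(by auto_derive; [|ring]).
  apply: (is_derive_eq _ _ (scal 1 (opp c))); last by vec.
  apply: is_derive_ext_loc d2; apply: (locally_gt (t / 2)); first lra.
  move=> r hr; rewrite hG -(ss_add _ _ hT); try lra; f_equal; ring.
have d3 := is_derive_scal _ t (1 / 2) _ (is_derive_ip X ip hip _ _ t _ _ d1 d1).
apply: (is_derive_eq_R _ _ _ _ (is_derive_ext _ _ _ _ _ d3)).
  by move=> r; rewrite /energy (npow_sg X T hT) ?(ip_norm _ _ hip) //; lra.
have e1 : T t v = P (1 / 2) (smoothed t x).
  rewrite /v -(npow_sg X T hT); last lra.
  rewrite -npow_smoothed // (npow_add X ip T hip hT npow_1_sym); try lra.
  by f_equal; ring.
have e2 : P (1 / 2) c = smoothed t x.
  apply: (npow_inj X ip T hip hT npow_1_sym (1 / 2)); first lra.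
  rewrite (npow_add X ip T hip hT npow_1_sym); try lra.
  have -> : 1 / 2 + 1 / 2 = 1 by field.
  rewrite -e1 /c (npow_sg X T hT); last lra.
  rewrite hG -(ss_add _ _ hT); try lra; f_equal; field.
rewrite (ip_opp_l _ _ hip) (ip_opp_r _ _ hip) (ip_sym _ _ hip _ c) e1.
rewrite -(npow_sym X ip T hip hT npow_1_sym); last lra.
rewrite e2 (ip_norm _ _ hip); field.
Qed.

Lemma continuous_smoothed_sqr x t : 0 < t ->
  continuous (fun t => norm (smoothed t x) ^ 2) t.
Proof.
move=> ht; apply: (continuous_ext (fun t => ip (smoothed t x) (smoothed t x))).
  by move=> s; exact: (ip_norm _ _ hip).
by apply: continuous_ip => //; exact: continuous_smoothed.
Qed.

Lemma RInt_smoothed x a b : 0 < a <= b ->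
  RInt (fun t => norm (smoothed t x) ^ 2) a b = energy (T a x) - energy (T b x).
Proof.
move=> hab.
have h : is_RInt (fun t => - norm (smoothed t x) ^ 2) a b
    (minus (energy (T b x)) (energy (T a x))).
  apply: (is_RInt_derive (fun t => energy (T t x))) => t;
    (rewrite Rmin_left; last lra); move=> ht.
    by apply: is_derive_energy; lra.
  by apply: (continuous_opp (V := R_NormedModule)); apply: continuous_smoothed_sqr; lra.
have h2 := is_RInt_opp _ _ _ _ h.
have h3 : is_RInt (fun t => norm (smoothed t x) ^ 2) a b
    (opp (minus (energy (T b x)) (energy (T a x)))).
  apply: is_RInt_ext h2 => t _; rewrite /opp /=; exact: Ropp_involutive.
rewrite (is_RInt_unique _ _ _ _ h3) /opp /minus /plus /opp /=; ring.
Qed.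

Lemma energy_sg_le s t x : s <= t -> energy (T t x) <= energy (T s x).
Proof.
move=> hst; rewrite /energy !(npow_sg X T hT); try lra.
apply: Rmult_le_compat_l; first lra.
apply: pow_incr; split; first exact: norm_ge_0.
exact: (sg_norm_decr X ip T hip hT npow_1_sym).
Qed.

Lemma energy_sg_0 x : energy (T 0 x) = energy x.
Proof. by rewrite (ss_neg _ _ hT) //; lra. Qed.

Lemma energy_ge_0 x : 0 <= energy x.
Proof. by rewrite /energy; have := pow2_ge_0 (norm (P (1 / 2 - q) x)); lra. Qed.

Lemma continuous_energy_sg x t : continuous (fun t => energy (T t x)) t.
Proof.
pose v := P (1 / 2 - q) x.
apply: (continuous_ext (fun t => 1 / 2 * ip (T t v) (T t v))).
  by move=> s; rewrite /energy (npow_sg X T hT) ?(ip_norm _ _ hip) //; lra.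
by apply: continuous_Rmult; [exact: continuous_const|apply: continuous_ip].
Qed.

Lemma energy_integral x : improper (fun t => norm (smoothed t x) ^ 2) (energy x).
Proof.
apply/improper_nonnegP.
- by move=> t ht; exact: continuous_smoothed_sqr.
- by move=> t ht; exact: pow2_ge_0.
split.
- move=> a b hab; rewrite RInt_smoothed; last lra.
  have := energy_ge_0 (T b x); have := energy_sg_le 0 a x ltac:(lra).
  rewrite energy_sg_0; lra.
- move=> e he; pose v := P (1 / 2 - q) x.
  have [d [hd h]] := proj1 (continuous_normP _ _ _) (continuous_energy_sg x 0)
    (e / 2) ltac:(lra).
  have {}h := h (d / 2) ltac:(rewrite Rminus_0_r Rabs_pos_eq; lra).
  have h1 : Rabs (energy (T (d / 2) x) - energy (T 0 x)) < e / 2 by exact: h.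
  rewrite energy_sg_0 in h1; move/Rabs_def2: h1 => h1.
  pose N := norm (P 1 v); have hN : 0 <= N by exact: norm_ge_0.
  have he2 : 0 < / e by exact: Rinv_0_lt_compat.
  (* From [b * norm (T b v) <= N], this choice makes [norm (T b v)] less than both 1 and [e], so
     that half its square is less than [e / 2]. *)
  pose b := d / 2 + 1 + (N + 1) * (1 + / e).
  have hb : 1 + d / 2 < b by rewrite /b; nra.
  have h2 := sg_le_npow_1 X ip T hip hT npow_1_sym b v ltac:(lra).
  have h3 : energy (T b x) < e / 2.
    rewrite /energy (npow_sg X T hT) -/v; last lra.
    have n0 := norm_ge_0 (T b v); rewrite -/N in h2.
    set z := norm (T b v) in h2 n0 *.
    have hz : (N + 1) * (1 + / e) * z <= N.
      have : (N + 1) * (1 + / e) <= b by rewrite /b; lra.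
      move=> k; apply: Rle_trans h2; exact: Rmult_le_compat_r.
    have hz2 : (1 + / e) * z < 1.
      apply: Rnot_le_lt => k.
      have := Rmult_le_compat_l (N + 1) _ _ ltac:(lra) k; lra.
    have z1 : z < 1 by nra.
    have z2 : z < e.
      have : / e * z < 1 by nra.
      move=> k; have := Rmult_lt_compat_l e _ _ he k.
      by rewrite -Rmult_assoc Rinv_r; lra.
    nra.
  exists (d / 2), b; split; first lra.
  rewrite RInt_smoothed; lra.
Qed.

Lemma energy_drop h x : 0 < h ->
  energy (T h x) - energy x <= - (h * norm (smoothed h x) ^ 2).
Proof.
move=> hh; set c := norm (smoothed h x) ^ 2.
have : h * c <= energy x - energy (T h x); last lra.
have hc : 0 <= c by exact: pow2_ge_0.
apply: Rle_plus_epsilon => e he.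
(* The integral is cut off at [a] away from 0, where [smoothed] is not controlled, at a cost
   [a * c <= e]; [c] may vanish, hence [c + 1]. *)
pose a := Rmin (h / 2) (e / (c + 1)).
have hec : 0 < e / (c + 1) by apply: Rdiv_lt_0_compat; lra.
have ha : 0 < a by apply: Rmin_glb_lt; lra.
have ha1 : a <= h / 2 by exact: Rmin_l.
have ha2 : a <= e / (c + 1) by exact: Rmin_r.
have ha3 : a * (c + 1) <= e.
  have -> : e = e / (c + 1) * (c + 1) by field; lra.
  apply: Rmult_le_compat_r; lra.
have h2 : RInt (fun _ => c) a h <= RInt (fun t => norm (smoothed t x) ^ 2) a h.
  apply: RInt_le_pos; try lra.
  - by move=> s _; exact: continuous_const.
  - by move=> s hs; exact: continuous_smoothed_sqr.
  - move=> s hs; apply: pow_incr; split; first exact: norm_ge_0.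
    by apply: smoothed_decr; lra.
rewrite RInt_const RInt_smoothed in h2; last lra.
have := energy_sg_le 0 a x ltac:(lra); rewrite energy_sg_0.
move: h2; rewrite /scal /= /mult /=; lra.
Qed.

Lemma energy_step h x z : 0 < h ->
  energy (plus (T h x) (P q z)) - energy x <=
  - (h * norm (smoothed h x) ^ 2) + norm (smoothed h x) * norm (P 1 z)
  + 1 / 2 * (norm z * norm (P 1 z)).
Proof.
move=> hh; have hd := energy_drop h x hh.
set g := smoothed h x in hd *.
have la : is_linear (P (1 / 2 - q)) by apply: npow_linear => //; lra.
have pq y : P (1 / 2 - q) (P q y) = P (1 / 2) y.
  rewrite (npow_add X ip T hip hT npow_1_sym); try lra; f_equal; ring.
have e1 : P (1 / 2 - q) (T h x) = P (1 / 2) g by rewrite -npow_smoothed.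
have half y w : ip (P (1 / 2) y) (P (1 / 2) w) = ip y (P 1 w).
  rewrite (npow_sym X ip T hip hT npow_1_sym); last lra.
  rewrite (npow_add X ip T hip hT npow_1_sym); try lra.
  by f_equal; f_equal; field.
have e2 : energy (plus (T h x) (P q z)) =
    energy (T h x) + ip g (P 1 z) + 1 / 2 * ip z (P 1 z).
  rewrite /energy (linear_plus _ la) pq e1 -!(ip_norm _ _ hip).
  rewrite (ip_plus_l _ _ hip) !(ip_plus_r _ _ hip) !half (ip_sym _ _ hip z).
  rewrite -(npow_1_sym g z) ?(ip_sym _ _ hip (P 1 g)).
  field.
rewrite e2.
have := ip_le X ip hip g (P 1 z); have := ip_le X ip hip z (P 1 z); nlra.
Qed.

(** Half of the dissipation [norm (smoothed h x) ^ 2] absorbs the cross term by Young's inequality.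
    The other half controls [T h x], because [T h x = P q (smoothed h x)], and this gives
    [c = / (2 * M ^ 2)] for a bound [M] of [P q]. The estimate is in terms of [T h x]; [x] itself
    reappears as [h] tends to 0. *)
Lemma energy_decay : exists c, 0 < c /\ forall C K, 0 <= C -> 0 <= K ->
  forall h x z m, 0 < h -> 0 <= m ->
    norm (P 1 z) <= h * (C * m) -> norm z <= K * m ->
    1 / h * (energy (plus (T h x) (P q z)) - energy x) <=
    - c * norm (T h x) ^ 2 + 1 / 2 * (C * C + K * C) * m ^ 2.
Proof.
have lq : is_linear (P q) by apply: npow_linear => //; lra.
have [M [hM bM]] := linear_norm _ lq.
have hM2 : 0 < M * M by nra.
exists (/ (2 * (M * M))); split; first by apply: Rinv_0_lt_compat; lra.
move=> C K hC hK h x z m hh hm hz1 hz2.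
have hs := energy_step h x z hh.
have hb := bM (smoothed h x); rewrite npow_smoothed // in hb.
have n0 := norm_ge_0 (smoothed h x); have n1 := norm_ge_0 (T h x).
have n2 := norm_ge_0 z; have n3 := norm_ge_0 (P 1 z).
set g := norm (smoothed h x) in hs hb n0.
have hTg : / (2 * (M * M)) * norm (T h x) ^ 2 <= 1 / 2 * g ^ 2.
  have k : norm (T h x) ^ 2 <= M * M * g ^ 2.
    have -> : M * M * g ^ 2 = (M * g) ^ 2 by ring.
    by apply: pow_incr.
  have k2 : 0 < / (2 * (M * M)) by apply: Rinv_0_lt_compat; lra.
  have := Rmult_le_compat_l _ _ _ (Rlt_le _ _ k2) k.
  have -> : / (2 * (M * M)) * (M * M * g ^ 2) = 1 / 2 * g ^ 2 by field; lra.
  done.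
have hCm : 0 <= C * m by nra.
have k1 : g * norm (P 1 z) <= g * (h * (C * m)) by apply: Rmult_le_compat_l.
have k2 : norm z * norm (P 1 z) <= K * m * (h * (C * m)).
  by apply: Rmult_le_compat.
have k3 : energy (plus (T h x) (P q z)) - energy x <=
    h * (- g ^ 2 + g * (C * m) + 1 / 2 * (K * m * (C * m))) by lra.
have k4 : 1 / h * (energy (plus (T h x) (P q z)) - energy x) <=
    - g ^ 2 + g * (C * m) + 1 / 2 * (K * m * (C * m)).
  have hih : 0 < 1 / h by apply: Rdiv_lt_0_compat; lra.
  have := Rmult_le_compat_l _ _ _ (Rlt_le _ _ hih) k3.
  set r := _ + _ + _.
  have -> : 1 / h * (h * r) = r by field; lra.
  done.
apply: Rle_trans k4 _.
have k5 : g * (C * m) <= 1 / 2 * g ^ 2 + 1 / 2 * (C * m) ^ 2.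
  have := pow2_ge_0 (g - C * m); lra.
nra.
Qed.

End Energy.

(** * Uniform boundedness *)

Lemma uniform_limit {U : CompleteNormedModule R_AbsRing} (u : nat -> R -> U)
    (e : nat -> R) :
  (forall n s, continuous (u n) s) ->
  (forall d, 0 < d -> exists n, e n < d) ->
  (forall k j s, (k <= j)%nat -> norm (minus (u j s) (u k s)) <= e k) ->
  exists v : R -> U, (forall s, continuous v s) /\
    forall k s, norm (minus (v s) (u k s)) <= e k.
Proof.
move=> cu e0 hu.
have lim s : exists l, filterlim (fun n => u n s) eventually (locally l).
  apply/filterlim_locally_cauchy => d.
  have [n hn] := e0 (d / 2) ltac:(have := cond_pos d; lra).
  exists (fun k => (n <= k)%nat); split; first by exists n.
  move=> j k hj hk; apply: norm_compat1.
  apply: Rle_lt_trans (norm_triangle_mid _ _ (u n s) _) _.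
  rewrite (norm_minus_sym _ (u n s)).
  have := hu n j s hj; have := hu n k s hk; nlra.
pose v s := proj1_sig (constructive_indefinite_description _ (lim s)).
have hv s : filterlim (fun n => u n s) eventually (locally (v s)).
  exact: (proj2_sig (constructive_indefinite_description _ (lim s))).
have bv k s : norm (minus (v s) (u k s)) <= e k.
  apply: Rle_plus_epsilon => d hd.
  have [N hN] := proj1 (filterlim_normP _ _ _ _) (hv s) d hd.
  have h1 := hN (Nat.max N k) (Nat.le_max_l _ _).
  have h2 := hu k (Nat.max N k) s (Nat.le_max_r _ _).
  have := norm_triangle_mid _ (v s) (u (Nat.max N k) s) (u k s).
  rewrite (norm_minus_sym _ (v s) (u (Nat.max N k) s)); nlra.
exists v; split=> // s; apply/continuous_normP => d hd.
have [n hn] := e0 (d / 3) ltac:(lra).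
have [r [hr h]] := proj1 (continuous_normP _ _ _) (cu n s) (d / 3) ltac:(lra).
exists r; split=> // t ht.
have h1 := bv n s; have h2 := bv n t; have h3 := h t ht.
have h4 := norm_triangle_mid _ (v t) (u n t) (v s).
have h5 := norm_triangle_mid _ (u n t) (u n s) (v s).
rewrite (norm_minus_sym _ (u n s) (v s)) in h5; nlra.
Qed.

Lemma inv_pow3_small d : 0 < d -> exists n, 1 / 2 * (/ 3) ^ n < d.
Proof.
move=> hd.
have [N hN] := pow_lt_1_zero (/ 3) ltac:(rewrite Rabs_pos_eq; lra) d hd.
exists N; have := hN N (Nat.le_refl _).
have h := pow_lt (/ 3) N ltac:(lra); rewrite Rabs_pos_eq; lra.
Qed.

(** Uniform boundedness on the space of continuous functions, by Sokal's gliding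
    hump: [u (k+1) = u k +- 3^-(k+1) v k], with the sign that makes
    [L (n k) (u (k+1))] large, and the limit of the [u k] is a bad input. *)
Lemma uniform_boundedness {U : CompleteNormedModule R_AbsRing}
    {X : NormedModule R_AbsRing} (L : nat -> (R -> U) -> X) :
  let Cont (u : R -> U) := forall s, continuous u s in
  (forall n u v, Cont u -> Cont v ->
    L n (fun s => plus (u s) (v s)) = plus (L n u) (L n v)) ->
  (forall n (r : R) u, Cont u -> L n (fun s => scal r (u s)) = scal r (L n u)) ->
  (forall n, exists c, forall u m, Cont u -> (forall s, norm (u s) <= m) ->
    norm (L n u) <= c * m) ->
  (forall u, Cont u -> exists K, forall n, norm (L n u) <= K) ->
  exists K, 0 <= K /\ forall n u m, Cont u -> (forall s, norm (u s) <= m) ->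
    norm (L n u) <= K * m.
Proof.
move=> Cont Lplus Lscal Lbd Lpt.
have Cz : Cont (fun _ => zero) by move=> s; exact: continuous_const.
have Cplus u v : Cont u -> Cont v -> Cont (fun s => plus (u s) (v s)).
  by move=> hu hv s; apply: continuous_plus.
have Cscal (r : R) u : Cont u -> Cont (fun s => scal r (u s)).
  by move=> hu s; apply: (continuous_scal_r r u).
have m_ge_0 (u : R -> U) m : (forall s, norm (u s) <= m) -> 0 <= m.
  by move=> h; apply: Rle_trans (h 0); exact: norm_ge_0.
(* [N] is the operator norm of [L n], with a unit input that attains it up to the factor [3 / 4]. *)
have ex n : exists N, 0 <= N /\ (forall u m, Cont u -> (forall s, norm (u s) <= m) ->
    norm (L n u) <= N * m) /\ (exists u, Cont u /\ (forall s, norm (u s) <= 1) /\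
      3 / 4 * N <= norm (L n u)).
  have [c hc] := Lbd n.
  pose E r := exists u, Cont u /\ (forall s, norm (u s) <= 1) /\ r = norm (L n u).
  have E0 : E (norm (L n (fun _ => zero))).
    exists (fun _ => zero); split=> //; split=> // s; rewrite norm_zero; lra.
  have [N [hN1 hN2]] : {N | is_lub E N}.
    apply: completeness; last by exists (norm (L n (fun _ => zero))).
    by exists c => r [u [h1 [h2 ->]]]; have := hc u 1 h1 h2; rewrite Rmult_1_r.
  have hN0 : 0 <= N by apply: Rle_trans (hN1 _ E0); exact: norm_ge_0.
  exists N; split=> //; split.
  - move=> u m hu hm; have [hm0|hm0] := m_ge_0 u m hm; last first.
      have := hc u m hu hm; rewrite -hm0; lra.
    have h1 : Cont (fun s => scal (/ m) (u s)) by apply: Cscal.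
    have him : 0 < / m by apply: Rinv_0_lt_compat.
    have h2 s : norm (scal (/ m) (u s)) <= 1.
      rewrite norm_scal_eq Rabs_pos_eq; last lra.
      apply: (Rmult_le_reg_l m) => //; rewrite -Rmult_assoc Rinv_r; last lra.
      by rewrite Rmult_1_l Rmult_1_r.
    have h3 : norm (L n (fun s => scal (/ m) (u s))) <= N.
      by apply: hN1; exists (fun s => scal (/ m) (u s)).
    rewrite Lscal // norm_scal_eq Rabs_pos_eq in h3; last lra.
    have := Rmult_le_compat_l m _ _ (Rlt_le _ _ hm0) h3.
    rewrite -Rmult_assoc Rinv_r; lra.
  - have [hpos|h0] := hN0; last first.
      exists (fun _ => zero); split=> //; split.
        by move=> s; rewrite norm_zero; lra.
      rewrite -h0; have := norm_ge_0 (L n (fun _ => zero)); lra.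
    apply: NNPP => hn; have : N <= 3 / 4 * N; last lra.
    apply: hN2 => r [u [h1 [h2 ->]]]; apply: Rnot_lt_le => hlt.
    by apply: hn; exists u; split=> //; split=> //; lra.
pose N n := proj1_sig (constructive_indefinite_description _ (ex n)).
have hN n : 0 <= N n /\ (forall u m, Cont u -> (forall s, norm (u s) <= m) ->
    norm (L n u) <= N n * m) /\ (exists u, Cont u /\ (forall s, norm (u s) <= 1) /\
      3 / 4 * N n <= norm (L n u)).
  exact: (proj2_sig (constructive_indefinite_description _ (ex n))).
case: (classic (exists K, forall n, N n <= K)) => [[K hK]|hunb].
  exists (Rmax K 0); split; first exact: Rmax_r.
  move=> n u m hu hm; apply: Rle_trans (proj1 (proj2 (hN n)) u m hu hm) _.
  apply: Rmult_le_compat_r; first exact: m_ge_0 hm.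
  by apply: Rle_trans (hK n) _; exact: Rmax_l.
exfalso.
have big K : exists n, K < N n.
  apply: NNPP => h; apply: hunb; exists K => n; apply: Rnot_lt_le => hlt.
  by apply: h; exists n.
(* The threshold gives [N * 3^-(k+1) > 4 * k]. In the end the hump contributes at least [3 / 4] of
   this product and the later steps remove at most [1 / 2] of it, so that more than [k] remains. *)
pose n_ (k : nat) := proj1_sig (constructive_indefinite_description _
  (big (4 * 3 ^ S k * INR k))).
have hn_ k : 4 * 3 ^ S k * INR k < N (n_ k).
  exact: (proj2_sig (constructive_indefinite_description _ (big _))).
pose v k := proj1_sig (constructive_indefinite_description _
  (proj2 (proj2 (hN (n_ k))))).
have hv k : Cont (v k) /\ (forall s, norm (v k s) <= 1) /\
    3 / 4 * N (n_ k) <= norm (L (n_ k) (v k)).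
  exact: (proj2_sig (constructive_indefinite_description _
    (proj2 (proj2 (hN (n_ k)))))).
pose add (r : R) (w u : R -> U) s := plus (u s) (scal r (w s)).
pose step k u :=
  match Rle_dec (norm (L (n_ k) (v k)) * (/ 3) ^ S k)
      (norm (L (n_ k) (add ((/ 3) ^ S k) (v k) u))) with
  | left _ => add ((/ 3) ^ S k) (v k) u
  | right _ => add (- (/ 3) ^ S k) (v k) u
  end.
pose u := fix u (j : nat) : R -> U := match j with O => fun _ => zero | S j => step j (u j) end.
have p3 k : 0 < (/ 3) ^ k by apply: pow_lt; lra.
have Cadd r w z : Cont w -> Cont z -> Cont (add r w z).
  by move=> hw hz; apply: Cplus => //; exact: Cscal.
have Cu k : Cont (u k).
  elim: k => [|k IH] //=; rewrite /step; have := proj1 (hv k).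
  by case: Rle_dec => _ hvk; apply: Cadd.
have Ladd n r w z : Cont w -> Cont z ->
    L n (add r w z) = plus (L n z) (scal r (L n w)).
  by move=> hw hz; rewrite /add Lplus ?Lscal //; exact: Cscal.
have step_norm k s : norm (minus (u (S k) s) (u k s)) <= (/ 3) ^ S k.
  have [_ [h1 _]] := hv k.
  have aux r : Rabs r = (/ 3) ^ S k ->
      norm (minus (add r (v k) (u k) s) (u k s)) <= (/ 3) ^ S k.
    move=> hr; rewrite /add.
    have -> : minus (plus (u k s) (scal r (v k s))) (u k s) = scal r (v k s) by vec.
    rewrite norm_scal_eq hr -[X in _ <= X]Rmult_1_r.
    by apply: Rmult_le_compat_l; [apply: Rlt_le|].
  change (u (S k)) with (step k (u k)); rewrite /step.
  case: Rle_dec => _; apply: aux; rewrite ?Rabs_Ropp Rabs_pos_eq //;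
    exact: Rlt_le.
have step_big k : norm (L (n_ k) (v k)) * (/ 3) ^ S k <= norm (L (n_ k) (u (S k))).
  change (u (S k)) with (step k (u k)); rewrite /step.
  case: Rle_dec => // /Rnot_le_lt.
  have hvk := proj1 (hv k); rewrite !Ladd //.
  set a := L (n_ k) (u k); set b := L (n_ k) (v k); set r := (/ 3) ^ S k => hlt.
  (* The images of the two candidates differ by [2 * r * b], so one of them has norm at least
     [r * norm b]. *)
  have h1 := norm_minus_le _ (plus a (scal r b)) (plus a (scal (- r) b)).
  have e1 : minus (plus a (scal r b)) (plus a (scal (- r) b)) = scal (2 * r) b by vec.
  have hr : 0 < r by exact: p3.
  rewrite e1 norm_scal_eq Rabs_pos_eq in h1; last lra.
  lra.
(* The total size of all steps after the first [k]: the sum of [3^-j] over [j > k]. *)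
pose e k := 1 / 2 * (/ 3) ^ k.
have cau k j s : (k <= j)%nat -> norm (minus (u j s) (u k s)) <= e k.
  move=> hkj.
  have : norm (minus (u j s) (u k s)) <= 1 / 2 * ((/ 3) ^ k - (/ 3) ^ j).
    elim: hkj => [|j' _ IH].
      have -> : minus (u k s) (u k s) = zero by vec.
      rewrite norm_zero; lra.
    have := norm_triangle_mid _ (u (S j') s) (u j' s) (u k s).
    have := step_norm j' s.
    change ((/ 3) ^ S j') with (/ 3 * (/ 3) ^ j'); nlra.
  have := p3 j; rewrite /e; lra.
have [w [hw1 hw2]] := uniform_limit u e Cu inv_pow3_small cau.
have [K hK] := Lpt w hw1.
have [k hk] := INR_unbounded K.
have h1 := hK (n_ k); have h2 := step_big k.
have [_ [_ h3]] := hv k.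
have [N0 [h4 _]] := hN (n_ k).
have h5 : norm (L (n_ k) (add (- 1) w (u (S k)))) <= N (n_ k) * e (S k).
  apply: h4; first exact: Cadd.
  move=> s; rewrite /add.
  have -> : plus (u (S k) s) (scal (- 1) (w s)) = minus (u (S k) s) (w s) by vec.
  rewrite norm_minus_sym; exact: hw2.
rewrite Ladd // in h5.
have h6 := norm_le_minus _ (L (n_ k) (u (S k))) (L (n_ k) w).
have e2 : minus (L (n_ k) (u (S k))) (L (n_ k) w) =
   plus (L (n_ k) (u (S k))) (scal (- 1) (L (n_ k) w)) by vec.
rewrite e2 in h6.
have h7 := hn_ k; have hr := p3 (S k).
have h8 : 3 ^ S k * (/ 3) ^ S k = 1.
  by rewrite -Rpow_mult_distr Rinv_r ?pow1; lra.
rewrite /e in h5.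
set r := (/ 3) ^ S k in h2 h5 h8 hr.
have h9 : 4 * INR k < N (n_ k) * r.
  have := Rmult_lt_compat_r r _ _ hr h7.
  have -> : 4 * 3 ^ S k * INR k * r = 4 * INR k * (3 ^ S k * r) by ring.
  rewrite h8; lra.
have h10 : 3 / 4 * N (n_ k) * r <= norm (L (n_ k) (v k)) * r.
  by apply: Rmult_le_compat_r; lra.
nlra.
Qed.

(** * Responses of admissible operators *)

Lemma RInt_linear {V W : CompleteNormedModule R_AbsRing} (L : V -> W)
    (f : R -> V) (a b : R) : is_linear L -> ex_RInt f a b ->
  RInt (fun t => L (f t)) a b = L (RInt f a b).
Proof.
by move=> hL hf; apply: is_RInt_unique; apply: is_RInt_linear => //; exact: RInt_correct.
Qed.

Lemma ex_RInt_cont {V : CompleteNormedModule R_AbsRing} (f : R -> V) (a b : R) :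
  (forall t, continuous f t) -> ex_RInt f a b.
Proof. by move=> hf; apply: ex_RInt_continuous. Qed.

Lemma continuous_Rmax (c : R) (f : R -> R) t :
  continuous f t -> continuous (fun t => Rmax c (f t)) t.
Proof.
move=> /continuous_normP hf; apply/continuous_normP => e he.
have [d [hd h]] := hf e he; exists d; split=> // s hs.
apply: Rle_lt_trans (h s hs); change (Rabs (Rmax c (f s) - Rmax c (f t)) <= Rabs (f s - f t)).
rewrite /Rmax; do 2 case: Rle_dec => ?; split_Rabs; lra.
Qed.

Lemma continuous_Rmin (c : R) (f : R -> R) t :
  continuous f t -> continuous (fun t => Rmin c (f t)) t.
Proof.
move=> /continuous_normP hf; apply/continuous_normP => e he.
have [d [hd h]] := hf e he; exists d; split=> // s hs.
apply: Rle_lt_trans (h s hs); change (Rabs (Rmin c (f s) - Rmin c (f t)) <= Rabs (f s - f t)).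
rewrite /Rmin; do 2 case: Rle_dec => ?; split_Rabs; lra.
Qed.

Section Convolution.

Variables (X : CompleteNormedModule R_AbsRing) (ip : X -> X -> R)
  (T : R -> X -> X).
Hypothesis hip : real_inner X ip.
Hypothesis hT : stable_semigroup X T.
Hypothesis npow_1_sym : forall x y, ip (npow T 1 x) y = ip x (npow T 1 y).

Let lin := ss_lin X T hT.
Let cont := ss_cont X T hT.
Local Notation P := (npow T).

Lemma sg_joint_cont (r : R -> R) (w : R -> X) s :
  continuous r s -> continuous w s -> continuous (fun s => T (r s) (w s)) s.
Proof.
move=> hr hw; apply/continuous_normP => e he.
have h1 := continuous_comp r (fun t => T t (w s)) s hr (cont (w s) (r s)).
have [d1 [hd1 k1]] := proj1 (continuous_normP _ _ _) h1 (e / 2) ltac:(lra).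
have [d2 [hd2 k2]] := proj1 (continuous_normP _ _ _) hw (e / 2) ltac:(lra).
exists (Rmin d1 d2); split; first exact: Rmin_glb_lt.
move=> t ht.
have {}k1 := k1 t (Rlt_le_trans _ _ _ ht (Rmin_l _ _)).
have {}k2 := k2 t (Rlt_le_trans _ _ _ ht (Rmin_r _ _)).
have := norm_triangle_mid _ (T (r t) (w t)) (T (r t) (w s)) (T (r s) (w s)).
rewrite -(linear_minus (T (r t))) //.
have := sg_contraction X ip T hip hT npow_1_sym (r t) (minus (w t) (w s)).
nlra.
Qed.

Lemma convolution_cont (w : R -> X) t s :
  (forall s, continuous w s) -> continuous (fun s => T (t - s) (w s)) s.
Proof.
move=> hw; apply: (sg_joint_cont (fun s : R => t - s)) => //.
by apply: ex_derive_continuous; auto_derive.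
Qed.

Lemma convolution_norm_le (w : R -> X) t m : 0 <= t ->
  (forall s, continuous w s) -> (forall s, 0 <= s <= t -> norm (w s) <= m) ->
  norm (RInt (fun s => T (t - s) (w s)) 0 t) <= t * m.
Proof.
move=> ht hw hm; have -> : t * m = (t - 0) * m by ring.
apply: (norm_RInt_le_const (fun s => T (t - s) (w s)) 0 t) => //.
- move=> s hs; apply: Rle_trans (hm s hs).
  exact: (sg_contraction X ip T hip hT npow_1_sym).
- by apply: RInt_correct; apply: ex_RInt_cont => s; exact: convolution_cont.
Qed.

Lemma convolution_const y t : RInt (fun s => T (t - s) y) 0 t =
  RInt (fun r => T r y) 0 t.
Proof.
have h := RInt_correct _ _ _ (ex_RInt_sg X T hT y t 0).
have e1 : t = -1 * 0 + t by ring.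
have e2 : 0 = -1 * t + t by ring.
rewrite {1}e1 {2}e2 in h.
have h2 := is_RInt_opp _ _ _ _ (is_RInt_comp_lin _ _ _ _ _ _ h).
have ex := ex_RInt_sg X T hT y t 0.
rewrite -(opp_RInt_swap _ _ _ ex).
apply: is_RInt_unique; apply: is_RInt_ext h2 => s _.
have -> : -1 * s + t = t - s by ring.
by vec.
Qed.

Lemma convolution_shift (w : R -> X) h : (forall s, continuous w s) ->
  RInt (fun s => T (1 - s) (w (s - (1 - h)))) (1 - h) 1 =
  RInt (fun s => T (h - s) (w s)) 0 h.
Proof.
move=> hw.
have ex : ex_RInt (fun s => T (h - s) (w s)) 0 h.
  by apply: ex_RInt_cont => s; exact: convolution_cont.
have c := RInt_correct _ _ _ ex.
have e1 : 0 = 1 * (1 - h) + - (1 - h) by ring.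
have e2 : h = 1 * 1 + - (1 - h) by ring.
set I := RInt _ 0 h in c *; rewrite {2}e2 {1}e1 in c.
apply: is_RInt_unique; apply: is_RInt_ext (is_RInt_comp_lin _ _ _ _ _ _ c) => s _.
rewrite Rmult_1_l.
have -> : h - (s + - (1 - h)) = 1 - s by ring.
exact: scal_one.
Qed.

Variables (U : CompleteNormedModule R_AbsRing) (C : U -> X).
Hypothesis C_lin : is_linear C.

Lemma cont_C (u : R -> U) : (forall s, continuous u s) ->
  forall s, continuous (fun s => C (u s)) s.
Proof.
move=> hu s; apply: continuous_comp; [exact: hu|exact: linear_cont].
Qed.

(** Admissibility at time 1, seen through [(-A)^(-1)]: [C] is to be read as [(-A)^(-1)] of the input
    operator, and the response lies in [X] when its image lies in the range of [P 1]. *)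
Hypothesis adm : forall u : R -> U, (forall s, continuous u s) ->
  exists x, P 1 x = RInt (fun s => T (1 - s) (C (u s))) 0 1.

(** [G n = - A (T (1 / (n + 1)))] is bounded and sends the transported response [P 1 x] to
    [T (1 / (n + 1)) x]. For a fixed input these vectors are bounded by [norm x], as [T] is
    contractive, so the maps from inputs are uniformly bounded; strong continuity at 0 then recovers
    [norm x]. *)
Lemma admissible_unit_bound : exists K, 0 <= K /\ forall (u : R -> U) x m,
  (forall s, continuous u s) -> (forall s, norm (u s) <= m) ->
  P 1 x = RInt (fun s => T (1 - s) (C (u s))) 0 1 -> norm x <= K * m.
Proof.
have hn (n : nat) : 0 < / (INR n + 1).
  by apply: Rinv_0_lt_compat; have := pos_INR n; lra.
pose G n := proj1_sig (constructive_indefinite_description _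
  (sg_factor X ip T hip hT npow_1_sym _ (hn n))).
have hG n : is_linear (G n) /\ forall x, P 1 (G n x) = T (/ (INR n + 1)) x.
  exact: (proj2_sig (constructive_indefinite_description _
    (sg_factor X ip T hip hT npow_1_sym _ (hn n)))).
have GP n x : G n (P 1 x) = T (/ (INR n + 1)) x.
  apply: (npow_1_inj X T hT); rewrite (proj2 (hG n)) (npow_sg X T hT) //; lra.
pose I (u : R -> U) := RInt (fun s => T (1 - s) (C (u s))) 0 1.
have [MC [hMC bMC]] := linear_norm _ C_lin.
have exI u : (forall s, continuous u s) ->
    ex_RInt (fun s => T (1 - s) (C (u s))) 0 1.
  by move=> hu; apply: ex_RInt_cont => s; apply: convolution_cont; exact: cont_C.
have [K [hK0 hK]] := uniform_boundedness (fun n u => G n (I u))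
  ltac:(
    move=> n u v hu hv; rewrite -(linear_plus _ (proj1 (hG n))); f_equal;
    rewrite /I -RInt_plus; [|exact: exI|exact: exI];
    apply: RInt_ext => s _; by rewrite (linear_plus _ C_lin) (linear_plus _ (lin _)))
  ltac:(
    move=> n r u hu; rewrite -(linear_scal _ (proj1 (hG n))); f_equal;
    rewrite /I -RInt_scal; [|exact: exI];
    apply: RInt_ext => s _; by rewrite (linear_scal _ C_lin) (linear_scal _ (lin _)))
  ltac:(
    move=> n; have [MG [hMG bMG]] := linear_norm _ (proj1 (hG n));
    exists (MG * MC) => u m hu hm; apply: Rle_trans (bMG _) _;
    rewrite Rmult_assoc; apply: Rmult_le_compat_l; [lra|];
    rewrite -[X in _ <= X]Rmult_1_l;
    apply: convolution_norm_le; [lra|exact: cont_C|];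
    move=> s _; apply: Rle_trans (bMC _) _; apply: Rmult_le_compat_l; [lra|done])
  ltac:(
    move=> u hu; have [x hx] := adm u hu; exists (norm x) => n;
    rewrite /I -hx GP; exact: (sg_contraction X ip T hip hT npow_1_sym)).
exists K; split=> // u x m hu hm hx; apply: Rle_plus_epsilon => e he.
have [d [hd h]] := proj1 (continuous_normP _ _ _) (cont x 0) e he.
have [N [hN1 hN2]] := archimed_cor1 d hd.
have hN3 := lt_0_INR _ hN2.
have hN4 : / (INR N + 1) < d.
  by apply: Rle_lt_trans hN1; apply: Rinv_le_contravar; lra.
have h1 := h (/ (INR N + 1))
  ltac:(rewrite Rminus_0_r Rabs_pos_eq; [lra|exact: Rlt_le]).
rewrite (ss_neg _ _ hT 0) in h1; last lra.
have h2 := hK N u m hu hm.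
rewrite /I -hx GP in h2.
have := norm_le_minus _ x (T (/ (INR N + 1)) x).
rewrite (norm_minus_sym _ x); lra.
Qed.

(** An input on [(0, h)] is delayed by [1 - h] and preceded by the constant
    [u 0]; the constant part contributes [T h (C (u 0)) - T 1 (C (u 0))]. *)
Lemma admissible_bound : exists C1 K, 0 <= C1 /\ 0 <= K /\
  forall h (u : R -> U) z m, 0 < h <= 1 ->
    (forall s, continuous u s) -> (forall s, 0 <= s <= h -> norm (u s) <= m) ->
    P 1 z = RInt (fun s => T (h - s) (C (u s))) 0 h ->
    norm (P 1 z) <= h * (C1 * m) /\ norm z <= K * m.
Proof.
have [MC [hMC bMC]] := linear_norm _ C_lin.
have [K [hK0 hK]] := admissible_unit_bound.
(* The response at time 1 is [z + T h y - T 1 y] with [norm y <= MC * m], so removing the last two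
   terms costs [2 * MC]. *)
exists MC, (K + 2 * MC); split; first lra; split; first lra.
move=> h u z m hh hu hm hz; split.
  rewrite hz; apply: convolution_norm_le; [lra|exact: cont_C|].
  move=> s hs; apply: Rle_trans (bMC _) _; apply: Rmult_le_compat_l; [lra|exact: hm].
(* Clamping keeps the argument of [u] in [[0, h]], the interval on which [m] bounds it. *)
pose r s := Rmax 0 (Rmin h (s - (1 - h))).
pose w s := u (r s).
have cr s : continuous r s.
  apply: continuous_Rmax; apply: continuous_Rmin.
  by apply: ex_derive_continuous; auto_derive.
have hr s : 0 <= r s <= h.
  rewrite /r; split; first exact: Rmax_l.
  apply: Rmax_lub; [lra|exact: Rmin_l].
have cw s : continuous w s by apply: continuous_comp; [exact: cr|exact: hu].
pose y := C (u 0).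
have ex a b : ex_RInt (fun s => T (1 - s) (C (w s))) a b.
  by apply: ex_RInt_cont => s; apply: convolution_cont; exact: cont_C.
have e1 : RInt (fun s => T (1 - s) (C (w s))) 0 (1 - h) =
    RInt (fun s => T (1 - s) y) 0 (1 - h).
  apply: RInt_ext => s; rewrite Rmin_left ?Rmax_right; try lra.
  move=> hs; rewrite /w /r Rmin_right; last lra.
  by rewrite Rmax_left //; lra.
have e2 : RInt (fun s => T (1 - s) (C (w s))) (1 - h) 1 = P 1 z.
  rewrite hz -(convolution_shift (fun s => C (u s))); last exact: cont_C.
  apply: RInt_ext => s; rewrite Rmin_left ?Rmax_right; try lra.
  move=> hs; rewrite /w /r Rmin_right; last lra.
  by rewrite Rmax_right //; lra.
have e3 : RInt (fun s => T (1 - s) y) 0 (1 - h) =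
    minus (P 1 (minus y (T 1 y))) (P 1 (minus y (T h y))).
  have exy a b : ex_RInt (fun s => T (1 - s) y) a b.
    apply: ex_RInt_cont => s; apply: convolution_cont => ?; exact: continuous_const.
  have e4 := RInt_Chasles _ _ _ _ (exy 0 (1 - h)) (exy (1 - h) 1).
  rewrite (convolution_shift (fun _ => y)) in e4; last by move=> ?; exact: continuous_const.
  rewrite !convolution_const -!(npow_1_sg X T hT) in e4; try lra.
  rewrite -e4; vec.
have l1 : is_linear (P 1) by apply: npow_linear => //; lra.
have e4 : P 1 (plus z (minus (T h y) (T 1 y))) = RInt (fun s => T (1 - s) (C (w s))) 0 1.
  rewrite -(RInt_Chasles _ _ _ _ (ex 0 (1 - h)) (ex (1 - h) 1)) e1 e2 e3.
  rewrite (linear_plus _ l1) !(linear_minus _ _ _ l1); vec.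
have h1 := hK w _ m cw (fun s => hm _ (hr s)) e4.
have ny : norm y <= MC * m.
  by apply: Rle_trans (bMC _) _; apply: Rmult_le_compat_l; [lra|apply: hm; lra].
have n1 := sg_contraction X ip T hip hT npow_1_sym h y.
have n2 := sg_contraction X ip T hip hT npow_1_sym 1 y.
have n3 := norm_minus_le _ (T h y) (T 1 y).
have e5 : z = minus (plus z (minus (T h y) (T 1 y))) (minus (T h y) (T 1 y)) by vec.
rewrite e5; apply: Rle_trans (norm_minus_le _ _ _) _; nlra.
Qed.

End Convolution.

(** * Finite-dimensional inputs *)

Section ScalarInput.

Variables (X : CompleteNormedModule R_AbsRing) (ip : X -> X -> R)
  (T : R -> X -> X).
Hypothesis hip : real_inner X ip.
Hypothesis hT : stable_semigroup X T.
Hypothesis npow_1_sym : forall x y, ip (npow T 1 x) y = ip x (npow T 1 y).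

Let lin := ss_lin X T hT.
Let cont := ss_cont X T hT.
Local Notation P := (npow T).

Definition scalar_conv (b : X) (t : R) (c : R -> R) : X :=
  RInt (fun s => scal (c s) (T (t - s) b)) 0 t.

Lemma scalar_conv_cont b t (c : R -> R) s : continuous c s ->
  continuous (fun s => scal (c s) (T (t - s) b)) s.
Proof.
move=> hc; apply: continuous_scal => //.
apply: (convolution_cont X ip T hip hT npow_1_sym (fun _ => b)) => r.
exact: continuous_const.
Qed.

Lemma scalar_conv_ex b t (c : R -> R) : (forall s, continuous c s) ->
  ex_RInt (fun s => scal (c s) (T (t - s) b)) 0 t.
Proof. by move=> hc; apply: ex_RInt_cont => s; exact: scalar_conv_cont. Qed.

Lemma scalar_conv_minus b t (c d : R -> R) :
  (forall s, continuous c s) -> (forall s, continuous d s) ->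
  scalar_conv b t (fun s => c s - d s) = minus (scalar_conv b t c) (scalar_conv b t d).
Proof.
move=> hc hd; rewrite /scalar_conv -RInt_minus; try exact: scalar_conv_ex.
apply: RInt_ext => s _; vec.
Qed.

Lemma scalar_conv_norm_le b t (c : R -> R) m : 0 <= t ->
  (forall s, continuous c s) -> (forall s, 0 <= s <= t -> Rabs (c s) <= m) ->
  norm (scalar_conv b t c) <= t * (m * norm b).
Proof.
move=> ht hc hm; rewrite /scalar_conv.
have -> : t * (m * norm b) = (t - 0) * (m * norm b) by ring.
apply: (norm_RInt_le_const (fun s => scal (c s) (T (t - s) b)) 0 t) => //.
- move=> s hs; rewrite norm_scal_eq; apply: Rmult_le_compat; try exact: norm_ge_0.
  + exact: Rabs_pos.
  + exact: hm.
  + exact: (sg_contraction X ip T hip hT npow_1_sym).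
- by apply: RInt_correct; exact: scalar_conv_ex.
Qed.

(** Integration by parts. *)
Lemma scalar_conv_C1 b t (c dc : R -> R) : 0 <= t ->
  (forall s, is_derive c s (dc s)) -> (forall s, continuous dc s) ->
  exists x, P 1 x = scalar_conv b t c.
Proof.
move=> ht hc hdc.
have cc s : continuous c s by apply: ex_derive_continuous; exists (dc s).
have l1 : is_linear (P 1) by apply: npow_linear => //; lra.
(* For [s <= t] this is [P 1 (T (t - s) b)]. The integral form has derivative [T (t - s) b]
   everywhere, including the endpoint [s = t]. *)
pose F s := minus (P 1 b) (RInt (fun r => T r b) 0 (t - s)).
have dF s : is_derive F s (T (t - s) b).
  have d1 : is_derive (fun r => minus (P 1 b) (RInt (fun r => T r b) 0 r)) (t - s)
      (minus zero (T (t - s) b)).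
    apply: is_derive_minus; first exact: is_derive_const.
    apply: (is_derive_RInt (fun t => T t b) _ 0 (t - s)); last exact: cont.
    by apply: filter_forall => r; apply: RInt_correct; exact: ex_RInt_sg.
  have d2 : is_derive (fun s : R => t - s) s (- 1) by auto_derive; [|ring].
  apply: (is_derive_eq _ _ _ _ (is_derive_comp _ _ s _ _ d1 d2)); vec.
have FP s : s <= t -> F s = P 1 (T (t - s) b).
  by move=> hs; rewrite npow_sg ?(sg_npow_1 X T hT) //; lra.
have dcF s : is_derive (fun s => scal (c s) (F s)) s
    (plus (scal (dc s) (F s)) (scal (c s) (T (t - s) b))).
  apply: (is_derive_bilinear (U := R_NormedModule) (fun (r : R) (v : X) => scal r v) 1).
  - by move=> u u' v; exact: scal_distr_r.
  - by move=> u v v'; exact: scal_distr_l.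
  - by move=> r u v; symmetry; exact: scal_assoc.
  - by move=> r u v; vec.
  - lra.
  - by move=> u v; rewrite Rmult_1_l; exact: norm_scal.
  - exact: hc.
  - exact: dF.
have cF s : continuous F s by apply: ex_derive_continuous; exists (T (t - s) b).
have c1 s : continuous (fun s => scal (dc s) (F s)) s by exact: continuous_scal.
have c2 s := scalar_conv_cont b t c s (cc s).
have hI : is_RInt (fun s => plus (scal (dc s) (F s)) (scal (c s) (T (t - s) b))) 0 t
    (minus (scal (c t) (F t)) (scal (c 0) (F 0))).
  apply: (is_RInt_derive (fun s => scal (c s) (F s))) => s _ //.
  by apply: continuous_plus.
have hJ := is_RInt_unique _ _ _ _ hI.
rewrite RInt_plus in hJ; try exact: ex_RInt_cont.
have e1 : RInt (fun s => scal (dc s) (F s)) 0 t = P 1 (scalar_conv b t dc).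
  rewrite /scalar_conv -(RInt_linear _ _ _ _ l1); last exact: scalar_conv_ex.
  apply: RInt_ext => s; rewrite Rmin_left ?Rmax_right; try lra.
  by move=> hs; rewrite FP ?(linear_scal _ l1) //; lra.
exists (minus (minus (scal (c t) b) (scal (c 0) (T t b))) (scalar_conv b t dc)).
rewrite !(linear_minus _ _ _ l1) !(linear_scal _ l1) -e1.
rewrite (FP t) in hJ; last lra.
rewrite (FP 0) in hJ; last lra.
rewrite Rminus_diag Rminus_0_r (ss_neg _ _ hT 0 b) in hJ; last lra.
rewrite -hJ /scalar_conv; vec.
Qed.

Lemma RInt_ip_l (f : R -> X) (a b : R) (y : X) : ex_RInt f a b ->
  ip (RInt f a b) y = RInt (fun s => ip (f s) y) a b.
Proof.
move=> hf; symmetry.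
exact: (RInt_linear (W := R_CompleteNormedModule) (fun x => ip x y) f a b
  (ip_linear_l X ip hip y) hf).
Qed.

(** The combinations of the [d s] with the nonnegative weights [m - c] and
    [m + c] have a nonnegative product. *)
Lemma RInt_weighted_norm_le (d : R -> X) (c : R -> R) (m t : R) : 0 <= t ->
  (forall s, continuous d s) -> (forall s, continuous c s) ->
  (forall s r, 0 <= s <= t -> 0 <= r <= t -> 0 <= ip (d s) (d r)) ->
  (forall s, 0 <= s <= t -> Rabs (c s) <= m) ->
  norm (RInt (fun s => scal (c s) (d s)) 0 t) <= m * norm (RInt d 0 t).
Proof.
move=> ht cd cc hpos hm.
have cs (w : R -> R) : (forall s, continuous w s) ->
    forall s, continuous (fun s => scal (w s) (d s)) s.
  by move=> hw s; apply: continuous_scal.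
pose I w := RInt (fun s => scal (w s) (d s)) 0 t.
have nonneg (v w : R -> R) : (forall s, continuous v s) -> (forall s, continuous w s) ->
    (forall s, 0 <= s <= t -> 0 <= v s) -> (forall s, 0 <= s <= t -> 0 <= w s) ->
    0 <= ip (I v) (I w).
  move=> cv cw v0 w0.
  have exv := ex_RInt_cont _ 0 t (cs v cv).
  have exw := ex_RInt_cont _ 0 t (cs w cw).
  rewrite {1}/I RInt_ip_l //; apply: RInt_ge_0 => //.
    by apply: ex_RInt_cont => s; apply: continuous_ip => //; [exact: cs|exact: continuous_const].
  move=> s hs; rewrite (ip_scal_l _ _ hip); apply: Rmult_le_pos; first by apply: v0; lra.
  rewrite (ip_sym _ _ hip) /I RInt_ip_l //; apply: RInt_ge_0 => //.
    by apply: ex_RInt_cont => r; apply: continuous_ip => //; [exact: cs|exact: continuous_const].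
  move=> r hr; rewrite (ip_scal_l _ _ hip); apply: Rmult_le_pos; first by apply: w0; lra.
  by apply: hpos; lra.
have m0 : 0 <= m by apply: Rle_trans (hm 0 _); [exact: Rabs_pos|lra].
have cm (w : R -> R) : (forall s, continuous w s) ->
    forall s, continuous (fun s => m + w s) s.
  by move=> hw s; apply: (continuous_plus (V := R_NormedModule)) => //; exact: continuous_const.
have cN s : continuous (fun s => - c s) s by apply: (continuous_opp (V := R_NormedModule)).
(* With [I1] the integral of [d], this product expands to [m ^ 2 * norm I1 ^ 2 - norm (I c) ^ 2],
   the mixed terms cancelling by symmetry. *)
have hN := nonneg (fun s => m + - c s) (fun s => m + c s) (cm _ cN) (cm _ cc)
  ltac:(move=> s /hm; move/Rabs_le_between; lra)
  ltac:(move=> s /hm; move/Rabs_le_between; lra).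
have eI (w : R -> R) : (forall s, continuous w s) ->
    I (fun s => m + w s) = plus (scal m (RInt d 0 t)) (I w).
  move=> hw; rewrite /I -RInt_scal; last exact: ex_RInt_cont.
  rewrite -RInt_plus; [|apply: ex_RInt_cont => s; exact: continuous_scal_r|exact: ex_RInt_cont _ _ _ (cs w hw)].
  apply: RInt_ext => s _; vec.
have eN : I (fun s => - c s) = opp (I c).
  rewrite /I -RInt_opp; last exact: ex_RInt_cont _ _ _ (cs c cc).
  apply: RInt_ext => s _; vec.
rewrite !eI // eN in hN.
rewrite (ip_plus_l _ _ hip) !(ip_plus_r _ _ hip) !(ip_opp_l _ _ hip)
  !(ip_scal_l _ _ hip) !(ip_scal_r _ _ hip) !(ip_norm _ _ hip)
  (ip_sym _ _ hip (I c)) in hN.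
have n1 := norm_ge_0 (I c); have n2 := norm_ge_0 (RInt d 0 t).
rewrite -/(I c); apply: Rnot_lt_le => hlt.
have : 0 <= m * norm (RInt d 0 t) by apply: Rmult_le_pos.
nra.
Qed.

(** [A (T s b)] may be singular at [s = 0], so the response is first smoothed by [T (r / 2)]: it
    becomes the integral of [c s] against the continuous vectors [T (t - s) (G b)], whose mutual
    inner products are squares of norms. A constant input yields [T (r / 2) (b - T t b)], whence the
    factor [2 * norm b], independent of [r] and [t]. *)
Lemma scalar_conv_bound b t (c : R -> R) m x : 0 <= t ->
  (forall s, continuous c s) -> (forall s, 0 <= s <= t -> Rabs (c s) <= m) ->
  P 1 x = scalar_conv b t c -> norm x <= m * (2 * norm b).
Proof.
move=> ht hc hm hx; apply: Rle_plus_epsilon => e he.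
have m0 : 0 <= m by apply: Rle_trans (hm 0 _); [exact: Rabs_pos|lra].
have [r [hr h]] := proj1 (continuous_normP _ _ _) (cont x 0) e he.
have {}h := h (r / 2) ltac:(rewrite Rminus_0_r Rabs_pos_eq; lra).
rewrite (ss_neg _ _ hT 0) in h; last lra.
have hr2 : 0 < r / 2 by lra.
have [G [lG hG]] := sg_factor X ip T hip hT npow_1_sym _ hr2.
have GP y : G (P 1 y) = T (r / 2) y.
  by apply: (npow_1_inj X T hT); rewrite hG (npow_sg X T hT) //; lra.
have GT s y : G (T s y) = T s (G y).
  apply: (npow_1_inj X T hT); rewrite hG (npow_sg X T hT) ?hG; [exact: (sg_comm X T hT)|lra].
pose d s := T (t - s) (G b).
have cd s : continuous d s.
  apply: (convolution_cont X ip T hip hT npow_1_sym (fun _ => G b)) => z.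
  exact: continuous_const.
have e1 : T (r / 2) x = RInt (fun s => scal (c s) (d s)) 0 t.
  rewrite -GP hx /scalar_conv -(RInt_linear _ _ _ _ lG); last exact: scalar_conv_ex.
  by apply: RInt_ext => s _; rewrite (linear_scal _ lG) GT.
have e2 : RInt d 0 t = T (r / 2) (minus b (T t b)).
  rewrite /d convolution_const // -(npow_1_sg X T hT) //.
  by rewrite -GT -(linear_minus _ _ _ lG) hG.
have h1 := RInt_weighted_norm_le d c m t ht cd hc _ hm.
have h2 : norm (T (r / 2) x) <= m * norm (RInt d 0 t).
  rewrite e1; apply: h1 => s s' hs hs'.
  rewrite /d (sg_inner X ip T hip hT npow_1_sym); try lra; exact: pow2_ge_0.
have h3 : norm (RInt d 0 t) <= 2 * norm b.
  rewrite e2; apply: Rle_trans (sg_contraction X ip T hip hT npow_1_sym _ _) _.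
  have := norm_minus_le _ b (T t b).
  have := sg_contraction X ip T hip hT npow_1_sym t b; nlra.
have h4 := Rmult_le_compat_l _ _ _ m0 h3.
have := norm_le_minus _ x (T (r / 2) x).
rewrite (norm_minus_sym _ x); nlra.
Qed.

Lemma mollify (c : R -> R) t n : 0 <= t -> (forall s, continuous c s) ->
  exists c1 dc, (forall s, is_derive c1 s (dc s)) /\ (forall s, continuous dc s) /\
    forall s, 0 <= s <= t -> Rabs (c1 s - c s) <= / (INR n + 1).
Proof.
move=> ht hc.
have he : 0 < / (INR n + 1) by apply: Rinv_0_lt_compat; have := pos_INR n; lra.
have [d hd] := unifcont_normed_1d (V := R_NormedModule) c 0 (t + 1)
  (fun s _ => hc s) (mkposreal _ he).
have hd0 := cond_pos d.
(* The approximation is the average over [[s, s + r]]; [r <= 1] keeps it inside [[0, t + 1]], where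
   the modulus [d] is valid. *)
pose r := Rmin 1 (d / 2).
have hr : 0 < r by apply: Rmin_glb_lt; lra.
have hr1 : r <= 1 by exact: Rmin_l.
have hr2 : r <= d / 2 by exact: Rmin_r.
have ex a b : ex_RInt c a b by exact: ex_RInt_cont.
have cs s : continuous (fun s => c (s + r)) s.
  apply: (continuous_comp (fun s : R => s + r) c); last exact: hc.
  by apply: ex_derive_continuous; auto_derive.
exists (fun s => / r * RInt c s (s + r)), (fun s => / r * (c (s + r) - c s)).
split; last split.
- move=> s.
  have d1 : is_derive (fun s => RInt c 0 s) s (c s).
    apply: (is_derive_RInt c _ 0 s); last exact: hc.
    by apply: filter_forall => z; apply: RInt_correct.
  have d2 : is_derive (fun s => RInt c 0 (s + r)) s (1 * c (s + r)).
    apply: (is_derive_comp (fun s => RInt c 0 s) (fun s : R => s + r)).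
      apply: (is_derive_RInt c _ 0 (s + r)); last exact: hc.
      by apply: filter_forall => z; apply: RInt_correct.
    by auto_derive; [|ring].
  apply: is_derive_scal; have := is_derive_minus _ _ s _ _ d2 d1.
  rewrite Rmult_1_l => d3; apply: is_derive_ext d3 => z.
  have := RInt_Chasles c 0 z (z + r) (ex _ _) (ex _ _).
  rewrite /plus /minus /opp /plus /=; lra.
- move=> s; apply: continuous_Rmult; first exact: continuous_const.
  by apply: (continuous_minus (V := R_NormedModule)).
- move=> s hs.
  have h1 : norm (RInt (fun z => minus (c z) (c s)) s (s + r)) <=
      (s + r - s) * / (INR n + 1).
    apply: (norm_RInt_le_const (V := R_NormedModule) (fun z => minus (c z) (c s))).
    + lra.
    + move=> z hz; apply: Rlt_le; apply: (hd s z); try lra.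
      rewrite /ball /= /AbsRing_ball /= /abs /minus /plus /opp /=; apply: Rabs_def1; lra.
    + apply: RInt_correct; apply: ex_RInt_minus => //; exact: ex_RInt_const.
  rewrite RInt_minus // in h1; last exact: ex_RInt_const.
  rewrite RInt_const in h1.
  have e1 : / r * RInt c s (s + r) - c s =
      / r * (RInt c s (s + r) - (s + r - s) * c s) by field; lra.
  rewrite e1 Rabs_mult Rabs_pos_eq; last by apply: Rlt_le; exact: Rinv_0_lt_compat.
  have h2 : Rabs (RInt c s (s + r) - (s + r - s) * c s) <= (s + r - s) * / (INR n + 1).
    exact: h1.
  have hir : 0 < / r by exact: Rinv_0_lt_compat.
  apply: Rle_trans (Rmult_le_compat_l _ _ _ (Rlt_le _ _ hir) h2) _.
  right; field; split; [have := pos_INR n; lra|lra].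
Qed.

(** Smooth approximations of [c] have responses in the range of [P 1]. Their preimages are Cauchy,
    since the preimage is bounded by the supremum of the input, and continuity of [P 1] identifies
    the limit. *)
Lemma scalar_admissible b t (c : R -> R) : 0 <= t -> (forall s, continuous c s) ->
  exists x, P 1 x = scalar_conv b t c.
Proof.
move=> ht hc.
have l1 : is_linear (P 1) by apply: npow_linear => //; lra.
have hex n : exists c1 x, (forall s, continuous c1 s) /\
    (forall s, 0 <= s <= t -> Rabs (c1 s - c s) <= / (INR n + 1)) /\
    P 1 x = scalar_conv b t c1.
  have [c1 [dc [h1 [h2 h3]]]] := mollify c t n ht hc.
  have [x hx] := scalar_conv_C1 b t c1 dc ht h1 h2.
  exists c1, x; split=> // s; apply: ex_derive_continuous; by exists (dc s).
pose c_ n := proj1_sig (constructive_indefinite_description _ (hex n)).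
have hex2 n : exists x, (forall s, continuous (c_ n) s) /\
    (forall s, 0 <= s <= t -> Rabs (c_ n s - c s) <= / (INR n + 1)) /\
    P 1 x = scalar_conv b t (c_ n).
  exact: (proj2_sig (constructive_indefinite_description _ (hex n))).
pose x_ n := proj1_sig (constructive_indefinite_description _ (hex2 n)).
have hx n : (forall s, continuous (c_ n) s) /\
    (forall s, 0 <= s <= t -> Rabs (c_ n s - c s) <= / (INR n + 1)) /\
    P 1 (x_ n) = scalar_conv b t (c_ n).
  exact: (proj2_sig (constructive_indefinite_description _ (hex2 n))).
have nb := norm_ge_0 b.
have pin n : 0 < / (INR n + 1) by apply: Rinv_0_lt_compat; have := pos_INR n; lra.
have csub (v w : R -> R) : (forall s, continuous v s) -> (forall s, continuous w s) ->
    forall s, continuous (fun s => v s - w s) s.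
  by move=> hv hw s; apply: (continuous_minus (V := R_NormedModule)).
have dist j k : norm (minus (x_ j) (x_ k)) <=
    (/ (INR j + 1) + / (INR k + 1)) * (2 * norm b).
  have [cj [bj ej]] := hx j; have [ck [bk ek]] := hx k.
  apply: (scalar_conv_bound b t (fun s => c_ j s - c_ k s)) => //.
  - exact: csub.
  - move=> s hs; have -> : c_ j s - c_ k s = (c_ j s - c s) + - (c_ k s - c s) by ring.
    apply: Rle_trans (Rabs_triang _ _) _; rewrite Rabs_Ropp.
    have := bj s hs; have := bk s hs; lra.
  - by rewrite (linear_minus _ _ _ l1) ej ek scalar_conv_minus.
have [x hlim] : exists x, filterlim x_ eventually (locally x).
  apply/filterlim_locally_cauchy => e.
  have he : 0 < e / (4 * (norm b + 1)).
    by apply: Rdiv_lt_0_compat; [exact: cond_pos|lra].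
  have [N hN] := inv_INR_small _ he.
  exists (fun n => (N <= n)%nat); split; first by exists N.
  move=> j k hj hk; apply: norm_compat1; apply: Rle_lt_trans (dist k j) _.
  have h1 := hN j hj; have h2 := hN k hk.
  have e1 : (e : R) = e / (4 * (norm b + 1)) * (4 * (norm b + 1)) by field; lra.
  rewrite e1; set z := e / _ in h1 h2 he *.
  have h3 : (/ (INR k + 1) + / (INR j + 1)) * (2 * norm b) <= 2 * z * (2 * norm b).
    by apply: Rmult_le_compat_r; lra.
  nra.
exists x; apply: norm_small_eq => e he.
have [M [hM bM]] := linear_norm _ l1.
have he1 : 0 < e / (2 * M) by apply: Rdiv_lt_0_compat; lra.
have tb : 0 <= t * norm b by apply: Rmult_le_pos.
have he2 : 0 < e / (2 * (t * norm b + 1)) by apply: Rdiv_lt_0_compat; lra.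
have [N hN] := inv_INR_small _ he2.
have [N' hN'] := proj1 (filterlim_normP _ _ _ _) hlim _ he1.
pose n := Nat.max N N'.
have h1 := hN n (Nat.le_max_l _ _); have h2 := hN' n (Nat.le_max_r _ _).
have [cn [bn en]] := hx n.
have h3 : norm (minus (P 1 x) (P 1 (x_ n))) <= e / 2.
  rewrite -(linear_minus _ _ _ l1); rewrite norm_minus_sym in h2.
  apply: Rle_trans (bM _) _.
  have -> : e / 2 = M * (e / (2 * M)) by field; lra.
  by apply: Rmult_le_compat_l; lra.
have h4 : norm (minus (scalar_conv b t (c_ n)) (scalar_conv b t c)) <= e / 2.
  rewrite -scalar_conv_minus //.
  apply: Rle_trans (scalar_conv_norm_le _ _ _ _ ht (csub _ _ cn hc) bn) _.
  have e1 : e / (2 * (t * norm b + 1)) * (t * norm b + 1) = e / 2 by field; lra.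
  have h5 : / (INR n + 1) * (t * norm b + 1) <= e / 2.
    by rewrite -e1; apply: Rmult_le_compat_r; lra.
  have := pin n; lra.
have := norm_triangle_mid _ (P 1 x) (P 1 (x_ n)) (scalar_conv b t c).
rewrite {2}en; nlra.
Qed.

(** * Orthogonal projections and reduction to scalar inputs *)

Fixpoint proj (F : list X) (v : X) : X :=
  match F with
  | nil => zero
  | cons f F' => plus (scal (ip v f) f) (proj F' v)
  end.

Lemma proj_plus F v w : proj F (plus v w) = plus (proj F v) (proj F w).
Proof.
elim: F => [|f F IH] /=; first by vec.
rewrite IH (ip_plus_l _ _ hip); vec.
Qed.

Lemma proj_scal F r v : proj F (scal r v) = scal r (proj F v).
Proof.
elim: F => [|f F IH] /=; first by vec.
rewrite IH (ip_scal_l _ _ hip); vec.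
Qed.

Lemma proj_orth F v f : (forall g, In g F -> ip g f = 0) -> ip (proj F v) f = 0.
Proof.
elim: F => [|g F IH] /= h.
  have -> : (zero : X) = scal 0 f by vec.
  rewrite (ip_scal_l _ _ hip); ring.
rewrite (ip_plus_l _ _ hip) (ip_scal_l _ _ hip) h; last by left.
rewrite IH; [ring|by move=> k hk; apply: h; right].
Qed.

(** The first clause says that [v - proj F v] is orthogonal to [F], which carries the induction; a
    vector with zero residual adds nothing to [F]. The coefficients [ip v f] depend continuously on
    [v], whereas coordinates in a spanning family may be neither unique nor continuous. *)
Lemma gram_schmidt (vs : list X) : exists F,
  (forall v f, In f F -> ip (proj F v) f = ip v f) /\
  forall v, In v vs -> proj F v = v.
Proof.
elim: vs => [|v vs [F [h1 h2]]]; first by exists nil.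
pose w := minus v (proj F v).
have worth f : In f F -> ip w f = 0.
  by move=> hf; rewrite /w (ip_minus_l _ _ hip) h1 //; ring.
have ev : v = plus w (proj F v) by rewrite /w; vec.
case: (Req_dec (norm w) 0) => hw.
  exists F; split=> // z [<-|]; last exact: h2.
  by rewrite {2}ev (norm_eq_zero _ hw) plus_zero_l.
pose f := scal (/ norm w) w.
have forth g : In g F -> ip g f = 0.
  move=> hg; rewrite (ip_sym _ _ hip) /f (ip_scal_l _ _ hip) worth //; ring.
have ff : ip f f = 1.
  rewrite /f (ip_scal_l _ _ hip) (ip_scal_r _ _ hip) (ip_norm _ _ hip); by field.
have wf : ip w f = norm w.
  rewrite /f (ip_scal_r _ _ hip) (ip_norm _ _ hip); by field.
exists (cons f F); split.
- move=> z g [<-|hg] /=; rewrite (ip_plus_l _ _ hip) (ip_scal_l _ _ hip).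
    rewrite ff proj_orth //; ring.
  rewrite (ip_sym _ _ hip f) (forth g hg) (h1 z g hg); ring.
- move=> z [<-|hz] /=.
    have -> : ip v f = norm w by rewrite {1}ev (ip_plus_l _ _ hip) proj_orth // wf; ring.
    rewrite {2}ev; f_equal; rewrite /f; vec.
  have -> : ip z f = 0 by rewrite -(h2 z hz) proj_orth.
  rewrite h2 //; vec.
Qed.

Lemma proj_cont F (w : R -> X) : (forall s, continuous w s) ->
  forall s, continuous (fun s => proj F (w s)) s.
Proof.
move=> hw s; elim: F => [|f F IH] /=; first exact: continuous_const.
apply: continuous_plus => //; apply: continuous_scal; last exact: continuous_const.
by apply: continuous_ip => //; exact: continuous_const.
Qed.

Lemma proj_admissible F (w : R -> X) t : 0 <= t -> (forall s, continuous w s) ->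
  exists x, P 1 x = RInt (fun s => T (t - s) (proj F (w s))) 0 t.
Proof.
move=> ht hw; have l1 : is_linear (P 1) by apply: npow_linear => //; lra.
elim: F => [|f F [x hx]] /=.
  exists zero; rewrite (linear_zero _ l1).
  rewrite (RInt_ext _ (fun _ => zero)); last first.
    by move=> s _; exact: (linear_zero _ (lin _)).
  by rewrite RInt_const; vec.
have cw s : continuous (fun s => ip (w s) f) s.
  by apply: continuous_ip => //; exact: continuous_const.
have [y hy] := scalar_admissible f t _ ht cw.
exists (plus y x); rewrite (linear_plus _ l1) hy hx /scalar_conv -RInt_plus.
- by apply: RInt_ext => s _; rewrite (linear_plus _ (lin _)) (linear_scal _ (lin _)).
- exact: (scalar_conv_ex f t (fun s => ip (w s) f)).
- apply: ex_RInt_cont => s; apply: (convolution_cont X ip T hip hT npow_1_sym).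
  exact: proj_cont.
Qed.

End ScalarInput.

(** * Restriction of scalars *)

Definition restrict_complete {k : RorC} (E : CompleteNormedModule (scalars k)) :
    CompleteNormedModule R_AbsRing :=
  CompleteNormedModule.Pack R_AbsRing E
    (CompleteNormedModule.Class R_AbsRing E
       (NormedModule.class R_AbsRing (restrict_scalars E))
       (CompleteNormedModule.mixin _ _ (CompleteNormedModule.class (scalars k) E)))
    E.

(** Keeps [vec] from looking through to the carrier over [scalars k]. *)
Arguments restrict_complete : simpl never.

Definition re (k : RorC) : scalars k -> R :=
  match k return scalars k -> R with
  | RealScalars => fun r => r
  | ComplexScalars => fun z => fst z
  end.

Lemma re_plus k a b : re k (plus a b) = re k a + re k b.
Proof. by case: k a b. Qed.

Lemma re_inj_mult k r a : re k (mult (inj k r) a) = r * re k a.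
Proof.
case: k a => [a|[a b]]; first reflexivity.
change (r * a - 0 * b = r * a); ring.
Qed.

Lemma re_inj k r : re k (inj k r) = r.
Proof. by case: k. Qed.

Lemma re_conj k a : re k (conj k a) = re k a.
Proof. by case: k a. Qed.

(** Turns a spanning family over [scalars k] into one over the reals, by adjoining the multiples by
    [i]. For real scalars [i = 0] is a mere default. *)
Lemma scalars_decomposition k : exists i : scalars k, forall c,
  exists a b, c = plus (inj k a) (mult (inj k b) i).
Proof.
case: k.
- exists (zero : R_AbsRing) => c; exists c, 0.
  have e (r : R) : r = r + 0 * 0 by ring.
  exact: e.
- exists (Ci : C_AbsRing) => -[a b]; exists a, b.
  change ((a, b) = Cplus (RtoC a) (Cmult (RtoC b) Ci)).
  rewrite /Cplus /Cmult /=; f_equal; ring.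
Qed.

(** The multipliers 1 and, for complex scalars, the imaginary unit suffice. This lifts identities
    for the real inner product to [inner]. *)
Lemma re_ext k (a b : scalars k) :
  (forall c, re k (mult c a) = re k (mult c b)) -> a = b.
Proof.
case: k a b => [|] a b h.
- have h1 : 1 * a = 1 * b by exact: (h (one : R_AbsRing)).
  have e (r s : R) : 1 * r = 1 * s -> r = s by lra.
  exact: e.
- have h1 : 1 * fst a - 0 * snd a = 1 * fst b - 0 * snd b by exact: (h (RtoC 1)).
  change (@eq C a b).
  have h2 : 0 * fst a - 1 * snd a = 0 * fst b - 1 * snd b by exact: (h Ci).
  apply: injective_projections; lra.
Qed.

Section Restrict.

Variable k : RorC.

Lemma restrict_linear (E F : CompleteNormedModule (scalars k)) (L : E -> F) :
  is_linear L ->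
  is_linear (U := restrict_complete E) (V := restrict_complete F) L.
Proof.
move=> hL; split; first exact: (linear_plus _ hL).
- by move=> r x; exact: (linear_scal _ hL (inj k r) x).
- exact: (linear_norm _ hL).
Qed.

Lemma scal_restrict_linear (E : CompleteNormedModule (scalars k)) (c : scalars k) :
  is_linear (U := restrict_complete E) (V := restrict_complete E) (fun x : E => scal c x).
Proof.
apply: (is_linear_intro (restrict_complete E) (restrict_complete E) _ (abs c)).
- by move=> x y; exact: (scal_distr_l c (x : E) y).
- move=> r x.
  have e : mult c (inj k r) = mult (inj k r) c.
    case: k c => [|] c; [exact: Rmult_comm|exact: Cmult_comm].
  change (scal c (scal (inj k r) (x : E)) = scal (inj k r) (scal c (x : E))).
  by rewrite !scal_assoc e.
- by move=> x; exact: norm_scal.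
Qed.

Definition rip (X : HilbertSpace k) (x y : X) : R := re k (inner x y).

Lemma rip_real_inner (X : HilbertSpace k) :
  real_inner (restrict_complete X) (rip X).
Proof.
split.
- by move=> x y z; rewrite /rip -re_plus; f_equal; exact: inner_plus_l.
- move=> r x y; rewrite /rip -re_inj_mult; f_equal.
  exact: (inner_scal_l k X (inj k r) x y).
- by move=> x y; rewrite /rip (inner_conj_sym k X x y) re_conj.
- by move=> x; rewrite /rip (inner_norm k X x) re_inj.
Qed.

(** The semigroup, extended by the identity to negative times, so that its
    orbits are continuous on the whole line. *)
Definition extended (E : CompleteNormedModule (scalars k)) (T : R -> E -> E)
    (t : R) : restrict_complete E -> restrict_complete E := T (Rmax 0 t).

Lemma extended_pos (E : CompleteNormedModule (scalars k)) (T : R -> E -> E) t x :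
  0 <= t -> extended E T t x = T t x.
Proof. by move=> ht; rewrite /extended Rmax_right. Qed.

Lemma extended_stable (E : CompleteNormedModule (scalars k)) (T : R -> E -> E) :
  C0_semigroup T -> exponentially_stable T ->
  stable_semigroup (restrict_complete E) (extended E T).
Proof.
move=> hT [M [w [hw hM]]].
have lin t : is_linear (extended E T t).
  apply: restrict_linear; apply: (sg_linear _ hT); exact: Rmax_l.
have e0 t x : t <= 0 -> extended E T t x = x.
  by move=> ht; rewrite /extended Rmax_left // (sg_zero _ hT).
have eadd s t x : 0 <= s -> 0 <= t ->
    extended E T (s + t) x = extended E T s (extended E T t x).
  by move=> hs ht; rewrite !extended_pos; try lra; exact: (sg_plus _ hT).
have bnd t x : norm (extended E T t x) <= (Rabs M + 1) * norm x.
  apply: Rle_trans (hM (Rmax 0 t) x (Rmax_l _ _)) _.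
  apply: Rmult_le_compat_r; first exact: norm_ge_0.
  have he : exp (- w * Rmax 0 t) <= 1.
    rewrite -exp_0; apply: exp_mono; have := Rmax_l 0 t; nra.
  have := exp_pos (- w * Rmax 0 t); have := Rle_abs M; have := Rabs_pos M; nra.
split=> //.
- move=> x t; apply/continuous_normP => e he.
  have hK : 0 < Rabs M + 1 by have := Rabs_pos M; lra.
  have he' : 0 < e / (Rabs M + 1) by apply: Rdiv_lt_0_compat.
  have h0 : filterlim (fun t => T t x : restrict_complete E) (at_right 0)
    (locally (x : restrict_complete E)) by exact: (sg_cont _ hT x).
  have [d [hd h]] := proj1 (at_right_0P _) (proj1 (filterlim_normP _ _ _ _) h0 _ he').
  (* Right continuity at 0 gives continuity from both sides: the difference is [T s] applied to
     [T (r - s) x - x], and [T s] is bounded uniformly in [s]. *)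
  have key s r : 0 <= s -> s <= r -> r - s < d ->
      norm (minus (extended E T r x) (extended E T s x)) < e.
    move=> hs hsr hrs; have [hlt|heq] := hsr; last first.
      rewrite heq; have -> : minus (extended E T r x) (extended E T r x) = zero by vec.
      by rewrite norm_zero.
    have -> : r = s + (r - s) by ring.
    rewrite eadd; try lra.
    rewrite -(linear_minus _ _ _ (lin s)).
    apply: Rle_lt_trans (bnd _ _) _.
    have h1 := h (r - s) ltac:(lra).
    have h2 := Rmult_lt_compat_l _ _ _ hK h1.
    rewrite extended_pos; last lra.
    have e1 : (Rabs M + 1) * (e / (Rabs M + 1)) = e by field; lra.
    by rewrite e1 in h2.
  exists d; split=> // s hs.
  have em r : extended E T r x = extended E T (Rmax 0 r) x.
    by rewrite /extended (Rmax_right 0 (Rmax 0 r)) //; exact: Rmax_l.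
  rewrite (em s) (em t).
  have p1 := Rmax_l 0 s; have p2 := Rmax_l 0 t.
  have hst : Rabs (Rmax 0 s - Rmax 0 t) < d.
    apply: Rle_lt_trans hs; rewrite /Rmax; do 2 case: Rle_dec => ?; split_Rabs; lra.
  move/Rabs_def2: hst => hst.
  case: (Rle_dec (Rmax 0 t) (Rmax 0 s)) => hle; first by apply: key; lra.
  by rewrite norm_minus_sym; apply: key; lra.
- exists M, w; split=> // t x ht; rewrite extended_pos //; exact: hM.
Qed.

End Restrict.

(** * Upper limits, comparison functions and extension of inputs *)

Lemma limsup_0_right_le (g : R -> R) (l : R) :
  (forall e, 0 < e -> exists d, 0 < d /\ forall h, 0 < h < d -> g h <= l + e) ->
  Rbar_le (limsup_0_right g) l.
Proof.
move=> hg; rewrite /limsup_0_right; set E := fun s : Rbar => _.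
have [lb _] : Rbar_is_glb E (Rbar_glb E) := proj2_sig (Rbar_ex_glb E).
have h e : 0 < e -> Rbar_le (Rbar_glb E) (l + e).
  move=> he; have [d [hd h]] := hg e he.
  apply: Rbar_le_trans (lb _ (ex_intro _ d (Logic.conj hd eq_refl))) _.
  have [_ lub] := Lub_Rbar_correct (fun v => exists h, 0 < h < d /\ v = g h).
  by apply: lub => v [s [hs ->]]; apply: h.
case E0 : (Rbar_glb E) h => [r| |] h //=.
- by apply: Rle_plus_epsilon => e he; have := h e he.
- by have := h 1 Rlt_0_1.
Qed.

Lemma K_infty_square (c : R) : 0 < c -> K_infty (fun r => c * r ^ 2).
Proof.
move=> hc; split.
- by move=> r hr; have := pow2_ge_0 r; nra.
- move=> r hr.
  have h : continuous (fun r => c * r ^ 2) r.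
    by apply: ex_derive_continuous; auto_derive.
  move=> Q hQ; apply: (filter_imp (F := locally r) (fun s => Q (c * s ^ 2))).
    by move=> s hs _.
  exact: (h Q hQ).
- by move=> r s hr hrs; apply: Rmult_lt_compat_l => //; nra.
- ring.
- apply: (is_lim_ext (fun r => c * (r * r))); first by move=> y; ring.
  have h := is_lim_mult (fun r => r) (fun r => r) p_infty p_infty p_infty
    (is_lim_id _) (is_lim_id _) I.
  have := is_lim_scal_l _ c _ _ h.
  rewrite /= /Rbar_mult /Rbar_mult' /=; case: Rle_dec => [H|]; last lra.
  by case: Rle_lt_or_eq_dec => // heq; lra.
Qed.

(** Inputs are given on an interval or a half-line; composing with a continuous map into that set
    makes them continuous on the whole line without changing them where the map is the identity. *)
Lemma continuous_on_retract {U : UniformSpace} (D : R -> Prop) (r : R -> R)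
    (u : R -> U) : (forall s, D (r s)) -> (forall s, continuous r s) ->
  continuous_on D u -> forall s, continuous (fun s => u (r s)) s.
Proof.
move=> hD hr hu s P hP; have h1 := hu (r s) (hD s) P hP.
have h2 := hr s _ h1.
apply: (filter_imp (F := locally s) (fun t => D (r t) -> P (u (r t)))) h2.
by move=> t ht; exact: ht.
Qed.

(** * Self-adjoint generators and the extrapolation space *)

Section SelfAdjoint.

Variables (k : RorC) (X : HilbertSpace k) (A : X -> X -> Prop) (T : R -> X -> X).
Hypothesis hA : self_adjoint A.
Hypothesis hT : C0_semigroup T.
Hypothesis hAT : generates A T.
Hypothesis hstab : exponentially_stable T.

Local Notation XR := (restrict_complete X).
Local Notation TR := (extended k X T).
Local Notation P := (npow (X := XR) TR).
Let hip := rip_real_inner k X.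
Let hTR := extended_stable k X T hT hstab.

Lemma generates_generator (y z : XR) : A y z <-> generator XR TR y z.
Proof.
have e h : 0 < h < 1 -> scal (inj k (/ h)) (minus (T h y) (y : X)) =
    scal (/ h) (minus (TR h y) (y : XR)).
  by move=> hh; rewrite extended_pos; [reflexivity|lra].
have near (Q : R -> Prop) : (forall h, 0 < h < 1 -> Q h) -> at_right 0 Q.
  by move=> hQ; apply/at_right_0P; exists 1; split; [lra|].
split.
- move=> /hAT h.
  apply: (filterlim_ext_loc (fun h => scal (inj k (/ h)) (minus (T h y) (y : X)))) h.
  exact: near.
- move=> h; apply/hAT.
  apply: (filterlim_ext_loc (fun h => scal (/ h) (minus (TR h y) (y : XR)))) h.
  by apply: near => h hh; rewrite e.
Qed.

Lemma generates_npow (y z : XR) : A y z <-> y = opp (P 1 z).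
Proof.
split.
- by move=> /generates_generator; exact: (generator_inv XR TR hTR).
- move=> ->; apply/generates_generator.
  have h := generator_npow_1 XR TR hTR (opp z).
  have l1 : is_linear (P 1) by apply: npow_linear => //; lra.
  rewrite (linear_opp _ _ l1) in h.
  have e : opp (opp z) = z by vec.
  rewrite e in h; exact: h.
Qed.

Lemma rip_npow_1 (x y : XR) : rip k X (P 1 x) y = rip k X x (P 1 y).
Proof.
have opp2 (z : XR) : P 1 z = opp (P 1 (opp z)).
  have l1 : is_linear (P 1) by apply: npow_linear => //; lra.
  rewrite (linear_opp _ _ l1); vec.
have ax : A (P 1 x) (opp (x : XR)) by apply/generates_npow; exact: opp2.
have ay : A (P 1 y) (opp (y : XR)) by apply/generates_npow; exact: opp2.
have h := proj1 (proj2 hA _ _) ay _ _ ax.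
have h2 : rip k X (opp (x : XR)) (P 1 y) = rip k X (P 1 x) (opp (y : XR)).
  by rewrite /rip; f_equal; exact: h.
rewrite (ip_opp_l XR _ hip) (ip_opp_r XR _ hip) in h2; lra.
Qed.

Lemma npow_scal a (c : scalars k) (x : X) : 0 <= a <= 1 ->
  P a (scal c x) = scal c (P a x : X).
Proof.
move=> ha; apply: (npow_comm XR TR hTR a (fun x : X => scal c x)) => //.
  exact: scal_restrict_linear.
move=> t y; symmetry; exact: (linear_scal _ (sg_linear _ hT _ (Rmax_l 0 t))).
Qed.

Lemma npow_k_linear a : 0 <= a <= 1 -> is_linear (P a : X -> X).
Proof.
move=> ha; have h := npow_linear XR TR hTR a ha; split.
- exact: (linear_plus _ h).
- by move=> c x; exact: npow_scal.
- exact: (linear_norm _ h).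
Qed.

(** The integral calculus gives symmetry for the real part only; as [P a] commutes with all scalars,
    testing against multiples [c] recovers the full inner product. *)
Lemma inner_npow a (x y : X) : 0 <= a <= 1 ->
  inner (P a x : X) y = inner x (P a y : X).
Proof.
move=> ha; apply: re_ext => c.
rewrite -!inner_scal_l -npow_scal //.
exact: (npow_sym XR _ TR hip hTR rip_npow_1 a _ _ ha).
Qed.

Lemma neg_frac_pow_npow a (x y : X) : 0 < a <= 1 ->
  neg_frac_pow T a x y <-> y = P a x.
Proof.
move=> ha; split.
- move=> [I [hI ->]]; rewrite npow_pos; last lra.
  have -> : power_integral (X := XR) TR a x = I; last by [].
  apply: power_integral_eq => //.
  apply: (improper_ext XR _ _ _ _ hI) => t ht.
  by rewrite extended_pos; [reflexivity|lra].
- move=> ->; exists (power_integral (X := XR) TR a x); split.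
    apply: (improper_ext XR _ _ _ _ (power_integralP XR TR hTR a x ha)) => t ht.
    by rewrite extended_pos; [reflexivity|lra].
  by rewrite npow_pos; [reflexivity|lra].
Qed.

Lemma frac_pow_npow_l a (x : X) : 0 <= a <= 1 -> frac_pow T (- a) x (P a x).
Proof.
move=> ha; case: (Req_dec a 0) => h0.
  by right; left; split; [lra|rewrite h0 npow_0].
left; split; first lra.
by rewrite Ropp_involutive; apply/neg_frac_pow_npow; [lra|].
Qed.

Lemma frac_pow_npow_r a (x : X) : 0 <= a <= 1 -> frac_pow T a (P a x) x.
Proof.
move=> ha; case: (Req_dec a 0) => h0.
  by right; left; split; [|rewrite h0 npow_0].
right; right; split; first lra.
by apply/neg_frac_pow_npow; [lra|].
Qed.

Variables (Xm1 : CompleteNormedModule (scalars k)) (i : X -> Xm1)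
  (Tm1 : R -> Xm1 -> Xm1).
Hypothesis hXm1 : is_extrapolation_space A Xm1 i.
Hypothesis hTm1 : is_extrapolated_semigroup i T Tm1.
Local Notation YR := (restrict_complete Xm1).

(** The identities [P 1 x = Ra x + P 1 (a * Ra x)] and [P 1 x = Ra (a * P 1 x) + Ra x] make the
    norms of [i x] and [P 1 x] equivalent. As both maps have dense range, the correspondence between
    [i x] and [P 1 x] extends in either direction: [J] is [(-A_{-1})^(-1)] and [K] its inverse. *)
Lemma extrapolation_isomorphism : exists (J : YR -> XR) (K : XR -> YR),
  is_linear J /\ is_linear K /\ (forall x, J (i x) = P 1 x) /\
  (forall z, K (J z) = z) /\ (forall x, J (K x) = x) /\
  forall t z, 0 <= t -> J (Tm1 t z) = TR t (J z).
Proof.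
have [hi [hd [a [Ra [[lRa hRa] hn]]]]] := hXm1.
have l1 : is_linear (P 1) by apply: npow_linear => //; lra.
have li := restrict_linear k X Xm1 i hi.
have [M1 [hM1 b1]] := linear_norm _ l1.
have [M2 [hM2 b2]] := linear_norm _ lRa.
have ha : 0 <= abs a by exact: abs_ge_0.
have le1 x : norm (P 1 x) <= (1 + M1 * abs a) * norm (i x : YR).
  have h : A (Ra x) (minus (scal a (Ra x)) x) by apply/hRa.
  move/generates_npow: h => h.
  have e : P 1 x = plus (Ra x : XR) (P 1 (scal a (Ra x) : X)).
    have h2 : (Ra x : XR) = opp (minus (P 1 (scal a (Ra x) : X)) (P 1 x)).
      rewrite -(linear_minus _ _ _ l1); exact: h.
    rewrite {1}h2; vec.
  rewrite e; apply: Rle_trans (norm_triangle _ _) _.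
  pose r := norm (Ra x); pose s := norm (scal a (Ra x) : X).
  pose p := norm (P 1 (scal a (Ra x) : X)).
  have h3 : p <= M1 * s by exact: b1.
  have h4 : s <= abs a * r by exact: norm_scal.
  have h5 := Rmult_le_compat_l _ _ _ (Rlt_le _ _ hM1) h4.
  have e2 : norm (i x : YR) = r by exact: hn.
  rewrite e2; change (r + p <= (1 + M1 * abs a) * r); lra.
have le2 x : norm (i x : YR) <= (1 + M2 * abs a) * norm (P 1 x).
  pose p : X := P 1 x.
  have ep : p = plus (Ra (scal a p)) (Ra x).
    rewrite -(linear_plus _ lRa); apply/hRa.
    apply/generates_npow.
    have -> : minus (scal a p) (plus (scal a p) x) = opp x :> X.
      by rewrite /minus opp_plus plus_assoc plus_opp_r plus_zero_l.
    have l := linear_opp _ (x : XR) l1.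
    have e : P 1 x = opp (opp (P 1 x)) by vec.
    by rewrite -l in e; exact: e.
  have er : Ra x = minus p (Ra (scal a p)).
    by rewrite {1}ep /minus (plus_comm (Ra (scal a p))) -plus_assoc plus_opp_r plus_zero_r.
  pose r := norm (Ra (scal a p)); pose s := norm (scal a p).
  have h1 : norm (Ra x) <= norm p + r.
    by rewrite er /minus; apply: Rle_trans (norm_triangle _ _) _; rewrite norm_opp; apply: Rle_refl.
  have h2 : r <= M2 * s by exact: b2.
  have h3 : s <= abs a * norm p by exact: norm_scal.
  have h5 := Rmult_le_compat_l _ _ _ (Rlt_le _ _ hM2) h3.
  have e2 : norm (i x : YR) = norm (Ra x) by exact: hn.
  rewrite e2; change (norm (Ra x) <= (1 + M2 * abs a) * norm p); lra.
have [J [lJ hJ]] := dense_extension XR YR XR i (P 1) _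
  (linear_plus _ li) (linear_scal _ li) (linear_plus _ l1) (linear_scal _ l1) le1
  ltac:(move=> y e he; have [z [[x ->] hx]] := hd y e he; by exists x).
have [K [lK hK]] := dense_extension XR XR YR (P 1) i _
  (linear_plus _ l1) (linear_scal _ l1) (linear_plus _ li) (linear_scal _ li) le2
  (npow_1_dense XR TR hTR).
have hdi (y : YR) e : 0 < e -> exists x : X, norm (minus y (i x : YR)) < e.
  by move=> he; have [z [[x ->] hx]] := hd y e he; exists x.
exists J, K; split=> //; split=> //; split=> //; split; last split.
- apply: (linear_dense_eq (V := YR) (W := YR) i (fun z => K (J z)) (fun z => z)) => //.
  + exact: (is_linear_comp J K lJ lK).
  + exact: is_linear_id.
  + by move=> x; rewrite hJ hK.
- apply: (linear_dense_eq (V := XR) (W := XR) (P 1) (fun z => J (K z)) (fun z => z)) => //.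
  + exact: (is_linear_comp K J lK lJ).
  + exact: is_linear_id.
  + exact: npow_1_dense.
  + by move=> x; rewrite hK hJ.
- move=> t z ht.
  have lT := restrict_linear k Xm1 Xm1 _ (sg_linear _ (proj1 hTm1) t ht).
  apply: (linear_dense_eq (V := YR) (W := XR) i (fun z => J (Tm1 t z)) (fun z => TR t (J z))) => //.
  + exact: (is_linear_comp _ J lT lJ).
  + exact: (is_linear_comp J _ lJ (ss_lin _ _ hTR t)).
  + move=> x; rewrite (proj2 hTm1 t x ht) hJ -(extended_pos k X T t x ht) hJ.
    by rewrite npow_sg //; lra.
Qed.

End SelfAdjoint.

(** * Admissibility in terms of the state space *)

Section Inputs.

Variables (k : RorC) (X : HilbertSpace k) (T : R -> X -> X).
Hypothesis hT : C0_semigroup T.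
Hypothesis hstab : exponentially_stable T.

Local Notation XR := (restrict_complete X).
Local Notation TR := (extended k X T).
Local Notation P := (npow (X := XR) TR).
Let hip := rip_real_inner k X.
Let hTR := extended_stable k X T hT hstab.
Hypothesis npow_1_sym : forall x y, rip k X (P 1 x) y = rip k X x (P 1 y).

Variables (Xm1 : CompleteNormedModule (scalars k)) (i : X -> Xm1)
  (Tm1 : R -> Xm1 -> Xm1).
Local Notation YR := (restrict_complete Xm1).
Variables (J : YR -> XR) (K : XR -> YR).
Hypothesis lJ : is_linear J.
Hypothesis lK : is_linear K.
Hypothesis Ji : forall x, J (i x) = P 1 x.
Hypothesis KJ : forall z, K (J z) = z.
Hypothesis JT : forall t z, 0 <= t -> J (Tm1 t z) = TR t (J z).

Lemma J_inj y z : J y = J z -> y = z.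
Proof. by move=> h; rewrite -(KJ y) h KJ. Qed.

(** The relation is read backwards, as [z = (-A)^(-a) y]: an integral of the semigroup, which the
    intertwining map [J] carries over to [X]. *)
Lemma frac_pow_J a (z y : Xm1) : 0 <= a <= 1 -> frac_pow Tm1 a z y ->
  J z = P a (J y).
Proof.
move=> ha [[h _]|[[-> ->]|[h [I [hI ->]]]]]; [lra|by rewrite npow_0|].
rewrite npow_pos //.
have -> : power_integral (X := XR) TR a (J y) = J I.
  apply: power_integral_eq => //; first lra.
  apply: (improper_ext XR _ _ _ _ (improper_linear YR XR J _ _ lJ hI)) => t ht.
  by rewrite -JT; [exact: (linear_scal _ lJ)|lra].
exact: (linear_scal _ lJ).
Qed.

Lemma frac_pow_inj a (z y y' : Xm1) : 0 <= a <= 1 -> frac_pow Tm1 a z y ->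
  frac_pow Tm1 a z y' -> y = y'.
Proof.
move=> ha h h'; apply: J_inj.
apply: (npow_inj XR _ TR hip hTR npow_1_sym a) => //.
by rewrite -(frac_pow_J a z y) // -(frac_pow_J a z y').
Qed.

Lemma input_integral_J (U : CompleteNormedModule (scalars k)) (B : U -> Xm1)
    (u : R -> U) t z : 0 <= t ->
  is_input_integral Tm1 B u t z <->
  is_RInt (V := XR) (fun s => TR (t - s) (J (B (u s)))) 0 t (J z).
Proof.
move=> ht; have e s : Rmin 0 t < s < Rmax 0 t ->
    J (Tm1 (t - s) (B (u s))) = TR (t - s) (J (B (u s))).
  by rewrite Rmin_left ?Rmax_right // => hs; apply: JT; lra.
split.
- move=> h; apply: (is_RInt_ext (V := XR) _ _ _ _ _ e).
  exact: (is_RInt_linear YR XR J lJ (fun s => Tm1 (t - s) (B (u s))) 0 t z h).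
- move=> h; have h2 := is_RInt_linear XR YR K lK _ 0 t _ h.
  rewrite KJ in h2.
  apply: (is_RInt_ext (V := YR) _ _ _ _ _ _ h2) => s hs.
  by rewrite -(e s hs) KJ.
Qed.

Lemma clamp_cont t s : continuous (fun s => Rmax 0 (Rmin t s)) s.
Proof. apply: continuous_Rmax; apply: continuous_Rmin; exact: continuous_id. Qed.

Lemma clamp_id t s : 0 <= s <= t -> Rmax 0 (Rmin t s) = s.
Proof. by move=> hs; rewrite Rmin_right ?Rmax_right; lra. Qed.

Lemma clamp_bounds t s : 0 <= t -> 0 <= Rmax 0 (Rmin t s) <= t.
Proof.
move=> ht; split; first exact: Rmax_l.
by apply: Rmax_lub => //; exact: Rmin_l.
Qed.

(** Under [J] the range of [i] becomes the range of [P 1]. Inputs on [[0, t]] correspond to inputs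
    on the whole line by clamping the time, which leaves the integral unchanged. *)
Lemma C_admissible_J (U : CompleteNormedModule (scalars k)) (B : U -> Xm1) :
  is_linear B ->
  C_admissible i Tm1 B <->
  forall t (u : R -> U), 0 <= t -> (forall s, continuous u s) ->
    exists x, P 1 x = RInt (V := XR) (fun s => TR (t - s) (J (B (u s)))) 0 t.
Proof.
move=> hB; split.
- move=> [_ h] t u ht hu.
  have [x hx] := h t u ht (continuous_on_forall _ _ (fun s _ => hu s)).
  exists x; rewrite -Ji; symmetry; apply: is_RInt_unique.
  by apply/input_integral_J.
- move=> h; split=> // t u ht hu.
  have hu' := continuous_on_retract (fun s => 0 <= s <= t) _ u
    (fun s => clamp_bounds t s ht) (clamp_cont t) hu.
  have [x hx] := h t _ ht hu'.
  exists x; apply/input_integral_J => //; rewrite Ji hx.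
  have lC : is_linear (U := restrict_complete U) (V := XR) (fun u => J (B u)).
    exact: (is_linear_comp _ J (restrict_linear k U Xm1 B hB) lJ).
  have cC s : continuous (fun s => J (B (u (Rmax 0 (Rmin t s))))) s.
    exact: (cont_C XR (restrict_complete U) _ lC _ hu').
  have ex : ex_RInt (V := XR)
      (fun s => TR (t - s) (J (B (u (Rmax 0 (Rmin t s)))))) 0 t.
    apply: ex_RInt_cont => s.
    exact: (convolution_cont XR _ TR hip hTR npow_1_sym
      (fun s => J (B (u (Rmax 0 (Rmin t s)))))).
  have hI := RInt_correct _ _ _ ex.
  apply: (is_RInt_ext (V := XR) _ _ _ _ _ _ hI) => s.
  by rewrite (Rmin_left 0 t) // (Rmax_right 0 t) // => hs; rewrite clamp_id //; lra.
Qed.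

Lemma frac_pow_k_linear (U : CompleteNormedModule (scalars k)) q
    (B AqB : U -> Xm1) : 0 <= q <= 1 -> bounded_into_frac_dom Tm1 q B ->
  (forall t, 0 <= t -> is_linear (Tm1 t)) ->
  (forall u, frac_pow Tm1 q (B u) (AqB u)) -> is_linear AqB.
Proof.
move=> hq [lB [_ [M hM]]] lT hAqB.
have l1 := npow_linear XR TR hTR q hq.
split.
- move=> u v; apply: J_inj.
  apply: (npow_inj XR _ TR hip hTR npow_1_sym q) => //.
  rewrite -(frac_pow_J q _ _ hq (hAqB _)) (linear_plus _ lB).
  have e : J (plus (AqB u) (AqB v)) = plus (J (AqB u)) (J (AqB v)).
    exact: (linear_plus _ lJ).
  rewrite e (linear_plus _ l1) -!(frac_pow_J q _ _ hq (hAqB _)).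
  exact: (linear_plus _ lJ).
(* [J] is known to be linear over the reals only, so a general scalar is moved inside the integral
   defining the power in [Xm1], and uniqueness of the power concludes. *)
- move=> c u; apply: (frac_pow_inj q (B (scal c u))) => //.
  rewrite (linear_scal _ lB).
  have [[h _]|[[h1 h2]|[h [I [hI hy]]]]] := hAqB u; first lra.
    by right; left; rewrite h2.
  right; right; split=> //; exists (scal c I); split.
    apply: (improper_ext YR _ _ _ _ (improper_linear YR YR (fun z : Xm1 => scal c z) _ _
      (scal_restrict_linear k Xm1 c) hI)) => t ht.
    rewrite (linear_scal _ (lT t (Rlt_le _ _ ht))).
    exact: (linear_scal _ (scal_restrict_linear k Xm1 c)).
  rewrite hy; exact: (linear_scal _ (scal_restrict_linear k Xm1 c)).
- exists (Rabs M + 1); split; first by have := Rabs_pos M; lra.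
  move=> u; have h := hM u _ (hAqB u).
  have := norm_ge_0 (B u); have := norm_ge_0 u; have := Rle_abs M; nra.
Qed.

Lemma finite_dim_admissible (U : CompleteNormedModule (scalars k)) (B : U -> Xm1) :
  is_linear B -> finite_dim U -> C_admissible i Tm1 B.
Proof.
move=> hB [n [e he]]; apply/C_admissible_J => // t u ht hu.
have [io hio] := scalars_decomposition k.
(* The real span of these vectors contains every [J (B v)]; hence the projection fixes all values of
   the transported input, although [J] is only real-linear. *)
pose vs := app (map (fun j => J (B (e j))) (seq 0 (S n)))
  (map (fun j => J (scal io (B (e j)))) (seq 0 (S n))).
have [F [_ hF]] := gram_schmidt XR _ hip vs.
have lC : is_linear (U := restrict_complete U) (V := XR) (fun u => J (B u)).
  exact: (is_linear_comp _ J (restrict_linear k U Xm1 B hB) lJ).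
have hfix v : proj XR (rip k X) F (J (B v)) = J (B v).
  have [c hc] := he v.
  have term j : (j <= n)%nat ->
      proj XR (rip k X) F (J (B (scal (c j) (e j)))) = J (B (scal (c j) (e j))).
    move=> hj; have hin : In j (seq 0 (S n)) by apply/in_seq; lia.
    have [a [b hab]] := hio (c j).
    have ej : J (B (scal (c j) (e j))) =
        plus (scal a (J (B (e j)))) (scal b (J (scal io (B (e j))))).
      rewrite (linear_scal _ hB) hab.
      have -> : scal (plus (inj k a) (mult (inj k b) io)) (B (e j)) =
          plus (scal (inj k a) (B (e j))) (scal (inj k b) (scal io (B (e j)))).
        by rewrite scal_distr_r scal_assoc.
      rewrite -!(linear_scal _ lJ); exact: (linear_plus _ lJ).
    rewrite ej (proj_plus XR _ hip) !(proj_scal XR _ hip) !hF //.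
    + apply: in_or_app; right; exact: (in_map (fun j => J (scal io (B (e j))))).
    + apply: in_or_app; left; exact: (in_map (fun j => J (B (e j)))).
  rewrite hc; elim: {-2}n (Nat.le_refl n) => [|m IH] hm.
    by rewrite sum_O; apply: term; lia.
  have es : J (B (sum_n (fun j => scal (c j) (e j)) (S m))) =
      plus (J (B (sum_n (fun j => scal (c j) (e j)) m))) (J (B (scal (c (S m)) (e (S m))))).
    rewrite sum_Sn (linear_plus _ hB); exact: (linear_plus _ lJ).
  by rewrite es (proj_plus XR _ hip) IH ?term //; lia.
have cw := cont_C XR (restrict_complete U) _ lC u hu.
have [x hx] := proj_admissible XR _ TR hip hTR npow_1_sym F _ t ht cw.
exists x; rewrite hx; apply: RInt_ext => s _; by rewrite hfix.
Qed.

End Inputs.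

(** * The Lyapunov property *)

Section Lyapunov.

Variables (k : RorC) (X : HilbertSpace k) (T : R -> X -> X).
Hypothesis hT : C0_semigroup T.
Hypothesis hstab : exponentially_stable T.

Local Notation XR := (restrict_complete X).
Local Notation TR := (extended k X T).
Local Notation P := (npow (X := XR) TR).
Let hip := rip_real_inner k X.
Let hTR := extended_stable k X T hT hstab.
Hypothesis npow_1_sym : forall x y, rip k X (P 1 x) y = rip k X x (P 1 y).

Variables (Xm1 : CompleteNormedModule (scalars k)) (i : X -> Xm1)
  (Tm1 : R -> Xm1 -> Xm1).
Local Notation YR := (restrict_complete Xm1).
Variables (J : YR -> XR) (K : XR -> YR).
Hypothesis lJ : is_linear J.
Hypothesis lK : is_linear K.
Hypothesis Ji : forall x, J (i x) = P 1 x.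
Hypothesis KJ : forall z, K (J z) = z.
Hypothesis JT : forall t z, 0 <= t -> J (Tm1 t z) = TR t (J z).

Variables (U : CompleteNormedModule (scalars k)) (q : R) (B AqB : U -> Xm1).
Hypothesis hq : 0 <= q <= 1 / 2.
Hypothesis lB : is_linear B.
Hypothesis hAqB : forall u, frac_pow Tm1 q (B u) (AqB u).
Hypothesis hadm : C_admissible i Tm1 AqB.

Let JB u : J (B u) = P q (J (AqB u)).
Proof. by apply: (frac_pow_J k X T hT hstab Xm1 Tm1 J lJ JT) => //; lra. Qed.

Let lC : is_linear (U := restrict_complete U) (V := XR) (fun u => J (AqB u)).
Proof. exact: (is_linear_comp _ J (restrict_linear k U Xm1 AqB (proj1 hadm)) lJ). Qed.

Let adm := proj1 (C_admissible_J k X T hT hstab npow_1_sym Xm1 i Tm1 J K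
  lJ lK Ji KJ JT U AqB (proj1 hadm)) hadm.

Lemma convolution_npow t (u : R -> U) : (forall s, continuous u s) ->
  RInt (V := XR) (fun s => TR (t - s) (J (B (u s)))) 0 t =
  P q (RInt (V := XR) (fun s => TR (t - s) (J (AqB (u s)))) 0 t).
Proof.
move=> hu; have lq : is_linear (P q) by apply: npow_linear => //; lra.
rewrite -(RInt_linear _ _ _ _ lq).
  by apply: RInt_ext => s _; rewrite JB npow_sg //; lra.
apply: ex_RInt_cont => s; apply: (convolution_cont XR _ TR hip hTR npow_1_sym).
exact: (cont_C XR (restrict_complete U) _ lC).
Qed.

Lemma admissible_B : C_admissible i Tm1 B.
Proof.
apply/(C_admissible_J k X T hT hstab npow_1_sym Xm1 i Tm1 J K lJ lK Ji KJ JT) => //.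
move=> t u ht hu; have [x hx] := adm t u ht hu.
exists (P q x); rewrite convolution_npow // -hx.
by apply: npow_npow_comm => //; lra.
Qed.

(** Both sides have the same image under the injective [P 1], because [P q] maps the transported
    response of [AqB] to that of [B]. The input is frozen at [u 0] for negative times, which the
    integral over [[0, h]] does not see. *)
Lemma mild_solution_split (x : X) (u : R -> U) (phi : R -> X) h :
  0 <= h -> continuous_on (fun s => 0 <= s) u ->
  is_mild_solution i T Tm1 B x u phi ->
  exists z, phi h = plus (TR h x) (P q z) /\
    P 1 z = RInt (V := XR) (fun s => TR (h - s) (J (AqB (u (Rmax 0 s))))) 0 h.
Proof.
move=> hh hu hphi.
have hu' := continuous_on_retract (fun s => 0 <= s) (Rmax 0) u (Rmax_l 0)
  (fun s => continuous_Rmax 0 (fun s => s) s (continuous_id s)) hu.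
have [z hz] := adm h _ hh hu'; exists z; split=> //.
have [w [hw1 hw2]] := hphi h hh.
have hw3 := proj1 (input_integral_J k X T Xm1 Tm1 J K lJ lK KJ JT U B u h w hh) hw1.
have hw4 : is_RInt (V := XR) (fun s => TR (h - s) (J (B (u (Rmax 0 s))))) 0 h (J w).
  apply: (is_RInt_ext (V := XR) _ _ _ _ _ _ hw3) => s.
  rewrite (Rmin_left 0 h) // => hs; rewrite (Rmax_right 0 s) //; lra.
have l1 : is_linear (P 1) by apply: npow_linear => //; lra.
apply: (npow_1_inj XR TR hTR); rewrite -Ji hw2.
have e : J (plus (i (T h x)) w) = plus (J (i (T h x))) (J w) by exact: (linear_plus _ lJ).
rewrite e Ji -(is_RInt_unique _ _ _ _ hw4) (convolution_npow h _ hu') -hz.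
rewrite -(extended_pos k X T h x hh) (linear_plus _ l1); f_equal.
by apply: npow_npow_comm => //; lra.
Qed.

Lemma energy_lyapunov : quadratic_L2_ISS_Lyapunov i T Tm1 B (energy XR TR q).
Proof.
pose a := 1 / 2 - q.
have ha : 0 <= a <= 1 by rewrite /a; lra.
have la := npow_linear XR TR hTR a ha.
have [M [hM bM]] := linear_norm _ la.
have hs2 : 0 < sqrt (1 / 2) by apply: sqrt_lt_R0; lra.
split.
- exact: admissible_B.
- move=> x; apply: (continuous_mult (K := R_AbsRing) (fun _ : XR => 1 / 2)
    (fun x : XR => norm (P a x) ^ 2)); first exact: continuous_const.
  apply: (continuous_comp (fun x : XR => norm (P a x)) (fun r => r ^ 2)).
    apply: (continuous_comp (P a) norm); first exact: linear_cont.
    exact: filterlim_norm.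
  by apply: ex_derive_continuous; auto_derive.
(* The factor [1 / 2] of the energy is absorbed into the operator as [sqrt (1 / 2)]. *)
- exists (fun x : X => scal (inj k (sqrt (1 / 2))) (P a x : X)); split; last split.
  + have lF := npow_k_linear k X T hT hstab a ha.
    apply: (is_linear_comp (V := X) _ (fun y : X => scal (inj k (sqrt (1 / 2))) y) lF).
    apply: is_linear_scal_r => c d.
    by case: (k) c d => c d; [exact: Rmult_comm|exact: Cmult_comm].
  + move=> x y h; apply: (npow_inj XR _ TR hip hTR npow_1_sym a _ _ ha).
    have h2 : scal (sqrt (1 / 2)) (P a x) = scal (sqrt (1 / 2)) (P a y) by exact: h.
    have e (z : XR) : z = scal (/ sqrt (1 / 2)) (scal (sqrt (1 / 2)) z) by vec.
    by rewrite (e (P a x)) h2 -e.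
  + move=> x; rewrite /energy.
    have e : norm (scal (inj k (sqrt (1 / 2))) (P a x : X)) =
        sqrt (1 / 2) * norm (P a x).
      rewrite -{2}(Rabs_pos_eq _ (Rlt_le _ _ hs2)).
      exact: (norm_scal_eq XR (sqrt (1 / 2)) (P a x)).
    by rewrite e Rpow_mult_distr pow2_sqrt //; lra.
- have hc : 0 < 1 / 2 * M ^ 2 by have := pow_lt M 2 hM; lra.
  exists (fun r => 1 / 2 * M ^ 2 * r ^ 2); split; first exact: K_infty_square.
  move=> x hx; rewrite /energy -/a; split.
    have hp : 0 < norm (P a x).
      apply: norm_gt_0 => h0; apply: hx.
      apply: (npow_inj XR _ TR hip hTR npow_1_sym a _ _ ha).
      by rewrite h0; symmetry; exact: (linear_zero _ la).
    have := pow_lt _ 2 hp; lra.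
  have h1 : norm (P a x) ^ 2 <= (M * norm x) ^ 2.
    by apply: pow_incr; split; [exact: norm_ge_0|exact: bM].
  rewrite Rpow_mult_distr in h1; lra.
- have [c [hc hdec]] := energy_decay XR _ TR hip hTR npow_1_sym q hq.
  have [C1 [K1 [hC1 [hK1 hbd]]]] := admissible_bound XR _ TR hip hTR npow_1_sym
    (restrict_complete U) _ lC (fun u => adm 1 u Rle_0_1).
  pose D := 1 / 2 * (C1 * C1 + K1 * C1).
  have hD : 0 <= D by rewrite /D; nra.
  (* [D] may vanish, whereas the gain has to be positive. *)
  exists c, (D + 1); split=> //; split; first lra.
  move=> x u phi hu hphi; apply: limsup_0_right_le => e he.
  pose nx := norm x; pose nu := norm (u 0).
  have hnx : 0 <= nx by exact: norm_ge_0.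
  have hnu : 0 <= nu by exact: norm_ge_0.
  (* Collects the coefficients of [eta] in the error: [2 * c * nx] from [norm (T h x) >= nx - eta],
     and [2 * D * nu + D] from [D * (nu + eta) ^ 2] with [eta <= 1]. The final 1 makes [S]
     positive. *)
  pose S := 2 * c * nx + 2 * D * nu + D + 1.
  have hS : 0 < S by rewrite /S; nra.
  pose eta := Rmin 1 (e / S).
  have heta : 0 < eta by apply: Rmin_glb_lt; [lra|exact: Rdiv_lt_0_compat].
  have heta1 : eta <= 1 by exact: Rmin_l.
  have heta2 : eta * S <= e.
    have -> : e = e / S * S by field; lra.
    by apply: Rmult_le_compat_r; [lra|exact: Rmin_r].
  have hu' := continuous_on_retract (fun s => 0 <= s) (Rmax 0) u (Rmax_l 0)
    (fun s => continuous_Rmax 0 (fun s => s) s (continuous_id s)) hu.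
  have [d1 [hd1 h1]] := proj1 (continuous_normP (restrict_complete U) _ 0) (hu' 0) eta heta.
  have [d2 [hd2 h2]] := proj1 (continuous_normP XR _ 0) (ss_cont _ _ hTR x 0) eta heta.
  pose d := Rmin 1 (Rmin d1 d2).
  have hd : 0 < d by apply: Rmin_glb_lt; [lra|apply: Rmin_glb_lt].
  have hda : d <= 1 by exact: Rmin_l.
  have hdb : d <= d1 by apply: Rle_trans (Rmin_r _ _) _; exact: Rmin_l.
  have hdc : d <= d2 by apply: Rle_trans (Rmin_r _ _) _; exact: Rmin_r.
  exists d; split=> // h hh.
  have [z [hz1 hz2]] := mild_solution_split x u phi h ltac:(lra) hu hphi.
  have hm s : 0 <= s <= h -> norm (u (Rmax 0 s) : restrict_complete U) <= nu + eta.
    move=> hs; have k1 := h1 s ltac:(rewrite Rminus_0_r Rabs_pos_eq; lra).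
    have k2 := norm_le_minus _ (u (Rmax 0 s) : restrict_complete U) (u (Rmax 0 0)).
    have k3 : norm (u (Rmax 0 0) : restrict_complete U) = nu by rewrite Rmax_left //; lra.
    rewrite k3 in k2; apply: Rle_trans k2 _.
    have k4 := Rlt_le _ _ k1; have := Rplus_le_compat_r nu _ _ k4.
    by rewrite (Rplus_comm eta).
  have [b1 b2] := hbd h _ z (nu + eta) ltac:(lra) hu' hm hz2.
  have k0 := hdec C1 K1 hC1 hK1 h x z (nu + eta) ltac:(lra) ltac:(lra) b1 b2.
  rewrite -hz1 -/D in k0; apply: Rle_trans k0 _.
  have k1 := h2 h ltac:(rewrite Rminus_0_r Rabs_pos_eq; lra).
  rewrite (ss_neg _ _ hTR 0) in k1; last lra.
  have k2 := norm_le_minus _ (x : XR) (TR h x); rewrite norm_minus_sym in k2.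
  have k3 : nx - eta <= norm (TR h x).
    have k21 : nx <= norm (minus (TR h x) (x : XR)) + norm (TR h x) by exact: k2.
    have k22 : norm (minus (TR h x) (x : XR)) < eta by exact: k1.
    lra.
  have k4 := norm_ge_0 (TR h x); set y := norm (TR h x) in k3 k4 *.
  have k5 : nx ^ 2 - 2 * eta * nx <= y ^ 2.
    case: (Rle_dec eta nx) => hle; last nra.
    have : (nx - eta) ^ 2 <= y ^ 2 by apply: pow_incr; lra.
    nra.
  have k6 : c * (nx ^ 2 - 2 * eta * nx) <= c * y ^ 2 by apply: Rmult_le_compat_l; lra.
  have k7 : D * (eta * eta) <= D * eta by apply: Rmult_le_compat_l => //; nra.
  change (- c * y ^ 2 + D * (nu + eta) ^ 2 <= - c * nx ^ 2 + (D + 1) * nu ^ 2 + e).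
  have := pow2_ge_0 nu; rewrite /S in heta2; nra.
Qed.

End Lyapunov.

Theorem theorem4 (k : RorC) (X : HilbertSpace k)
    (U : CompleteNormedModule (scalars k))
    (A : X -> X -> Prop) (T : R -> X -> X)
    (hA : self_adjoint A)
    (hT : C0_semigroup T) (hAT : generates A T)
    (hstab : exponentially_stable T)
    (Xm1 : CompleteNormedModule (scalars k)) (i : X -> Xm1)
    (hXm1 : is_extrapolation_space A Xm1 i)
    (Tm1 : R -> Xm1 -> Xm1)
    (hTm1 : is_extrapolated_semigroup i T Tm1)
    (q : R) (hq : 0 <= q <= 1 / 2)
    (B : U -> Xm1) (hB : bounded_into_frac_dom Tm1 q B)
    (AqB : U -> Xm1) (hAqB : forall u, frac_pow Tm1 q (B u) (AqB u)) :
  (C_admissible i Tm1 AqB ->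
   exists W : X -> R,
     (forall x : X,
        is_energy_integral T q x (W x) /\
        (exists y, frac_pow T (2 * q - 1) x y /\
           inj k (W x) = mult (inj k (1 / 2)) (inner x y)) /\
        (exists z, frac_pow T (q - 1 / 2) x z /\
           W x = 1 / 2 * norm z ^ 2)) /\
     quadratic_L2_ISS_Lyapunov i T Tm1 B W /\
     (q = 1 / 2 -> coercive W /\ forall x, W x = 1 / 2 * norm x ^ 2)) /\
  (finite_dim U -> C_admissible i Tm1 AqB).
Proof.
have [J [K [lJ [lK [Ji [KJ [_ JT]]]]]]] :=
  extrapolation_isomorphism k X A T hT hAT hstab Xm1 i Tm1 hXm1 hTm1.
have hs := rip_npow_1 k X A T hA hT hAT hstab.
have hip := rip_real_inner k X.
have hTR := extended_stable k X T hT hstab.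
set XR := restrict_complete X in J K lJ lK Ji KJ JT hs hip hTR.
set TR := extended k X T in lJ lK Ji KJ JT hs hip hTR.
split; last first.
  apply: (finite_dim_admissible k X T hT hstab hs Xm1 i Tm1 J K lJ lK Ji KJ JT).
  apply: (frac_pow_k_linear k X T hT hstab hs Xm1 Tm1 J K lJ KJ JT U q B AqB) => //.
    lra.
  exact: (sg_linear _ (proj1 hTm1)).
move=> hadm; exists (energy XR TR q); split; last split.
- move=> x; split; last split.
  + exists (fun t => smoothed XR TR q t x); split.
      move=> t ht.
      have h := npow_smoothed XR _ TR hip hTR hs q hq t x ht.
      have e : TR t x = T t x by apply: extended_pos; lra.
      rewrite -e -h; apply: (frac_pow_npow_r k X T hT hstab); lra.
    exact: (energy_integral XR _ TR hip hTR hs q hq x).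
  + exists (npow TR (1 - 2 * q) x); split.
      have -> : 2 * q - 1 = - (1 - 2 * q) by ring.
      by apply: (frac_pow_npow_l k X T hT hstab); lra.
    (* Splitting the exponent evenly lets one half cross the inner product, which turns it into the
       square of a norm. *)
    have e : npow TR (1 - 2 * q) x = npow TR (1 / 2 - q) (npow TR (1 / 2 - q) x).
      rewrite (npow_add XR _ TR hip hTR hs); try lra; f_equal; field.
    rewrite e -(inner_npow k X A T hA hT hAT hstab); last lra.
    by rewrite inner_norm -inj_mult.
  + exists (npow TR (1 / 2 - q) x); split; last by [].
    have -> : q - 1 / 2 = - (1 / 2 - q) by ring.
    by apply: (frac_pow_npow_l k X T hT hstab); lra.
- exact: (energy_lyapunov k X T hT hstab hs Xm1 i Tm1 J K lJ lK Ji KJ JT U q B AqB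
    hq (proj1 hB) hAqB hadm).
- move=> hq2.
  have e (x : X) : energy XR TR q x = 1 / 2 * norm x ^ 2.
    by rewrite /energy hq2 Rminus_diag npow_0; reflexivity.
  split; last exact: e.
  exists (1 / 2), (1 / 2); split; first lra; split; first lra.
  by move=> x; rewrite e; lra.
Qed.
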